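(* Up to projective equivalence, there are exactly two nonlinear null curves $g:\mathbb{P}^1\to\mathbb{Q}^3$ of degree $6$. One of these is unbranched, and the other has two distinct branch points, each of order $1$.
   Context: $\langle\,,\rangle$ is a nondegenerate symmetric complex bilinear form on a $5$-dimensional complex vector space $W$, and $\mathbb{Q}^3=\{[w]\in\mathbb{P}(W):\langle w,w\rangle=0\}\subset\mathbb{P}(W)\simeq\mathbb{P}^4$ is the corresponding smooth quadric. Curves are holomorphic maps. A holomorphic curve $g:S\to\mathbb{Q}^3$ from a connected Riemann surface $S$ is a null curve if its tangent lines lie in $\mathbb{Q}^3$; equivalently, for local holomorphic nonvanishing lifts $G$ with $g=[G]$, one has $\langle G,G\rangle=\langle G,dG\rangle=\langle dG,dG\rangle=0$. It is nonlinear if its image is not contained in a linear $\mathbb{P}^1\subset\mathbb{P}(W)$. For compact $S$, the degree of a nonconstant $g$ is its degree as a map to $\mathbb{P}^4$: the number of points, counted with multiplicity, of the preimage of a hyperplane not containing the image. A point $p$ is a branch point of $g$ of order $r>0$ if the differential of $g$ vanishes at $p$ to order exactly $r$; $g$ is unbranched if it has no branch points, i.e., if it is an immersion. Two null curves $g,\tilde g:\mathbb{P}^1\to\mathbb{Q}^3$ are projectively equivalent if $\tilde g=A\circ g\circ\varphi$ for some projective transformation $A$ of $\mathbb{P}(W)$ preserving $\mathbb{Q}^3$ and some automorphism $\varphi$ of $\mathbb{P}^1$ (reparametrization). *)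

(* Defs.v *)
From mathcomp Require Import all_boot all_order all_algebra sesquilinear.
From mathcomp Require Export complex.
From mathcomp Require Import all_classical reals topology normedtype derive.
Set Implicit Arguments.
Unset Strict Implicit.
Unset Printing Implicit Defensive.
Import Order.TTheory GRing.Theory Num.Theory.
Import numFieldNormedType.Exports.
Local Open Scope classical_set_scope.
Local Open Scope ring_scope.

(* Everything below is stated over a [numFieldType] [C]; it is meant to be used
   with [C := R[i]] for a [realType] [R], where [derivable f z 1] is complex
   differentiability of [f] at [z]. *)

Section Holomorphy.
Variables (C : numFieldType) (W : vectType C).

Definition holomorphic_near (f : C -> C) (z0 : C) : Prop :=
  \forall z \near z0, derivable f z 1.

Definition wcoord (G : C -> W) (i : 'I_(\dim {:W})) : C -> C :=
  fun z => coord (vbasis {:W}) i (G z).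

(* A vector-valued map is holomorphic when its coordinates are; [W] carries no
   topology of its own, and the choice of basis is irrelevant. *)
Definition wholomorphic_near (G : C -> W) (z0 : C) : Prop :=
  forall i, holomorphic_near (wcoord G i) z0.

Definition wderive (G : C -> W) (z : C) : W :=
  \sum_(i < \dim {:W}) derive1 (wcoord G i) z *: (vbasis {:W})`_i.

Definition vanishing_order (h : C -> C) (z0 : C) (m : nat) : Prop :=
  exists u : C -> C,
    [/\ holomorphic_near u z0, u z0 != 0
      & \forall z \near z0, h z = (z - z0) ^+ m * u z].

Definition wvanishing_order (H : C -> W) (z0 : C) (m : nat) : Prop :=
  exists U : C -> W,
    [/\ wholomorphic_near U z0, U z0 != 0
      & \forall z \near z0, H z = (z - z0) ^+ m *: U z].

End Holomorphy.

(* P(W): the lines through the origin of [W]. *)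
Notation projective_space W := {L : {vspace W} | \dim L == 1%N}.

Notation P1 C := (projective_space 'rV[C]_2).

Section ProjectiveLine.
Variable C : numFieldType.

(* Homogeneous coordinates [1 : z] (b = false) and [z : 1] (b = true). *)
Definition chart_vec (b : bool) (z : C) : 'rV[C]_2 :=
  \row_i (if i == b :> nat then 1 else z).

Lemma chart_vec_dim (b : bool) (z : C) : \dim <[chart_vec b z]>%VS == 1%N.
Proof.
rewrite dim_vline eqb1; apply/eqP => /rowP E.
have lt_b2 : (b < 2)%N by case: b {E}.
by have /eqP := E (Ordinal lt_b2); rewrite !mxE eqxx oner_eq0.
Qed.

(* The two standard affine charts C -> P^1, which together cover P^1. *)
Definition chart (b : bool) (z : C) : P1 C :=
  exist (fun L : {vspace 'rV[C]_2} => \dim L == 1%N) _ (chart_vec_dim b z).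

End ProjectiveLine.

Section Curves.
Variables (C : numFieldType) (W : vectType C).
Implicit Types (g : P1 C -> projective_space W) (lam : 'Hom(W, C^o)).

(* [G] is a holomorphic nonvanishing lift of [g], read in the chart [b], near
   the point of coordinate [z0]. *)
Definition local_lift g (b : bool) (z0 : C) (G : C -> W) : Prop :=
  wholomorphic_near G z0 /\
  \forall z \near z0, G z != 0 /\ val (g (chart b z)) = <[G z]>%VS.

Definition holomorphic_curve g : Prop :=
  forall b z0, exists G : C -> W, local_lift g b z0 G.

(* A linear P^1 in P(W) is the projectivization of a 2-dimensional subspace. *)
Definition nonlinear g : Prop :=
  ~ exists L : {vspace W}, \dim L = 2%N /\ forall p, (val (g p) <= L)%VS.

(* Multiplicity of [p] in the preimage under [g] of the hyperplane
   [lam = 0]. *)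
Definition hyperplane_mult g lam (p : P1 C) (m : nat) : Prop :=
  exists b z0 (G : C -> W),
    [/\ p = chart b z0, local_lift g b z0 G
      & vanishing_order (fun z => lam (G z)) z0 m].

(* The preimage of every hyperplane [lam = 0] not containing the image of [g]
   is finite and has exactly [d] points, counted with multiplicity. *)
Definition has_degree g (d : nat) : Prop :=
  forall lam, (exists p, ~~ (val (g p) <= lker lam)%VS) ->
    exists (s : seq (P1 C)) (m : P1 C -> nat),
      [/\ uniq s,
          forall p, (p \in s) = (val (g p) <= lker lam)%VS,
          {in s, forall p, hyperplane_mult g lam p (m p)}
        & (\sum_(p <- s) m p)%N = d].

(* A lift normalized by [lam (G z) = 1] is [g] written in the affine chart
   [lam != 0] of P(W), so [wderive G] is the differential of [g] there. *)
Definition branch_point g (p : P1 C) (r : nat) : Prop :=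
  (0 < r)%N /\
  exists b z0 (G : C -> W) lam,
    [/\ p = chart b z0, local_lift g b z0 G,
        \forall z \near z0, lam (G z) = 1
      & wvanishing_order (wderive G) z0 r].

Definition unbranched g : Prop := forall p r, ~ branch_point g p r.

Variable form : {symmetric W}.

Definition in_quadric (p : projective_space W) : Prop :=
  forall w, w \in val p -> form w w = 0.

Definition null_curve g : Prop :=
  [/\ holomorphic_curve g,
      forall p, in_quadric (g p)
    & forall b z0 (G : C -> W), local_lift g b z0 G ->
        [/\ form (G z0) (G z0) = 0, form (G z0) (wderive G z0) = 0
          & form (wderive G z0) (wderive G z0) = 0]].

End Curves.

Definition P1_automorphism (C : numFieldType) (phi : P1 C -> P1 C) : Prop :=
  exists psi : P1 C -> P1 C,
    [/\ cancel phi psi, cancel psi phi,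
        holomorphic_curve phi & holomorphic_curve psi].

Definition projectively_equivalent (C : numFieldType) (W : vectType C)
    (form : {symmetric W}) (g g' : P1 C -> projective_space W) : Prop :=
  exists (A : 'End(W)) (phi : P1 C -> P1 C),
    [/\ lker A == 0%VS,
        forall w, form (A w) (A w) = 0 <-> form w w = 0,
        P1_automorphism phi
      & forall p, val (g' p) = (A @: val (g (phi p)))%VS].

(* Main.v *)
(* A holomorphic curve of degree d has a polynomial lift of degree d, by a Liouville theorem:
   the ratio of two coordinates, divided by the rational function with the same divisor, is an
   entire function with a finite limit at infinity. The maximum principle makes it constant;
   the second-order expansions this requires come from the vanishing orders in the definition
   of the degree.

   For a polynomial lift P with coefficients p_0, ..., p_6, nullity says that
   <P(z), P(w)> = (z - w)^4 C(z, w) with C symmetric of bidegree (2, 2). The Gram matrix of the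
   p_i has rank at most 5, which forces C(z, z) to have at least two distinct roots. Once these
   are moved to 0 and infinity, the rank condition makes the Gram matrix antidiagonal and
   leaves only two such matrices up to scaling, each determining the curve up to an isometry:
     h_0 + h_1 z + r h_2 z^3 - (9/4) h_3 z^5 + h_4 z^6   (2 r^2 = 5), unbranched;
     h_0 + h_1 z^2 + 4 h_2 z^3 - 9 h_3 z^4 + h_4 z^6, branched at 0 and infinity,
   where <h_i, h_j> = 1 if i + j = 4 and 0 otherwise. *)
Require Import Defs.
From mathcomp Require Import all_boot all_order all_algebra sesquilinear.
From mathcomp Require Import all_classical reals topology normedtype derive.
From HB Require Import structures.
From mathcomp Require Import ring lra zify.
Set Implicit Arguments.
Unset Strict Implicit.
Unset Printing Implicit Defensive.
Import Order.TTheory GRing.Theory Num.Theory.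
Import numFieldNormedType.Exports.
Local Open Scope classical_set_scope.
Local Open Scope ring_scope.

(** * Derivatives and a Liouville theorem *)

(** Why there are two distinct roots: [C(z, z)] is a binary quartic, so it has a root. A fourfold
    root placed at infinity would leave a nonzero constant, and the rank condition then forces
    [p_6 = 0], which a lift of degree 6 excludes. Ranks are bounded without large determinants: five
    or six coefficients are paired triangularly with others. Branch points are read off two
    coordinates. In either chart some two linear forms restrict to [1] and [a z^k] on the lift, with
    [k = 1] for one model and [k = 2] for the other, and they control the vanishing of the
    derivative of every lift. Inequivalence is not deduced from branching, which would require
    transforming derivatives under an automorphism of the line given only as a biholomorphic
    bijection. It rests on the point sets cut out by hyperplanes, which any bijection transports. On
    the unbranched curve hyperplanes restrict to [z^6] and [z^5 (z - 1)], but none meets the curve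
    at [1] alone; the missing powers [z] and [z^5] forbid such a configuration on the other
    curve. *)

Section Derivatives.
Variable C : numFieldType.
Implicit Types f k : C -> C.

Lemma derivable_continuous f z : derivable f z 1 -> {for z, continuous f}.
Proof. by move=> /derivable1_diffP/differentiable_continuous. Qed.

Lemma derivable_comp f k z : derivable f z 1 -> derivable k (f z) 1 ->
  derivable (k \o f) z 1.
Proof.
by move=> /derivable1_diffP df /derivable1_diffP dk; apply/derivable1_diffP/differentiable_comp.
Qed.

Lemma derivable_hornerC (p : {poly C}) z : derivable (horner p) z 1.
Proof.
elim/poly_ind: p => [|p r ih].
  rewrite (_ : horner 0 = cst 0); first exact: derivable_cst.
  by apply/funext => y; rewrite horner0.
rewrite (_ : horner _ = horner p * id + cst r).
  by apply: derivableD; [apply: derivableM|apply: derivable_cst].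
by apply/funext => y; rewrite !hornerE.
Qed.

Lemma derive1_hornerC (p : {poly C}) z : derive1 (horner p) z = p^`().[z].
Proof.
elim/poly_ind: p => [|p r ih].
  rewrite (_ : horner 0 = cst 0) ?derive1_cst ?deriv0 ?horner0//.
  by apply/funext => y; rewrite horner0.
rewrite (_ : horner _ = horner p * id + cst r); last first.
  by apply/funext => y; rewrite !hornerE.
rewrite derive1E deriveD; last 2 first.
- by apply: derivableM; [apply: derivable_hornerC|apply: derivable_id].
- exact: derivable_cst.
rewrite deriveM; last 2 first.
- exact: derivable_hornerC.
- exact: derivable_id.
by rewrite derive_cst derive_id -derive1E ih derivMXaddC !hornerE/= /GRing.scale/=; ring.
Qed.

(* Caratheodory's form of differentiability. *)
Lemma derivable_slope f z : derivable f z 1 ->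
  exists k, [/\ {for z, continuous k}, k z = derive1 f z
    & forall w, f w = f z + (w - z) * k w].
Proof.
move=> df; pose d h := h^-1 *: (f (h + z) - f z).
have dE : (fun h => h^-1 *: ((f \o shift z) (h *: 1) - f z)) = d.
  by apply/funext => h; rewrite /d /= [h%:A]mulr1.
have dcv : d @ 0^' --> derive1 f z by rewrite /derive1; move: df; rewrite /derivable dE.
pose k0 h := if h == 0 then derive1 f z else d h.
have k0c : {for 0, continuous k0}.
  apply/continuous_withinNx; rewrite {2}/k0 eqxx.
  apply: cvg_trans dcv; apply: near_eq_cvg.
  near=> h; rewrite /k0 ifN//; near: h; exact: (nbhs_dnbhs_neq 0).
exists (fun w => k0 (w - z)); split.
- apply: (@continuous_comp _ _ _ (fun w => w - z) k0); last by rewrite subrr.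
  apply: continuousB; [exact: cvg_id|exact: cst_continuous].
- by rewrite subrr /k0 eqxx.
- move=> w; rewrite /k0 subr_eq0; case: eqVneq => [->|wz]; first by rewrite subrr mul0r addr0.
  by rewrite /d subrK /GRing.scale/= mulrA divff ?subr_eq0// mul1r subrKC.
Unshelve. all: by end_near. Qed.

Lemma slope_derivable f k z : {for z, continuous k} ->
  (forall w, f w = f z + (w - z) * k w) -> derivable f z 1 /\ derive1 f z = k z.
Proof.
move=> kc fE; pose d h := h^-1 *: (f (h + z) - f z).
have dE : (fun h => h^-1 *: ((f \o shift z) (h *: 1) - f z)) = d.
  by apply/funext => h; rewrite /d /= [h%:A]mulr1.
have dcv : d @ 0^' --> k z.
  have : {for 0, continuous (fun h => k (h + z))}.
    apply: (@continuous_comp _ _ _ (fun w => w + z) k); last by rewrite add0r.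
    apply: continuousD; [exact: cvg_id|exact: cst_continuous].
  move=> /continuous_withinNx; rewrite add0r; apply: cvg_trans.
  apply: near_eq_cvg; near=> h.
  have h0 : h != 0 by near: h; exact: (nbhs_dnbhs_neq 0).
  by rewrite /d fE addrK [f z + _]addrC addrK /GRing.scale/= mulKf.
split; last exact: cvg_lim.
by rewrite /derivable dE; apply/cvg_ex; exists (k z).
Unshelve. all: by end_near. Qed.

Lemma derivable_add_linear f (d : C) z : derivable f z 1 ->
  derivable (fun w => f w + d * w) z 1.
Proof.
by move=> df; apply: (@derivableD _ _ _ f (cst d * id)) => //; apply: derivableM.
Qed.

Lemma derivable_affine_comp f (c l : C) z : derivable f z 1 ->
  derivable (fun w => c * (f w - l)) z 1.
Proof.
by move=> df; apply: (@derivableM _ _ (cst c) (f - cst l)) => //; apply: derivableB.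
Qed.

Lemma derivable_scale f (c : C) z : derivable f z 1 -> derivable (fun w => c * f w) z 1.
Proof.
by move=> df; apply: (@derivableM _ _ (cst c) f).
Qed.

Lemma cvg_affine_comp (F : set_system C) (FF : Filter F) f (c l : C) :
  f @ F --> l -> (fun w => c * (f w - l)) @ F --> (0 : C).
Proof.
move=> fl; rewrite -(mulr0 c) -[X in c * X](subrr l).
by apply: cvgM; [exact: cvg_cst|apply: cvgB => //; exact: cvg_cst].
Qed.
End Derivatives.

(* Two derivatives at a point, in Peano's sense. Without Cauchy's integral formula a
   derivable function is not known to have them; the coordinates of a curve with a
   degree do, away from finitely many points. *)
Definition derivable2 (K : numFieldType) (f : K -> K) (z0 : K) :=
  exists2 k : K -> K, derivable k z0 1
    & \forall z \near z0, f z = f z0 + (z - z0) * k z.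

(** * A maximum principle, and Liouville's theorem *)

Section MaximumPrinciple.
Variable R : realType.
Local Notation C := (complex_complex__canonical__Num_NumField R).
Implicit Types (H : C -> C) (z w : C).

Lemma ReD z w : complex.Re (z + w) = complex.Re z + complex.Re w.
Proof. by case: z w => [? ?] []. Qed.
Lemma ImD z w : complex.Im (z + w) = complex.Im z + complex.Im w.
Proof. by case: z w => [? ?] []. Qed.
Lemma ReN z : complex.Re (- z) = - complex.Re z.
Proof. by case: z. Qed.
Lemma ImN z : complex.Im (- z) = - complex.Im z.
Proof. by case: z. Qed.
Lemma ReM z w : complex.Re (z * w) =
  complex.Re z * complex.Re w - complex.Im z * complex.Im w.
Proof. by case: z w => [? ?] []. Qed.
Lemma ImM z w : complex.Im (z * w) =
  complex.Re z * complex.Im w + complex.Im z * complex.Re w.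
Proof. by case: z w => [? ?] []. Qed.
Lemma complex_eq0 z : complex.Re z = 0 -> complex.Im z = 0 -> z = 0.
Proof. by case: z => x y /= -> ->. Qed.
Definition ReImE := (ReD, ImD, ReN, ImN, ReM, ImM).

Lemma normC_ge (x : C) :
  `|complex.Re x|%:C%C <= `|x| /\ `|complex.Im x|%:C%C <= `|x|.
Proof.
rewrite normc_def !lecR.
by split; rewrite -sqrtr_sqr; apply (@ler_wsqrtr R); rewrite ?lerDl ?lerDr sqr_ge0.
Qed.

Lemma normC_lt (x : C) (c : R) : `|x| < c%:C%C ->
  `|complex.Re x| < c /\ `|complex.Im x| < c.
Proof.
have [h1 h2] := normC_ge x => h.
by rewrite -!ltcR; split; [apply: le_lt_trans h1 _|apply: le_lt_trans h2 _].
Qed.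

Lemma normC_le (x : C) : `|x| <= (`|complex.Re x| + `|complex.Im x|)%:C%C.
Proof.
rewrite normc_def lecR.
rewrite -[leRHS]ger0_norm ?addr_ge0// -[leRHS]sqrtr_sqr; apply (@ler_wsqrtr R).
by rewrite sqrrD !real_normK ?num_real// lerD2r lerDl mulrn_wge0// mulr_ge0.
Qed.

Lemma near_complexP (P : C -> Prop) z : (\forall w \near z, P w) <->
  exists2 t : R, 0 < t & forall w, `|w - z| < t%:C%C -> P w.
Proof.
split=> [/nbhs_ballP[[t s]]|[t t0 h]].
  rewrite /= ltcE/= => /andP[/eqP-> t0] h; exists t => // w wt.
  by apply: h; rewrite /ball/= distrC.
apply/nbhs_ballP; exists t%:C%C; first by rewrite /= ltcR.
by move=> w; rewrite /ball/= distrC; apply: h.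
Qed.

Definition sqn (w : C) : R := complex.Re w ^+ 2 + complex.Im w ^+ 2.

(* Averaging the second-order expansion of [H] over [z + s i^j], [j < 4], leaves
   [Re (H z + d z)] up to an error smaller than the gain [e s ^ 2] of [e sqn]. *)
Lemma derivable2_not_max H (d : C) (e : R) z : 0 < e -> derivable2 H z ->
  ~ (\forall w \near z, complex.Re (H w + d * w) + e * sqn w <=
                        complex.Re (H z + d * z) + e * sqn z).
Proof.
move=> e0 [k dk Hk] Hmax.
have [q [qc _ kE]] := derivable_slope dk.
have qe : \forall w \near z, `|q w - q z| < e%:C%C.
  by move/cvgrPdistC_lt: qc; apply; rewrite ltcR.
have /near_complexP[t t0 ht] : \forall w \near z,
    [/\ H w = H z + (w - z) * k w, `|q w - q z| < e%:C%C &
     complex.Re (H w + d * w) + e * sqn w <= complex.Re (H z + d * z) + e * sqn z].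
  near=> w; split; near: w => //.
pose s := t / 2; have s0 : 0 < s by rewrite divr_gt0.
have st : s < t by rewrite /s; lra.
have key (u : C) : `|u| = 1 -> exists r : C,
    [/\ H (z + s%:C%C * u) = H z + s%:C%C * u * (k z + s%:C%C * u * (q z + r)),
     `|complex.Re r| < e, `|complex.Im r| < e &
     complex.Re (H (z + s%:C%C * u) + d * (z + s%:C%C * u)) + e * sqn (z + s%:C%C * u) <= complex.Re (H z + d * z) + e * sqn z].
  move=> u1; have [|E1 E2 E3] := ht (z + s%:C%C * u).
    by rewrite addrC addKr normrM u1 mulr1 ger0_norm ?ltcR// lecR ltW.
  exists (q (z + s%:C%C * u) - q z).
  have [? ?] := normC_lt E2; split=> //.
  by rewrite E1 kE; rewrite [z + _]addrC addrK; ring.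
(* In the sum over the four directions [u], the terms in [k z] and [q z] cancel because the sums of
   [u] and of [u ^ 2] are zero. Since [u ^ 2] is [1] or [-1], the remainders enter with either
   sign. *)
have B (x : R) : `|x| < e -> 0 < s ^+ 2 * (x + e) /\ 0 < s ^+ 2 * (e - x).
  by rewrite ltr_norml => /andP[? ?]; split; rewrite mulr_gt0 ?exprn_gt0//; lra.
have i1 : `|'i%C : C| = 1 by rewrite normc_def/= expr0n/= expr1n add0r sqrtr1.
have [r0 [E0 /B[B0 _] _ M0]] := key 1 (normr1 _).
have [r1 [E1 /B[_ B1] _ M1]] := key 'i%C i1.
have [r2 [E2 /B[B2 _] _ M2]] := key (-1) (normrN1 _).
have [r3 [E3 /B[_ B3] _ M3]] := key (- 'i%C) (etrans (normrN _) i1).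
move: M0 M1 M2 M3; rewrite {}E0 {}E1 {}E2 {}E3 /sqn.
move: (H z) (k z) (q z) B0 B1 B2 B3; clear => h l p B0 B1 B2 B3.
rewrite !ReImE /= => M0 M1 M2 M3.
lra.
Unshelve. all: by end_near. Qed.

(* At an exceptional point only the first-order expansion is available, and it excludes
   a maximum unless [d] takes one particular value. *)
Lemma derivable_not_max H (d : C) (e : R) z : 0 < e -> derivable H z 1 ->
  derive1 H z + d + (2 * e)%:C%C * conjc z != 0 ->
  ~ (\forall w \near z, complex.Re (H w + d * w) + e * sqn w <=
                        complex.Re (H z + d * z) + e * sqn z).
Proof.
move=> e0 dH a0 Hmax; set a := derive1 H z + _ + _ in a0.
have [q [qc qz HE]] := derivable_slope dH.
pose A := complex.Re a; pose B := complex.Im a.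
have AB : 0 < A ^+ 2 + B ^+ 2.
  rewrite lt0r paddr_eq0 ?sqr_ge0// ?addr_ge0 ?sqr_ge0// !sqrf_eq0 andbT.
  by apply: contra a0 => /andP[/eqP A0 /eqP B0]; apply/eqP/complex_eq0.
(* [a] is the complex gradient at [z] of the function to be maximized. The displacement [s conj a]
   changes that function by [s (|a|^2 + A Re r + B Im r) + e s^2 |a|^2], where [r] is the error of
   the slope; the bound [c] on [r] keeps the bracket positive. *)
pose c := (A ^+ 2 + B ^+ 2) / (`|A| + `|B| + 1).
have AB1 : 0 < `|A| + `|B| + 1 by rewrite ltr_wpDl// addr_ge0.
have c0 : 0 < c by rewrite divr_gt0.
have qe : \forall w \near z, `|q w - q z| < c%:C%C.
  by move/cvgrPdistC_lt: qc; apply; rewrite ltcR.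
have /near_complexP[t t0 ht] : \forall w \near z, `|q w - q z| < c%:C%C /\
     complex.Re (H w + d * w) + e * sqn w <= complex.Re (H z + d * z) + e * sqn z.
  near=> w; split; near: w => //.
pose s := t / (`|A| + `|B| + 1); have s0 : 0 < s by rewrite divr_gt0.
have [|/normC_lt[Er Ei]] := ht (z + s%:C%C * conjc a).
  rewrite addrC addKr normrM [X in X * _]ger0_norm; last by rewrite lecR ltW.
  apply: le_lt_trans (_ : s%:C%C * (`|A| + `|B|)%:C%C < _).
    rewrite ler_wpM2l//; first by rewrite lecR ltW.
    by apply: le_trans (normC_le _) _; rewrite /A /B; case: (a) => x y /=; rewrite normrN.
  by rewrite -rmorphM/= ltcR /s mulrAC -mulrA gtr_pMr// ltr_pdivrMr ?mul1r ?ltrDl.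
set r := q _ - q z in Er Ei; rewrite HE.
have -> : q (z + s%:C%C * conjc a) = r + q z by rewrite /r subrK.
move: Er Ei; rewrite !ltr_pdivlMr// => Er Ei.
have key : `|A * complex.Re r + B * complex.Im r| < A ^+ 2 + B ^+ 2.
  apply: le_lt_trans (ler_normD _ _) _; rewrite !normrM.
  rewrite -(ltr_pM2r AB1).
  have := ler_wpM2l (normr_ge0 A) (ltW Er).
  have := ler_wpM2l (normr_ge0 B) (ltW Ei).
  lra.
move: key; rewrite ltr_norml => /andP[key _].
have qzE : q z = a - d - (2 * e)%:C%C * conjc z by rewrite /a qz; ring.
rewrite qzE /sqn leNgt => /negP; apply.
move: AB s0 key; rewrite /A /B; case: (a) (d) (z) (r) (H z) => [a1 a2] [d1 d2] [z1 z2] [r1 r2] [h1 h2].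
rewrite !ReImE /=; clear -e0 => AB s0 key.
have : 0 < s * (a1 ^+ 2 + a2 ^+ 2 + (a1 * r1 + a2 * r2)) by rewrite mulr_gt0//; lra.
have : 0 <= e * s^+2 * (a1 ^+ 2 + a2 ^+ 2)
  by rewrite mulr_ge0 ?addr_ge0 ?sqr_ge0// mulr_ge0 ?sqr_ge0 ?ltW.
lra.
Unshelve. all: by end_near. Qed.

Lemma injective_notin (T : eqType) (f : nat -> T) (s : seq T) :
  injective f -> exists n, f n \notin s.
Proof.
move=> finj; apply: contrapT => h.
have /(uniq_leq_size _) : {subset [seq f i | i <- iota 0 (size s).+1] <= s}.
  by move=> _ /mapP[i _ ->]; apply: contraT => fi; case: h; exists i.
by rewrite map_inj_uniq// iota_uniq size_map size_iota ltnn => /(_ isT).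
Qed.

Lemma Re_continuous : continuous (@complex.Re R : C -> R).
Proof.
move=> z; apply: (@cvgrPdistC_lt _ _ C (nbhs z) _ _ _).2 => e e0.
apply: (near_complexP (fun w => `|complex.Re w - complex.Re z| < e) z).2.
by exists e => // w /normC_lt[]; rewrite ReD ReN.
Qed.

Lemma Complex_continuous : continuous (fun p : R * R => Complex p.1 p.2 : C).
Proof.
move=> p; apply: (@cvgrPdistC_lt _ _ (R * R)%type (nbhs p) _ _ _).2 => e; rewrite ltcE/= => /andP[/eqP e1 e0].
have e2 : 0 < complex.Re e / 2 by rewrite divr_gt0.
have h1 : \forall q \near p, `|q.1 - p.1| < complex.Re e / 2.
  have h : (fst : R * R -> R) @ p --> p.1 by exact: cvg_fst.
  by move/cvgrPdistC_lt: h; apply.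
have h2 : \forall q \near p, `|q.2 - p.2| < complex.Re e / 2.
  have h : (snd : R * R -> R) @ p --> p.2 by exact: cvg_snd.
  by move/cvgrPdistC_lt: h; apply.
near=> q; apply: le_lt_trans (normC_le _) _ => /=.
have -> : e = (complex.Re e)%:C%C by case: (e) e1 => x y /= ->.
have ? : `|q.1 - p.1| < complex.Re e / 2 by near: q.
have ? : `|q.2 - p.2| < complex.Re e / 2 by near: q.
by rewrite ltcR; lra.
Unshelve. all: by end_near. Qed.

(* Otherwise [Re (H z + d z) + e |z|^2] has an interior maximum on a large square for all
   small [d] and [e], and [d] can be chosen to avoid the finitely many values allowed at
   points of [E]. *)
Lemma vanishing_at_infinity_Re_le0 H (E : seq C) :
  (forall z, derivable H z 1) -> (forall z, z \notin E -> derivable2 H z) ->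
  H w^-1 @[w --> 0^'] --> 0 -> forall z, complex.Re (H z) <= 0.
Proof.
move=> dH d2H H0 z1; rewrite leNgt; apply/negP => eta0.
set eta := complex.Re _ in eta0.
have /near_complexP[rho rho0 hrho] : \forall w \near (0 : C), w != 0 -> `|H w^-1| < (eta / 4)%:C%C.
  have /cvgrPdistC_lt/(_ (eta / 4)%:C%C) := H0; rewrite ltcR divr_gt0// => /(_ isT).
  by rewrite near_withinE; apply: filterS => w h w0; have := h w0; rewrite subr0.
(* Outside the square of half-side [r] the function is below [eta / 4], and [z1] lies inside it. *)
pose r := rho^-1 + `|complex.Re z1| + `|complex.Im z1| + 1.
have rho10 : 0 < rho^-1 by rewrite invr_gt0.
have r1 : 1 < r.
  by rewrite /r ltrDr ltr_wpDr// ltr_wpDr.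
have r0 : 0 < r by apply: lt_trans r1.
have far z : r <= `|complex.Re z| \/ r <= `|complex.Im z| -> complex.Re (H z) < eta / 4.
  move=> hz; have rz : r%:C%C <= `|z|.
    by have [h1 h2] := normC_ge z; case: hz; rewrite -lecR => /le_trans; apply.
  have z0 : z != 0 by rewrite -normr_gt0; apply: lt_le_trans rz; rewrite ltcR.
  have [|+ _] := @normC_lt (H z) (eta / 4); last by move=> h; apply: le_lt_trans h; apply: ler_norm.
  rewrite -[z]invrK; apply: hrho; last by rewrite invr_eq0.
  rewrite subr0 normfV -[rho]invrK rmorphV/= ?unitfE ?invr_eq0 ?gt_eqF//.
  rewrite ltf_pV2 ?posrE ?normr_gt0 ?ltcR//.
  rewrite -ltcR; apply: lt_le_trans rz.
  by rewrite ltcR /r -!addrA ltrDl !addrA ltr_wpDl// addr_ge0.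
(* On the boundary the perturbed function is below [eta/4 + eta/8 + 2 (eta/16) = eta/2], while at
   [z1] it is at least [eta - eta/8]. Hence the maximum over the square is interior. *)
pose e := eta / (16 * r ^+ 2).
have e0 : 0 < e by rewrite divr_gt0// mulr_gt0// exprn_gt0.
pose d n : R := eta / (8 * r) / n.+1%:R.
have d0 n : 0 < d n by rewrite !divr_gt0// mulr_gt0.
have [n /negP nE] : exists n, (d n)%:C%C \notin [seq - (derive1 H z + (2 * e)%:C%C * conjc z) | z <- E].
  apply: injective_notin => i j [] /(mulfI _) dij.
  apply/eqP; rewrite -eqSS -(eqr_nat R); apply/eqP/invr_inj/dij.
  by rewrite gt_eqF// divr_gt0// mulr_gt0.
pose G z := complex.Re (H z + (d n)%:C%C * z) + e * sqn z.
have [|||[x y]] := @compact_EVT_max _ R (fun p : R * R => G (Complex p.1 p.2))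
    (`[- r, r]%classic `*` `[- r, r]%classic).
- by exists (0, 0); split; rewrite /= in_itv/= oppr_le0 ltW.
- by apply: compact_setX; exact: segment_compact.
- apply: continuous_subspaceT => p.
  rewrite [X in continuous_at _ X](_ : _ =
    (fun p : R * R => complex.Re (H (Complex p.1 p.2) + (d n)%:C%C * Complex p.1 p.2)) +
    (fun p : R * R => e * (p.1 * p.1 + p.2 * p.2))); last first.
    by apply/funext => q; rewrite /G /sqn /= !expr2.
  have fc : {for p, continuous (fst : R * R -> R)} by exact: cvg_fst.
  have sc : {for p, continuous (snd : R * R -> R)} by exact: cvg_snd.
  apply: continuousD.
    apply: (@continuous_comp _ _ _ (fun p : R * R => Complex p.1 p.2 : C)
      (fun z : C => complex.Re (H z + (d n)%:C%C * z))).
      exact: Complex_continuous.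
    apply: (@continuous_comp _ _ _ (fun z : C => H z + (d n)%:C%C * z) (@complex.Re R : C -> R)).
      have dG := @derivable_add_linear C H (d n)%:C%C _ (dH (Complex p.1 p.2)).
      exact: (derivable_continuous dG).
    exact: Re_continuous.
  by apply: continuousM; [exact: cst_continuous|apply: continuousD; apply: continuousM].
rewrite inE/= => -[] /= xr yr Gmax; move: xr yr; rewrite !in_itv/= => xr yr.
have dr x' : - r <= x' <= r -> d n * x' <= eta / 8.
  move=> /andP[_ xr']; apply: le_trans (ler_wpM2l (ltW (d0 n)) xr') _.
  have -> : d n * r = eta / 8 / n.+1%:R.
    have N0 : n.+1%:R != 0 :> R by rewrite pnatr_eq0.
    by rewrite /d; move: (n.+1%:R) N0 => N N0; field; rewrite N0 gt_eqF.
  by rewrite ler_pdivrMr// ler_peMr ?ler1n// ltW// divr_gt0.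
have er x' : - r <= x' <= r -> e * x' ^+ 2 <= eta / 16.
  move=> xr'; have -> : eta / 16 = e * r ^+ 2 by rewrite /e; field; rewrite gt_eqF.
  rewrite ler_wpM2l ?(ltW e0)// -[x' ^+ 2]real_normK ?num_real// lerXn2r ?nnegrE ?(ltW r0)//.
  by rewrite ler_norml.
have Gz1 : eta / 2 < G (Complex x y).
  have z1r : - r <= complex.Re z1 <= r.
    rewrite -ler_norml /r -!addrA addrCA lerDl !addr_ge0// ltW//.
  have z1i : - r <= complex.Im z1 <= r.
    rewrite -ler_norml /r addrAC lerDr !addr_ge0// ltW//.
  have := Gmax (complex.Re z1, complex.Im z1); rewrite inE/= !in_itv/= => /(_ (conj z1r z1i)).
  have := dr (- complex.Re z1); rewrite lerN2 lerNl andbC => /(_ z1r).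
  have : 0 <= e * (complex.Re z1 ^+ 2 + complex.Im z1 ^+ 2).
    by rewrite mulr_ge0 ?addr_ge0 ?sqr_ge0 ?(ltW e0).
  rewrite /G /sqn !ReImE /= -[Complex (complex.Re z1) _]/(Complex _ _).
  have -> : H (Complex (complex.Re z1) (complex.Im z1)) = H z1 by case: (z1).
  rewrite -/eta; move: eta0; clear; lra.
have xyr : `|x| < r /\ `|y| < r.
  split.
    rewrite ltNge; apply/negP => rx; have := far (Complex x y) (or_introl rx).
    move: Gz1 (dr _ xr) (er _ xr) (er _ yr); rewrite /G /sqn !ReImE /=; lra.
  rewrite ltNge; apply/negP => rx; have := far (Complex x y) (or_intror rx).
  move: Gz1 (dr _ xr) (er _ xr) (er _ yr); rewrite /G /sqn !ReImE /=; lra.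
have lmax : \forall w \near (Complex x y : C), G w <= G (Complex x y).
  have [xr1 yr1] := xyr; apply: (near_complexP _ _).2.
  exists (Num.min (r - `|x|) (r - `|y|)); first by rewrite lt_min !subr_gt0 xr1.
  move=> [u v] /normC_lt[]; rewrite !lt_min /= => /andP[ux _] /andP[_ vy].
  apply: (Gmax (u, v)); rewrite inE/= !in_itv/= -!ler_norml; split.
    have := ler_normD (u - x) x; rewrite subrK; lra.
  have := ler_normD (v - y) y; rewrite subrK; lra.
have [zE|zE] := boolP ((Complex x y : C) \in E).
  apply: (derivable_not_max e0 (dH _) _ lmax).
  apply/negP => /eqP h; apply: nE; apply/mapP; exists (Complex x y) => //.
  by apply/eqP; rewrite eq_sym eqr_oppLR -subr_eq0 opprK -h; apply/eqP; ring.
exact: (derivable2_not_max e0 (d2H _ zE) lmax).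
Qed.

Lemma derivable2_affine (c L : C) H z :
  derivable2 H z -> derivable2 (fun w => c * (H w - L)) z.
Proof.
move=> [k dk Hk]; exists (fun w => c * k w).
  exact: derivable_scale.
by near=> w; rewrite (near Hk w)//; ring.
Unshelve. all: by end_near. Qed.

(** The bound on real parts is applied to [conj (H z - L) (H - L)], which tends to 0 at infinity and
    whose value at [z] itself is [|H z - L|^2]. *)
Theorem liouville H (E : seq C) (L : C) :
  (forall z, derivable H z 1) -> (forall z, z \notin E -> derivable2 H z) ->
  H w^-1 @[w --> 0^'] --> L -> forall z, H z = L.
Proof.
move=> dH d2H HL z; apply/eqP; rewrite -subr_eq0; apply/eqP.
pose a : C := H z - L; pose ca : C := conjc a.
have h : complex.Re (ca * (H z - L)) <= 0.
  apply: (@vanishing_at_infinity_Re_le0 (fun w => ca * (H w - L)) E).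
  - move=> w; exact: (@derivable_affine_comp C H ca L w (dH w)).
  - move=> w wE; exact: (@derivable2_affine ca L H w (d2H w wE)).
  - exact: (@cvg_affine_comp C _ _ (fun w => H w^-1) ca L HL).
have : complex.Re a ^+ 2 + complex.Im a ^+ 2 == 0.
  rewrite eq_le addr_ge0 ?sqr_ge0// andbT; apply: le_trans h.
  by rewrite -/a ReM /ca; case: (a) => x y /=; rewrite mulNr opprK -!expr2.
rewrite paddr_eq0 ?sqr_ge0// !sqrf_eq0 => /andP[/eqP ? /eqP ?].
exact: complex_eq0.
Qed.

End MaximumPrinciple.

Section HolomorphicFunctions.
Variable C : numFieldType.
Implicit Types (f h u : C -> C) (z w : C).

Lemma holo_derivable f z : holomorphic_near f z -> derivable f z 1.
Proof. exact: nbhs_singleton. Qed.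

Lemma holo_continuous f z : holomorphic_near f z -> {for z, continuous f}.
Proof. by move=> /holo_derivable/derivable_continuous. Qed.

Lemma holo_neq0 f z : holomorphic_near f z -> f z != 0 ->
  \forall w \near z, f w != 0.
Proof. by move=> /holo_continuous fc f0; exact: (@cvgr_neq0 _ _ _ (nbhs z) _ f (f z) fc f0). Qed.

Lemma holoM f h z : holomorphic_near f z -> holomorphic_near h z ->
  holomorphic_near (f * h) z.
Proof.
by apply: filterS2 => w; exact: derivableM. Qed.

Lemma holoV f z : holomorphic_near f z -> f z != 0 ->
  holomorphic_near (fun w => (f w)^-1) z.
Proof.
move=> hf f0; have fn := holo_neq0 hf f0.
by apply: filterS2 fn hf => w; exact: derivableV.
Qed.

Lemma holo_cst (c : C) z : holomorphic_near (fun=> c) z.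
Proof. by near=> w; exact: derivable_cst. Unshelve. all: by end_near. Qed.

Lemma holo_horner (p : {poly C}) z : holomorphic_near (horner p) z.
Proof. by near=> w; exact: derivable_hornerC. Unshelve. all: by end_near. Qed.

Lemma holo_sum n (F : 'I_n -> C -> C) z :
  (forall i, holomorphic_near (F i) z) -> holomorphic_near (fun w => \sum_i F i w) z.
Proof.
move=> hF; have : \forall w \near z, forall i, derivable (F i) w 1.
  exact: (@filter_forall _ _ (fun i w => derivable (F i) w 1) (nbhs z)).
apply: filterS => w hw; rewrite (_ : (fun w => _) = \sum_i F i).
  exact: derivable_sum.
by apply/funext => x; rewrite fct_sumE.
Qed.

Lemma holo_near_eq f h z : (\forall w \near z, f w = h w) ->
  holomorphic_near f z -> holomorphic_near h z.
Proof.
by move=> /near_join; apply: filterS2 => w; exact: near_eq_derivable.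
Qed.

Lemma near_inv (P : C -> Prop) z : z != 0 -> (\forall w \near z, P w) ->
  \forall w \near z^-1, P w^-1.
Proof.
move=> z0 hP.
have : (fun w : C => w^-1) @ z^-1 --> z^-1^-1.
  by apply: inv_continuous; rewrite invr_eq0.
by rewrite invrK; apply.
Qed.

Lemma holo_comp_inv f z : z != 0 -> holomorphic_near f z ->
  holomorphic_near (f \o GRing.inv) z^-1.
Proof.
move=> z0 /(near_inv z0) hf.
have w0 : \forall w \near z^-1, w != 0.
  by apply: (@cvgr_neq0 _ _ _ (nbhs z^-1) _ id z^-1) => //; rewrite ?invr_eq0.
apply: filterS2 w0 hf => w w0 dfw; apply: derivable_comp => //.
by apply: derivableV => //; exact: derivable_id.
Qed.

Lemma continuous_dnbhs_eq f h z : {for z, continuous f} -> {for z, continuous h} ->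
  (\forall w \near z^', f w = h w) -> f z = h z.
Proof.
move=> /continuous_withinNx fc /continuous_withinNx hc fh.
apply: (@cvg_unique _ _ (h @ z^')) => //.
by apply: cvg_trans fc; exact: near_eq_cvg.
Qed.

Lemma finite_near (E : seq C) z : \forall w \near z^', w \notin E.
Proof.
elim: E => [|e E ih]; first by near=> w.
suff h : \forall w \near z^', w != e.
  by near=> w; rewrite in_cons negb_or; apply/andP; split; near: w.
have [->|ez] := eqVneq e z; first exact: nbhs_dnbhs_neq.
have ce : {for z, continuous (id - cst e : C -> C)}.
  by apply: continuousB; [exact: cvg_id|exact: cst_continuous].
have := @cvgr_neq0 _ _ _ (nbhs z) _ _ _ ce; rewrite !fctE subr_eq0 eq_sym => /(_ _ ez) h.
by apply: cvg_within; apply: filterS h => w; rewrite subr_eq0.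
Unshelve. all: by end_near. Qed.

Lemma derivable2_near_eq f h z : (\forall w \near z, f w = h w) ->
  derivable2 f z -> derivable2 h z.
Proof.
move=> fh [k dk Hk]; exists k => //; have fhz := nbhs_singleton fh.
near=> w; have <- : f w = h w by near: w.
by rewrite -fhz; near: w.
Unshelve. all: by end_near. Qed.

Lemma derivable2M f h z : derivable2 f z -> derivable2 h z -> derivable2 (f * h) z.
Proof.
move=> [k dk Hk] [l dl Hl].
exists (cst (f z) * l + cst (h z) * k + (id - cst z) * k * l).
  apply: derivableD; first by apply: derivableD; apply: derivableM => //; exact: derivable_cst.
  by apply: derivableM => //; apply: derivableM.
near=> w.
have fw : f w = f z + (w - z) * k w by near: w.
have hw : h w = h z + (w - z) * l w by near: w.
change (f w * h w = f z * h z + (w - z) * (f z * l w + h z * k w + (w - z) * k w * l w)).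
by rewrite fw hw; ring.
Unshelve. all: by end_near. Qed.

Lemma derivable2_derivable f z : derivable2 f z -> derivable f z 1.
Proof.
move=> [k dk Hk]; apply: (@near_eq_derivable _ _ _ (cst (f z) + (id - cst z) * k)).
  by near=> w; rewrite !fctE /cst; apply/esym; near: w.
apply: derivableD; first exact: derivable_cst.
by apply: derivableM.
Unshelve. all: by end_near. Qed.

Lemma derivable2V f z : f z != 0 -> derivable2 f z -> derivable2 (fun w => (f w)^-1) z.
Proof.
move=> f0 df; have df1 := derivable2_derivable df; case: df => [k dk Hk].
exists (cst (- (f z)^-1) * k * (fun w => (f w)^-1)).
  apply: derivableM; last exact: derivableV.
  by apply: derivableM => //; exact: derivable_cst.
have fn : \forall w \near z, f w != 0 by apply: (@cvgr_neq0 _ _ _ (nbhs z) _ f (f z)) => //; exact: derivable_continuous.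
near=> w.
have fw : f w = f z + (w - z) * k w by near: w.
have fw0 : f w != 0 by near: w.
change ((f w)^-1 = (f z)^-1 + (w - z) * (- (f z)^-1 * k w * (f w)^-1)).
apply: (mulIf fw0); rewrite mulVf// mulrDl -!mulrA mulVf// mulr1.
by rewrite {1}fw; field.
Unshelve. all: by end_near. Qed.

Lemma derivable2_horner (p : {poly C}) z : derivable2 (horner p) z.
Proof.
have /factor_theorem[q pE] : root (p - p.[z]%:P) z by rewrite rootE !hornerE subrr.
exists (horner q); first exact: derivable_hornerC.
near=> w; rewrite -[p in LHS](subrK p.[z]%:P) pE !hornerE; ring.
Unshelve. all: by end_near. Qed.

End HolomorphicFunctions.

(** * Charts, lifts and divisors *)

Section ProjectivePoints.
Variable C : numFieldType.

Lemma line_gen (K : fieldType) (W : vectType K) (L : {vspace W}) v :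
  \dim L == 1%N -> v \in L -> v != 0 -> L = <[v]>%VS.
Proof.
move=> dL vL v0; apply/eqP; rewrite eq_sym eqEdim -memvE vL dim_vline v0.
by rewrite (eqP dL).
Qed.

Lemma line_eqP (K : fieldType) (W : vectType K) (v w : W) : v != 0 ->
  <[v]>%VS = <[w]>%VS -> exists2 c, c != 0 & w = c *: v.
Proof.
move=> v0 vw; have /vlineP[c wE] : w \in <[v]>%VS by rewrite vw memv_line.
exists c => //; apply: contra v0 => /eqP c0.
have /vlineP[k ->] : v \in <[w]>%VS by rewrite -vw memv_line.
by rewrite wE c0 scale0r scaler0.
Qed.

Lemma vpick_line (K : fieldType) (W : vectType K) (p : projective_space W) :
  vpick (val p) != 0 /\ val p = <[vpick (val p)]>%VS.
Proof.
have p0 : vpick (val p) != 0.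
  rewrite vpick0; apply: contraTneq (valP p) => /= ->; by rewrite dimv0.
by split=> //; apply: line_gen (valP p) (memv_pick _) p0.
Qed.

Lemma chart_vec0 b (z : C) : chart_vec b z != 0.
Proof. by move: (chart_vec_dim b z); rewrite dim_vline eqb1. Qed.

Lemma chart_vecE b (z : C) : chart_vec b z 0 0 = (if b then z else 1) /\
  chart_vec b z 0 1 = (if b then 1 else z).
Proof. by rewrite !mxE; case: b. Qed.

Lemma rV2P (K : fieldType) (v w : 'rV[K]_2) : v 0 0 = w 0 0 -> v 0 1 = w 0 1 -> v = w.
Proof.
move=> h0 h1; apply/rowP => i; case: (unliftP 0 i) => [j ->|->//].
by rewrite (ord1 j) (_ : lift 0 0 = 1)//; apply/val_inj.
Qed.

Lemma chart_swap b (z : C) : z != 0 -> chart (~~ b) z^-1 = chart b z.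
Proof.
move=> z0; apply/val_inj => /=.
apply: line_gen; rewrite ?chart_vec0 ?dim_vline ?chart_vec0//.
apply/vlineP; exists z.
have [h0 h1] := chart_vecE b z; have [k0 k1] := chart_vecE (~~ b) z^-1.
by apply: rV2P; rewrite [RHS]mxE ?h0 ?h1 ?k0 ?k1; case: b {h0 h1 k0 k1} => /=; rewrite ?mulr1 ?divff.
Qed.

Lemma chart_eqP b b' (z z' : C) : chart b z = chart b' z' ->
  if b == b' then z = z' else z != 0 /\ z' = z^-1.
Proof.
move=> /(congr1 val)/= /(line_eqP (chart_vec0 b z))[c c0].
have [h0 h1] := chart_vecE b z; have [k0 k1] := chart_vecE b' z'.
move=> /rowP E; move: (E 0) (E 1); rewrite [c *: _]lock.
rewrite k0 k1 -lock !mxE.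
case: b b' {h0 h1 k0 k1 E} => [] [] /=; rewrite ?mulr1 => E0 E1.
- by rewrite E0 -E1 mul1r.
- have z0 : z != 0 by apply: contraTneq (oner_neq0 C) => z0; rewrite E0 z0 mulr0 eqxx.
  by split=> //; rewrite E1; apply: (mulIf z0); rewrite -E0 mulVf.
- have z0 : z != 0 by apply: contraTneq (oner_neq0 C) => z0; rewrite E1 z0 mulr0 eqxx.
  by split=> //; rewrite E0; apply: (mulIf z0); rewrite -E1 mulVf.
- by rewrite E1 -E0 mul1r.
Qed.

Lemma chart_inj b : injective (@chart C b).
Proof. by move=> z w /chart_eqP; rewrite eqxx. Qed.

Lemma chart_cover (p : P1 C) : (exists z, p = chart false z) \/ p = chart true 0.
Proof.
have [v0 pE] := vpick_line p; set v := vpick _ in v0 pE.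
have [v00|v00] := eqVneq (v 0 0) 0.
  have v01 : v 0 1 != 0.
    by apply: contra v0 => /eqP v01; apply/eqP/rV2P; rewrite !mxE.
  right; apply/val_inj; rewrite pE /=.
  apply: line_gen; rewrite ?chart_vec0 ?dim_vline ?v0//.
  apply/vlineP; exists (v 0 1)^-1.
  by have [h0 h1] := chart_vecE true (0 : C); apply: rV2P; rewrite [RHS]mxE ?h0 ?h1 ?v00 ?mulr0 ?mulVf.
left; exists (v 0 1 / v 0 0); apply/val_inj; rewrite pE /=.
apply: line_gen; rewrite ?chart_vec0 ?dim_vline ?v0//.
apply/vlineP; exists (v 0 0)^-1.
have [h0 h1] := chart_vecE false (v 0 1 / v 0 0).
by apply: rV2P; rewrite [RHS]mxE ?h0 ?h1 ?mulVf// mulrC.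
Qed.

End ProjectivePoints.

(** * Independence of the lift and of the chart *)

Section Lifts.
Variables (C : numFieldType) (W : vectType C).
Implicit Types (g : P1 C -> projective_space W) (lam nu : 'Hom(W, C^o)).
Implicit Types (G : C -> W) (z w : C).

Definition dual_coord (i : 'I_(\dim {:W})) : 'Hom(W, C^o) :=
  linfun (coord (vbasis {:W}) i : W -> C^o).

Lemma dual_coordE i v : dual_coord i v = coord (vbasis {:W}) i v.
Proof. by rewrite lfunE. Qed.

Lemma functional_coord lam v :
  lam v = \sum_i coord (vbasis {:W}) i v * lam (vbasis {:W})`_i.
Proof.
rewrite {1}(coord_vbasis (memvf v)) linear_sum; apply: eq_bigr => i _.
by rewrite linearZ.
Qed.

Lemma dual_eq (v w : W) : (forall lam, lam v = lam w) -> v = w.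
Proof.
move=> h; rewrite (coord_vbasis (memvf v)) (coord_vbasis (memvf w)).
by apply: eq_bigr => i _; rewrite -!dual_coordE h.
Qed.

Lemma dual_neq0 (v : W) : v != 0 -> exists lam, lam v != 0.
Proof.
move=> v0; apply: contrapT => h; case/negP: v0; apply/eqP/dual_eq => lam.
rewrite linear0; apply/eqP; apply: contrapT => /negP lv.
by apply: h; exists lam.
Qed.

Lemma holo_functional lam G z : wholomorphic_near G z ->
  holomorphic_near (fun w => lam (G w)) z.
Proof.
move=> hG.
apply: (@holo_near_eq _ (fun w => \sum_i (wcoord G i * cst (lam (vbasis {:W})`_i)) w)).
  by near=> w; rewrite [RHS]functional_coord.
by apply: holo_sum => i; apply: holoM => //; exact: holo_cst.
Unshelve. all: by end_near. Qed.

Lemma lift_neq0 g b z G : local_lift g b z G -> G z != 0.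
Proof. by case=> _ /nbhs_singleton[]. Qed.

Lemma lift_val g b z G : local_lift g b z G -> val (g (chart b z)) = <[G z]>%VS.
Proof. by case=> _ /nbhs_singleton[]. Qed.

Lemma lift_proportional g b z G G' : local_lift g b z G -> local_lift g b z G' ->
  \forall w \near z, exists2 c, c != 0 & G' w = c *: G w.
Proof.
move=> [_ hG] [_ hG']; apply: filterS2 hG hG' => w [G0 GE] [_ GE'].
by apply: line_eqP => //; rewrite -GE.
Qed.

(** The pointwise factor between two lifts carries no regularity by itself. Dividing the values of a
    functional [nu] nonzero at [G z] exhibits it as a holomorphic unit. *)
Lemma vanishing_order_lift g b z G G' lam m :
  local_lift g b z G -> local_lift g b z G' ->
  vanishing_order (fun w => lam (G w)) z m ->
  vanishing_order (fun w => lam (G' w)) z m.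
Proof.
move=> lG lG' [u [hu u0 uE]]; have [nu nuG] := dual_neq0 (lift_neq0 lG).
have prop := lift_proportional lG lG'.
have hnu := holo_functional nu lG.1; have hnu' := holo_functional nu lG'.1.
have nuG' : nu (G' z) != 0.
  by have [c c0 ->] := nbhs_singleton prop; rewrite linearZ mulf_neq0.
have nuGn := holo_neq0 hnu nuG.
exists (u * (fun w => nu (G' w)) * (fun w => (nu (G w))^-1)); split.
- by apply: holoM; [exact: holoM|exact: holoV].
- by rewrite !mulf_neq0 ?invr_eq0.
- apply: filterS3 uE prop nuGn => w uE [c c0 GE] nu0.
  change (lam (G' w) = (w - z) ^+ m * (u w * nu (G' w) / nu (G w))).
  rewrite GE !linearZ /= !mulrA -uE /GRing.scale/=; by field.
Qed.

Lemma lift_swap g b z G : z != 0 -> local_lift g b z G ->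
  local_lift g (~~ b) z^-1 (G \o GRing.inv).
Proof.
move=> z0 [hG GE]; split; first by move=> i; exact: holo_comp_inv (hG i).
have w0 : \forall w \near z^-1, w != 0.
  by apply: (@cvgr_neq0 _ _ _ (nbhs z^-1) _ id z^-1) => //; rewrite ?invr_eq0.
apply: filterS2 w0 (near_inv z0 GE) => w w0 [Gw0 Gw]; split=> //=.
by rewrite -Gw -[w in LHS]invrK chart_swap// invr_eq0.
Qed.

Lemma vanishing_order_inv (h : C -> C) z m : z != 0 -> vanishing_order h z m ->
  vanishing_order (h \o GRing.inv) z^-1 m.
Proof.
move=> z0 [u [hu u0 uE]].
have w0 : \forall w \near z^-1, w != 0.
  by apply: (@cvgr_neq0 _ _ _ (nbhs z^-1) _ id z^-1) => //; rewrite ?invr_eq0.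
(* From [w^-1 - z = (w - z^-1) (- z / w)]: the unit [(- z / w) ^ m] joins [u]. *)
exists (((horner (((- z) *: 'X) ^+ m)) * u) \o GRing.inv); split.
- by apply: holo_comp_inv => //; apply: holoM => //; exact: holo_horner.
- change ((((- z) *: 'X) ^+ m).[z^-1^-1] * u (z^-1^-1) != 0).
  by rewrite invrK !hornerE mulf_neq0// expf_neq0// mulf_neq0// oppr_eq0.
- apply: filterS2 w0 (near_inv z0 uE) => w w0 uEw.
  change (h w^-1 = (w - z^-1) ^+ m * ((((- z) *: 'X) ^+ m).[w^-1] * u w^-1)).
  have -> : (((- z) *: 'X) ^+ m).[w^-1] = (- z / w) ^+ m by rewrite !hornerE.
  rewrite uEw (_ : w^-1 - z = (w - z^-1) * (- z / w)); last by field; rewrite ?z0 ?w0.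
  by rewrite exprMn mulrA.
Qed.

(** [hyperplane_mult] only provides some chart and some lift; this makes the multiplicity available
    on any given lift. *)
Lemma hyperplane_mult_lift g lam b z G m : local_lift g b z G ->
  hyperplane_mult g lam (chart b z) m -> vanishing_order (fun w => lam (G w)) z m.
Proof.
move=> lG [b' [z' [G' [/chart_eqP]]]].
case: eqVneq => [<- <-|bb'].
  by move=> lG' v; apply: vanishing_order_lift lG' lG v.
have -> : b' = ~~ b by clear -bb'; case: b b' bb' => [] [].
move=> [z0 ->] lG' /(vanishing_order_inv _); rewrite invr_eq0 => /(_ z0).
have := lift_swap _ lG'; rewrite invr_eq0 negbK => /(_ z0); rewrite invrK.
by move=> lG'' v; apply: vanishing_order_lift lG'' lG v.
Qed.

End Lifts.

Section Divisors.
Variables (C : numFieldType) (W : vectType C).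
Implicit Types (g : P1 C -> projective_space W) (lam mu nu : 'Hom(W, C^o)).
Implicit Types (G : C -> W) (z w : C) (P Q : {poly C}).

Lemma near_dnbhs (D : C -> Prop) z : D z -> (\forall w \near z^', D w) ->
  \forall w \near z, D w.
Proof.
rewrite near_withinE => Dz; apply: filterS => w.
by have [->|wz] := eqVneq w z => // /(_ isT).
Qed.

Lemma poly_roots_seq P : P != 0 -> exists s : seq C, forall z, root P z -> z \in s.
Proof.
have [n] := ubnP (size P); elim: n P => // n ih P szP P0.
have [[z rz]|nor] := pselect (exists z, root P z); last first.
  by exists [::] => z rz; case: nor; exists z.
have /factor_theorem[Q PE] := rz.
have Q0 : Q != 0 by apply: contra P0 => /eqP Q0; rewrite PE Q0 mul0r.
have [|s hs] := ih Q _ Q0.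
  by move: szP; rewrite PE size_Mmonic ?monicXsubC// size_XsubC addn2/= ltnS.
exists (z :: s) => w; rewrite PE rootM root_XsubC in_cons orbC.
by case/orP=> [->//|/hs ->]; rewrite orbT.
Qed.

Lemma poly_at_infinity P : exists Pr : {poly C}, Pr.[0] = lead_coef P /\
  forall w, w != 0 -> Pr.[w] = P.[w^-1] * w ^+ (size P).-1.
Proof.
have [->|P0] := eqVneq P 0.
  by exists 0; rewrite lead_coef0 horner0; split=> // w _; rewrite !horner0 mul0r.
have szP : size P = (size P).-1.+1 by rewrite prednK// size_poly_gt0.
exists (\poly_(i < size P) P`_((size P).-1 - i)); split.
  by rewrite horner_coef0 coef_poly size_poly_gt0 P0 subn0 lead_coefE.
move=> w w0; rewrite horner_poly horner_coef mulr_suml (reindex_inj rev_ord_inj)/=.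
apply: eq_bigr => i _; rewrite -mulrA; have := ltn_ord i => iP.
have E1 n j : (j < n)%N -> (n.-1 - (n - j.+1) = j)%N by lia.
have E2 n j : (j < n)%N -> n.-1 = (j + (n - j.+1))%N by lia.
rewrite E1// (E2 _ _ iP); congr (_ * _).
by rewrite exprVn exprD mulKf// expf_neq0.
Qed.

Lemma functional_line lam z g b G : local_lift g b z G ->
  (val (g (chart b z)) <= lker lam)%VS = (lam (G z) == 0).
Proof. by move=> /lift_val ->; rewrite -memvE memv_ker. Qed.

(* The divisor cut out by [lam = 0] is that of the roots of [P], plus [n] times the point
   at infinity. *)
Definition divisor_poly g lam P n :=
  [/\ P != 0,
      forall z G, local_lift g false z G -> exists m Q,
        [/\ vanishing_order (fun w => lam (G w)) z m,
            P = Q * ('X - z%:P) ^+ m & Q.[z] != 0]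
    & forall G, local_lift g true 0 G ->
        vanishing_order (fun w => lam (G w)) 0 n].

Lemma vanishing_order0 g b z G lam : local_lift g b z G -> lam (G z) != 0 ->
  vanishing_order (fun w => lam (G w)) z 0.
Proof.
move=> lG l0; exists (fun w => lam (G w)); split=> //.
  exact: holo_functional lG.1.
by near=> w; rewrite expr0 mul1r.
Unshelve. all: by end_near. Qed.

Lemma divisor_poly_exists g lam d : has_degree g d ->
  (exists p, ~~ (val (g p) <= lker lam)%VS) ->
  exists P n, divisor_poly g lam P n /\ (size P + n = d.+1)%N.
Proof.
move=> /(_ lam) hd /hd[s [m [us sE hm dE]]].
(* [aff] is the affine coordinate, with an arbitrary value at infinity. *)
have /choice[aff affE] (p : P1 C) : exists z, p != chart true 0 -> p = chart false z.
  by have [[z ->]|->] := chart_cover p; [exists z|exists 0; rewrite eqxx].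
pose fin (p : P1 C) := p != chart true 0.
pose F p := ('X - (aff p)%:P) ^+ m p.
have Fmonic p : F p \is monic by rewrite monic_exp ?monicXsubC.
exists (\prod_(p <- s | fin p) F p), (\sum_(p <- s | ~~ fin p) m p)%N.
have neq0 (D : pred (P1 C)) : \prod_(p <- s | D p) F p != 0.
  by rewrite monic_neq0// monic_prod.
split; first split=> //.
- move=> z G lG; have finz : fin (chart false z).
    by apply/eqP => /chart_eqP /= [z0 /esym/eqP]; rewrite invr_eq0 (negbTE z0).
  have affz : aff (chart false z) = z by apply: (@chart_inj _ false); rewrite -affE.
  have other q : fin q -> q != chart false z -> ('X - (aff q)%:P).[z] != 0.
    move=> finq; rewrite !hornerE subr_eq0; apply: contra => /eqP ->.
    by rewrite {1}(affE q finq).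
  have [zs|zs] := boolP (chart false z \in s).
    exists (m (chart false z)), (\prod_(p <- rem (chart false z) s | fin p) F p); split.
    - exact: hyperplane_mult_lift lG (hm _ zs).
    - by rewrite (big_rem (chart false z))//= finz mulrC /F affz.
    - rewrite horner_prod prodf_seq_neq0; apply/allP => q; rewrite mem_rem_uniq// inE => /andP[qz _].
      apply/implyP => fq; by rewrite horner_exp expf_neq0// other.
  exists 0%N, (\prod_(p <- s | fin p) F p); split; last 2 first.
  - by rewrite expr0 mulr1.
  - rewrite horner_prod prodf_seq_neq0; apply/allP => q qs; apply/implyP => fq.
    have qz : q != chart false z by apply: contraNneq zs => <-.
    by rewrite horner_exp expf_neq0// other.
  have lG0 : lam (G z) != 0 by rewrite -(functional_line lam lG) -sE.
  exact: vanishing_order0 lG lG0.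
- move=> G lG; have [zs|zs] := boolP (chart true 0 \in s).
    have -> : (\sum_(p <- s | ~~ fin p) m p = m (chart true 0))%N.
      rewrite (big_rem (chart true 0))//= /fin eqxx/= big1_seq ?addn0// => q.
      by rewrite mem_rem_uniq// inE negbK => /and3P[/eqP->]; rewrite eqxx.
    exact: hyperplane_mult_lift lG (hm _ zs).
  have lG0 : lam (G 0) != 0 by rewrite -(functional_line lam lG) -sE.
  rewrite big1_seq; first exact: vanishing_order0 lG lG0.
  by move=> q; rewrite negbK => /andP[/eqP -> qs]; rewrite qs in zs.
- rewrite -dE [in RHS](bigID fin)/= -addSn; congr (_ + _)%N.
  elim: (s) => [|p t ih]; first by rewrite !big_nil size_poly1.
  rewrite !big_cons; case: (fin p) => //.
  rewrite size_Mmonic ?monic_prod ?monic_neq0// ih size_exp_XsubC.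
  by rewrite addSn/= addnS.
Qed.
End Divisors.

(** * Ratios of linear forms along a curve *)

Section Ratio.
Variables (C : numFieldType) (W : vectType C).
Implicit Types (g : P1 C -> projective_space W) (lam mu nu : 'Hom(W, C^o)).
Implicit Types (G : C -> W) (z w : C) (P Q : {poly C}).

(** The quotient is homogeneous of degree 0, so the generator picked on the line does not matter. *)
Definition ratio g lam mu (p : P1 C) : C :=
  lam (vpick (val (g p))) / mu (vpick (val (g p))).

Lemma ratioE g lam mu p v : v != 0 -> v \in val (g p) ->
  ratio g lam mu p = lam v / mu v.
Proof.
move=> v0 vp; have [p0 pE] := vpick_line (g p).
have /vlineP[k vE] : v \in <[vpick (val (g p))]>%VS by rewrite -pE.
have k0 : k != 0 by apply: contra v0 => /eqP k0; rewrite vE k0 scale0r.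
rewrite vE !linearZ /ratio /= /GRing.scale/= invfM mulrACA divff// mul1r//.
Qed.

Lemma ratio_lift g b z G lam mu : local_lift g b z G ->
  \forall w \near z, ratio g lam mu (chart b w) = lam (G w) / mu (G w).
Proof.
move=> [_]; apply: filterS => w [G0 gE]; apply: ratioE => //.
by rewrite gE memv_line.
Qed.

(** [lam] and [P] have the same order at [z], and so do [mu] and [Q]. All powers of [w - z] cancel
    in the quotient, leaving only units. *)
Lemma near_ratio g lam mu P n Q k z : holomorphic_curve g ->
  divisor_poly g lam P n -> divisor_poly g mu Q k ->
  exists K : C -> C, [/\ derivable K z 1, K z != 0 &
    \forall w \near z^',
      ratio g lam mu (chart false w) * (Q.[w] / P.[w]) = K w].
Proof.
move=> hg [P0 divP _] [Q0 divQ _]; have [G lG] := hg false z.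
have [m [P1 [[u [hu u0 uE]] PE P10]]] := divP z G lG.
have [l [Q1 [[v [hv v0 vE]] QE Q10]]] := divQ z G lG.
exists (u * (fun w => (v w)^-1) * (horner Q1 * (fun w => (P1.[w])^-1))); split.
- exact: (holo_derivable (holoM (holoM hu (holoV hv v0))
    (holoM (holo_horner Q1 z) (holoV (holo_horner P1 z) P10)))).
- by rewrite !mulf_neq0 ?invr_eq0.
have P1n : \forall w \near z, P1.[w] != 0 by exact: holo_neq0 (holo_horner P1 z) P10.
have vn := holo_neq0 hv v0.
rewrite near_withinE; near=> w => wz.
change (ratio g lam mu (chart false w) * (Q.[w] / P.[w]) = u w / v w * (Q1.[w] / P1.[w])).
have -> : ratio g lam mu (chart false w) = lam (G w) / mu (G w).
  by near: w; exact: ratio_lift.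
have -> : lam (G w) = (w - z) ^+ m * u w by near: w.
have -> : mu (G w) = (w - z) ^+ l * v w by near: w.
have wz0 : w - z != 0 by rewrite subr_eq0.
have vw0 : v w != 0 by near: w.
have P1w0 : P1.[w] != 0 by near: w.
rewrite PE QE !hornerM !horner_exp !hornerXsubC.
move: (expf_neq0 m wz0) (expf_neq0 l wz0).
move: ((w - z) ^+ m) ((w - z) ^+ l) (u w) (v w) (Q1.[w]) P1.[w] vw0 P1w0.
clear => a b x y p q y0 q0 a0 b0; field.
by rewrite a0 b0 y0 q0.
Unshelve. all: by end_near. Qed.

(* [lam - c mu] vanishes at [z] for [c] the value of the ratio; its vanishing order there is
   finite by the degree hypothesis, which gives the second-order expansion. *)
Lemma ratio_derivable2 g d lam mu z : holomorphic_curve g -> has_degree g d ->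
  ~~ (val (g (chart false z)) <= lker mu)%VS ->
  derivable2 (fun w => ratio g lam mu (chart false w)) z.
Proof.
move=> hg hd muz; have [G lG] := hg false z.
have muG0 : mu (G z) != 0 by rewrite -(functional_line _ lG).
have hmu := holo_functional mu lG.1; have mun := holo_neq0 hmu muG0.
set c := ratio g lam mu (chart false z).
have cE : c = lam (G z) / mu (G z) by exact: (nbhs_singleton (ratio_lift lam mu lG)).
pose lam' : 'Hom(W, C^o) := lam - c *: mu.
have lam'E (w : W) : lam' w = lam w - c * mu w by rewrite add_lfunE opp_lfunE scale_lfunE.
have [lamp|] := pselect (exists p, ~~ (val (g p) <= lker lam')%VS); last first.
  move=> all; exists (fun=> 0); first exact: derivable_cst.
  near=> w; rewrite mulr0 addr0.
  have -> : ratio g lam mu (chart false w) = lam (G w) / mu (G w).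
    by near: w; exact: ratio_lift.
  have wE : val (g (chart false w)) = <[G w]>%VS.
    by near: w; case: lG => _; apply: filterS => w [].
  have muw : mu (G w) != 0 by near: w.
  have : lam' (G w) == 0.
    rewrite -memv_ker; apply: contrapT => /negP h; apply: all; exists (chart false w).
    by rewrite wE -memvE.
  by rewrite lam'E subr_eq0 => /eqP ->; rewrite mulfK.
have [P [n [[_ divP _] _]]] := divisor_poly_exists hd lamp.
have [m [_ [[u [hu u0 uE]] _ _]]] := divP z G lG.
case: m uE => [|m] uE.
  have := nbhs_singleton uE; rewrite expr0 mul1r lam'E cE mulfVK// subrr => /esym/eqP.
  by rewrite (negbTE u0).
exists ((horner (('X - z%:P) ^+ m)) * u * (fun w => (mu (G w))^-1)).
  exact: (holo_derivable (holoM (holoM (holo_horner _ z) hu) (holoV hmu muG0))).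
near=> w.
have muw : mu (G w) != 0 by near: w.
have -> : ratio g lam mu (chart false w) = lam (G w) / mu (G w).
  by near: w; exact: ratio_lift.
change (lam (G w) / mu (G w) =
  c + (w - z) * ((('X - z%:P) ^+ m).[w] * u w / mu (G w))).
have lamw : lam' (G w) = (w - z) ^+ m.+1 * u w by near: w.
have -> : lam (G w) = (w - z) ^+ m.+1 * u w + c * mu (G w) by rewrite -lamw lam'E subrK.
by rewrite horner_exp hornerXsubC exprS mulrDl mulfK// addrC -!mulrA.
Unshelve. all: by end_near. Qed.
End Ratio.

Section Rationality.
Variable R : realType.
Local Notation C := (complex_complex__canonical__Num_NumField R).
Variable W : vectType C.
Implicit Types (g : P1 C -> projective_space W) (lam mu nu : 'Hom(W, C^o)).
Implicit Types (G : C -> W) (z w : C) (P Q : {poly C}).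

Lemma divisor_poly_neq0 g lam P n z v : holomorphic_curve g -> divisor_poly g lam P n ->
  P.[z] != 0 -> v != 0 -> v \in val (g (chart false z)) -> lam v != 0.
Proof.
move=> hg [_ divP _] Pz v0 vz; have [G lG] := hg false z.
have [m [P1 [[u [_ u0 uE]] PE _]]] := divP z G lG.
have m0 : m = 0%N.
  case: m uE PE => // m _ PE; move: Pz.
  by rewrite PE hornerM horner_exp hornerXsubC subrr exprS mul0r mulr0 eqxx.
have lG0 : lam (G z) != 0.
  by have := nbhs_singleton uE; rewrite m0 expr0 mul1r => ->.
move: vz; rewrite (lift_val lG) => /vlineP[k vE]; rewrite vE linearZ mulf_neq0//.
by apply: contra v0 => /eqP k0; rewrite vE k0 scale0r.
Qed.

(** The equalities [deg P + n = d = deg Q + k] balance the powers of the coordinate [w] at infinity,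
    so the common degree is what prevents a zero or a pole there. *)
Lemma ratio_at_infinity g lam mu P n Q k d : holomorphic_curve g ->
  divisor_poly g lam P n -> divisor_poly g mu Q k ->
  (size P + n = d.+1)%N -> (size Q + k = d.+1)%N ->
  exists K : C -> C, {for 0, continuous K} /\
    \forall w \near (0 : C)^',
      ratio g lam mu (chart false w^-1) * (Q.[w^-1] / P.[w^-1]) = K w.
Proof.
move=> hg [P0 _ divP] [Q0 _ divQ] sP sQ; have [G lG] := hg true 0.
have [u [hu u0 uE]] := divP G lG; have [v [hv v0 vE]] := divQ G lG.
have [Pr [Pr0 PrE]] := poly_at_infinity P; have [Qr [Qr0 QrE]] := poly_at_infinity Q.
have Pr00 : Pr.[0] != 0 by rewrite Pr0 lead_coef_eq0.
have Prn := holo_neq0 (holo_horner Pr 0) Pr00; have vn := holo_neq0 hv v0.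
exists (u * (fun w => (v w)^-1) * (horner Qr * (fun w => (Pr.[w])^-1))); split.
  exact: (holo_continuous (holoM (holoM hu (holoV hv v0))
    (holoM (holo_horner Qr 0) (holoV (holo_horner Pr 0) Pr00)))).
rewrite near_withinE; near=> w => w0.
change (ratio g lam mu (chart false w^-1) * (Q.[w^-1] / P.[w^-1]) = u w / v w * (Qr.[w] / Pr.[w])).
have -> : chart false w^-1 = chart true w by rewrite -(chart_swap true w0).
have -> : ratio g lam mu (chart true w) = lam (G w) / mu (G w).
  by near: w; exact: ratio_lift.
have -> : lam (G w) = w ^+ n * u w by rewrite -[w in w ^+ n]subr0; near: w.
have -> : mu (G w) = w ^+ k * v w by rewrite -[w in w ^+ k]subr0; near: w.
have vw0 : v w != 0 by near: w.
have Prw0 : Pr.[w] != 0 by near: w.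
have : (w ^+ n * w ^+ (size P).-1 = w ^+ k * w ^+ (size Q).-1).
  rewrite -!exprD; congr (_ ^+ _).
  have sP0 : (0 < size P)%N by rewrite size_poly_gt0.
  have sQ0 : (0 < size Q)%N by rewrite size_poly_gt0.
  rewrite -[size P]prednK// addSn in sP; rewrite -[size Q]prednK// addSn in sQ.
  by rewrite addnC; case: sP => ->; rewrite addnC; case: sQ.
move: Prw0; rewrite PrE// QrE//.
move: (expf_neq0 n w0) (expf_neq0 k w0) (expf_neq0 (size P).-1 w0) (expf_neq0 (size Q).-1 w0).
move: (w ^+ n) (w ^+ k) (w ^+ (size P).-1) (w ^+ (size Q).-1) (P.[_]) (Q.[_]) (u w) (v w) vw0.
clear => a b c e p q x y y0 a0 b0 c0 e0; rewrite mulf_eq0 negb_or c0 andbT => p0 acbe.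
have -> : e = a * c / b by rewrite acbe mulrC mulKf.
by field; rewrite y0 p0 b0 c0.
Unshelve. all: by end_near. Qed.

(* [(lam / mu) (Q / P)] has neither zeros nor poles on the projective line, so it is
   constant. *)
Lemma divisor_ratio g lam mu P n Q k d : holomorphic_curve g -> has_degree g d ->
  divisor_poly g lam P n -> divisor_poly g mu Q k ->
  (size P + n = d.+1)%N -> (size Q + k = d.+1)%N ->
  exists2 c, c != 0 & exists E : seq C, forall z, z \notin E ->
    forall v, v \in val (g (chart false z)) -> lam v * Q.[z] = c * (mu v * P.[z]).
Proof.
move=> hg hd dP dQ sP sQ.
have P0 : P != 0 by case: dP.
have Q0 : Q != 0 by case: dQ.
have [E hE] := poly_roots_seq (mulf_neq0 P0 Q0).
have PE z : z \notin E -> P.[z] != 0 /\ Q.[z] != 0.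
  move=> zE; have : ~~ root (P * Q) z by apply: contra zE; exact: hE.
  by rewrite rootM negb_or => /andP[].
pose H0 z := ratio g lam mu (chart false z) * (Q.[z] / P.[z]).
have /choice[K KE] z := near_ratio z hg dP dQ.
(* At the roots of [P Q] the formula [H0] is subject to the convention that the inverse of 0 is 0;
   its value there is replaced by the limit. *)
pose H z := if z \in E then K z z else H0 z.
have HH0 z : \forall w \near z^', H w = H0 w.
  by apply: filterS (finite_near E z) => w wE; rewrite /H ifN.
have d2H z : z \notin E -> derivable2 H z.
  move=> zE; have [Pz Qz] := PE z zE.
  apply: (@derivable2_near_eq _ H0).
    apply: near_dnbhs; first by rewrite /H ifN.
    by apply: filterS (HH0 z) => w ->.
  have muz : ~~ (val (g (chart false z)) <= lker mu)%VS.
    have [v0 vE] := vpick_line (g (chart false z)).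
    rewrite vE -memvE memv_ker; apply: divisor_poly_neq0 hg dQ Qz v0 _.
    exact: memv_pick.
  exact: (derivable2M (ratio_derivable2 lam hg hd muz)
    (derivable2M (derivable2_horner Q z) (derivable2V Pz (derivable2_horner P z)))).
have dH z : derivable H z 1.
  have [zE|zE] := boolP (z \in E); last exact: derivable2_derivable (d2H z zE).
  have [dK _ KH] := KE z; apply: near_eq_derivable dK.
  apply: near_dnbhs; first by rewrite /H zE.
  by apply: filterS2 KH (HH0 z) => w <- ->.
have [L [Lc LE]] := ratio_at_infinity hg dP dQ sP sQ.
have HL z : H z = L 0.
  apply: (liouville dH d2H); move/continuous_withinNx: Lc; apply: cvg_trans.
  apply: near_eq_cvg.
  have far : \forall w \near (0 : C)^', w \notin [seq x^-1 | x <- E] by exact: finite_near.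
  apply: filterS2 LE far => w <- wE; rewrite /H ifN//.
  by apply: contra wE => wE; rewrite -[w]invrK map_f.
(* [H] is constantly [L 0] and agrees with [K 0] on a punctured neighbourhood of 0, so [L 0]
   inherits [K 0 0 != 0]. *)
exists (L 0).
  have [dK K0 KH] := KE 0.
  suff -> : L 0 = K 0 0 by [].
  apply: (@continuous_dnbhs_eq _ (fun=> L 0) (K 0) 0); first exact: cst_continuous.
    exact: derivable_continuous.
  by apply: filterS2 KH (HH0 0) => w KHw Hw; rewrite -KHw -/(H0 w) -Hw HL.
exists E => z zE v vz; have [->|v0] := eqVneq v 0; first by rewrite !linear0 !mul0r mulr0.
have [Pz Qz] := PE z zE; have mu0 := divisor_poly_neq0 hg dQ Qz v0 vz.
have := HL z; rewrite /H ifN// /H0 (ratioE _ _ v0 vz) => <-.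
move: (lam v) (mu v) Q.[z] P.[z] mu0 Pz; clear => a b p q b0 q0; field.
by rewrite q0 b0.
Qed.

End Rationality.

(** * Curves with a degree are rational *)

Section VectorPolynomials.
Variables (C : numFieldType) (W : vectType C) (d : nat).
Implicit Types (g : P1 C -> projective_space W) (lam mu nu : 'Hom(W, C^o)).
Implicit Types (G : C -> W) (z w : C) (P Q : {poly C}) (p : 'I_d.+1 -> W).

Definition veval p z : W := \sum_(j < d.+1) z ^+ j *: p j.

(* [veval (flip b p)] is the lift in [chart b] of the curve with homogeneous
   coefficients [p]. *)
Definition flip (b : bool) p : 'I_d.+1 -> W := fun j => p (if b then rev_ord j else j).

Definition lpoly lam p : {poly C} := \poly_(j < d.+1) lam (p (inord j)).

Definition parametrizes g p := forall b z,
  veval (flip b p) z != 0 /\ val (g (chart b z)) = <[veval (flip b p) z]>%VS.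

Lemma lpolyE lam p z : lam (veval p z) = (lpoly lam p).[z].
Proof.
rewrite horner_poly /veval linear_sum; apply: eq_bigr => j _.
by rewrite linearZ inord_val mulrC.
Qed.

Lemma coef_lpoly lam p (j : 'I_d.+1) : (lpoly lam p)`_j = lam (p j).
Proof. by rewrite coef_poly ltn_ord inord_val. Qed.

Lemma size_lpoly lam p : (size (lpoly lam p) <= d.+1)%N.
Proof. exact: size_poly. Qed.

Lemma flipK b p : flip (~~ b) p = flip b (flip true p).
Proof.
by apply/funext => j; rewrite /flip; case: b => /=; rewrite ?rev_ordK.
Qed.

Lemma veval_flip b p z : z != 0 ->
  veval (flip (~~ b) p) z = z ^+ d *: veval (flip b p) z^-1.
Proof.
move=> z0; rewrite /veval scaler_sumr (reindex_inj rev_ord_inj)/=.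
apply: eq_bigr => j _; rewrite scalerA exprVn; congr (_ *: _); last first.
  by rewrite /flip; case: b => /=; rewrite ?rev_ordK.
have jd : (j <= d)%N by rewrite -ltnS.
by rewrite subSS; apply: (mulIf (expf_neq0 j z0)); rewrite -exprD subnK// divfK// expf_neq0.
Qed.

Lemma veval0 p : veval p 0 = p ord0.
Proof.
rewrite /veval big_ord_recl expr0 scale1r big1 ?addr0// => j _.
by rewrite exprS mul0r scale0r.
Qed.

Lemma holo_veval p z : wholomorphic_near (veval p) z.
Proof.
move=> i; rewrite (_ : wcoord (veval p) i = horner (lpoly (dual_coord i) p)).
  exact: holo_horner.
by apply/funext => w; rewrite -lpolyE dual_coordE.
Qed.

Lemma parametrizes_lift g p b z : parametrizes g p -> local_lift g b z (veval (flip b p)).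
Proof.
move=> gp; split; first exact: holo_veval.
by near=> w; apply: gp.
Unshelve. all: by end_near. Qed.

(** The lifts in the two charts differ by the unit [z ^ d] where the charts overlap, so the affine
    line and one point at infinity suffice. *)
Lemma parametrizes_cover g p :
  (forall z, veval p z != 0 /\ val (g (chart false z)) = <[veval p z]>%VS) ->
  (p ord_max != 0 /\ val (g (chart true 0)) = <[p ord_max]>%VS) ->
  parametrizes g p.
Proof.
move=> hfin hinf; have flip0 : flip false p = p by [].
case; last by rewrite flip0.
move=> z; have [->|z0] := eqVneq z 0.
  by rewrite veval0 /flip (_ : rev_ord ord0 = ord_max)//; apply/val_inj; rewrite /= subSS subn0.
have [v0 gE] := hfin z^-1.
rewrite (veval_flip false)// flip0 scaler_eq0 expf_eq0 (negbTE z0) andbF (negbTE v0).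
split=> //; rewrite -(chart_swap true z0) gE.
apply: line_gen; rewrite ?dim_vline ?v0//.
  by apply/vlineP; exists (z ^+ d).
by rewrite scaler_eq0 expf_eq0 (negbTE z0) andbF (negbTE v0).
Qed.

Lemma exists_notin (E : seq C) : exists z, z \notin E.
Proof.
have [n nE] := @injective_notin _ (fun n => n%:R : C) E (mulrIn (oner_neq0 C)).
by exists n%:R.
Qed.

Lemma poly_eq_cofinite P Q (E : seq C) : (forall z, z \notin E -> P.[z] = Q.[z]) -> P = Q.
Proof.
move=> h; apply/eqP; rewrite -subr_eq0; apply: contrapT => /negP PQ0.
have [s hs] := poly_roots_seq PQ0.
have [z] := exists_notin (E ++ s); rewrite mem_cat negb_or => /andP[zE /negP]; apply.
by apply: hs; rewrite rootE hornerD hornerN h// subrr.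
Qed.
End VectorPolynomials.

Section Parametrization.
Variable R : realType.
Local Notation C := (complex_complex__canonical__Num_NumField R).
Variables (W : vectType C) (d : nat).
Implicit Types (g : P1 C -> projective_space W) (lam mu nu : 'Hom(W, C^o)).
Implicit Types (G : C -> W) (z w : C) (P Q : {poly C}) (p : 'I_d.+1 -> W).

Theorem rational_parametrization g : holomorphic_curve g -> has_degree g d ->
  exists p : 'I_d.+1 -> W, parametrizes g p.
Proof.
move=> hg hd.
have nonc b z G lam : local_lift g b z G -> lam (G z) != 0 ->
    exists q, ~~ (val (g q) <= lker lam)%VS.
  by move=> lG l0; exists (chart b z); rewrite (functional_line lam lG).
have [G0 lG0] := hg false 0.
have [lam0 lam0G] := dual_neq0 (lift_neq0 lG0).
have [P0 [n0 [dP0 sP0]]] := divisor_poly_exists hd (nonc _ _ _ _ lG0 lam0G).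
have P0n : P0 != 0 by case: dP0.
(* [N i / P0] is the coordinate [i] divided by [lam0] along the curve. [N i] is a multiple of the
   divisor polynomial of that coordinate, or 0 if the coordinate vanishes on the whole curve. *)
have /choice[N /choice[EN NE]] (i : 'I_(\dim {:W})) : exists N : {poly C}, exists E : seq C,
    (size N <= d.+1)%N /\ forall z, z \notin E -> forall v, v \in val (g (chart false z)) ->
      dual_coord i v * P0.[z] = lam0 v * N.[z].
  have [hi|hi] := pselect (exists q, ~~ (val (g q) <= lker (dual_coord i))%VS); last first.
    exists 0, [::]; split; first by rewrite size_poly0.
    move=> z _ v vz; have : v \in lker (dual_coord i).
      apply: contrapT => /negP vn; apply: hi; exists (chart false z).
      by apply: contra vn => /subvP; apply.
    by rewrite memv_ker => /eqP ->; rewrite horner0 mul0r mulr0.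
  have [P [n [dP sP]]] := divisor_poly_exists hd hi.
  have [c c0 [E hE]] := divisor_ratio hg hd dP dP0 sP sP0.
  exists (c *: P), E; split.
    by rewrite size_scale// -sP leq_addr.
  by move=> z zE v vz; rewrite hornerZ mulrCA; exact: hE.
pose p (j : 'I_d.+1) : W := \sum_i (N i)`_j *: (vbasis {:W})`_i.
have Np i : lpoly (dual_coord i) p = N i.
  apply/polyP => j; rewrite coef_poly; case: ltnP => jd; last first.
    by rewrite nth_default//; apply: leq_trans jd; have [] := NE i.
  rewrite /p linear_sum (bigD1 i)//= big1 ?addr0; last first.
    move=> k ki; rewrite linearZ /= dual_coordE coord_free ?(basis_free (vbasisP _))//.
    by rewrite (negbTE ki) scaler0.
  rewrite linearZ /= dual_coordE coord_free ?(basis_free (vbasisP _))// eqxx inordK//.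
  by rewrite /GRing.scale/= mulr1.
pose E0 := flatten [seq EN i | i <- enum 'I_(\dim {:W})].
have P0v z : z \notin E0 -> forall v, v \in val (g (chart false z)) ->
    P0.[z] *: v = lam0 v *: veval p z.
  move=> zE v vz; apply: dual_eq => lam.
  rewrite !(functional_coord lam); apply: eq_bigr => i _; congr (_ * _).
  rewrite -!dual_coordE !linearZ /= lpolyE Np /GRing.scale/= mulrC.
  have [_ h] := NE i; apply: h => //; apply: contra zE => zE.
  by apply/flatten_mapP; exists i; rewrite ?mem_enum.
have [s0 hs0] := poly_roots_seq P0n.
(* Proportionality off a finite set is an identity of polynomials. It will show that [p] has no
   common zero: a functional not vanishing at a given point of the curve has a divisor polynomial
   not vanishing there. *)
have lamP lam P n : divisor_poly g lam P n -> (size P + n = d.+1)%N ->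
    exists2 c, c != 0 & lpoly lam p = c *: P.
  move=> dP sP; have [c c0 [E hE]] := divisor_ratio hg hd dP dP0 sP sP0.
  exists c => //; apply: (@poly_eq_cofinite _ _ _ (E ++ E0 ++ s0)) => z.
  rewrite !mem_cat !negb_or => /and3P[zE zE0 zs].
  have P0z : P0.[z] != 0 by apply: contra zs => /eqP zs; apply: hs0; rewrite rootE zs.
  have [v0 vE] := vpick_line (g (chart false z)); set v := vpick _ in v0 vE.
  have vz : v \in val (g (chart false z)) by exact: memv_pick.
  have lam0v := divisor_poly_neq0 hg dP0 P0z v0 vz.
  apply: (mulfI lam0v); rewrite -lpolyE hornerZ mulrCA -(hE z zE v vz).
  have := congr1 lam (P0v z zE0 v vz); rewrite !linearZ /= /GRing.scale/= => <-.
  by rewrite mulrC.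
have prop lam z : z \notin E0 ++ s0 -> forall v, v \in val (g (chart false z)) ->
    lam (veval p z) *: v = lam v *: veval p z.
  rewrite mem_cat negb_or => /andP[zE0 zs] v vz.
  have P0z : P0.[z] != 0 by apply: contra zs => /eqP zs; apply: hs0; rewrite rootE zs.
  apply: (scalerI P0z); rewrite scalerA mulrC -scalerA P0v// !scalerA.
  have := congr1 lam (P0v z zE0 v vz); rewrite !linearZ /= /GRing.scale/= => ->.
  by rewrite mulrC.
(* Collinearity of [G] and the polynomial lift passes to the limit at [z]; a functional nonzero on
   both limits makes it an equality of lines. *)
have close b z G lam : local_lift g b z G -> lam (veval (flip b p) z) != 0 -> lam (G z) != 0 ->
    (\forall w \near z^', lam (veval (flip b p) w) *: G w = lam (G w) *: veval (flip b p) w) ->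
    veval (flip b p) z != 0 /\ val (g (chart b z)) = <[veval (flip b p) z]>%VS.
  move=> lG lv lg hw.
  have eqz : lam (veval (flip b p) z) *: G z = lam (G z) *: veval (flip b p) z.
    apply: dual_eq => nu; rewrite !linearZ /=.
    have hv nu' := holo_functional nu' (holo_veval (flip b p) z).
    have hG nu' := holo_functional nu' lG.1.
    apply: (continuous_dnbhs_eq (holo_continuous (holoM (hv lam) (hG nu)))
      (holo_continuous (holoM (hG lam) (hv nu)))).
    by apply: filterS hw => w /(congr1 nu); rewrite !linearZ.
  have v0 : veval (flip b p) z != 0.
    by apply: contra lv => /eqP ->; rewrite linear0.
  split=> //; rewrite (lift_val lG).
  apply: line_gen => //; first by rewrite dim_vline (lift_neq0 lG).
  apply/vlineP; exists ((lam (G z))^-1 * lam (veval (flip b p) z)).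
  by rewrite -scalerA eqz scalerA mulVf// scale1r.
exists p; apply: parametrizes_cover.
- move=> z; have [G lG] := hg false z; have [lam lamG] := dual_neq0 (lift_neq0 lG).
  have [P [n [dP sP]]] := divisor_poly_exists hd (nonc _ _ _ _ lG lamG).
  have [c c0 lpE] := lamP lam P n dP sP.
  apply: (close false z G lam) => //.
    rewrite lpolyE lpE hornerZ mulf_neq0//.
    have [_ divP _] := dP; have [m [Q [[u [_ _ uE]] PE Qz]]] := divP z G lG.
    have m0 : m = 0%N.
      case: m uE {PE} => // m uE; move: lamG.
      by rewrite (nbhs_singleton uE) subrr exprS mul0r mul0r eqxx.
    by rewrite PE m0 expr0 mulr1.
  have lGw : \forall w \near z^', val (g (chart false w)) = <[G w]>%VS.
    by apply: cvg_within; case: lG => _; apply: filterS => w [].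
  apply: filterS2 lGw (finite_near (E0 ++ s0) z) => w gw wE.
  by apply: prop; rewrite // gw memv_line.
- have [G lG] := hg true 0; have [lam lamG] := dual_neq0 (lift_neq0 lG).
  have [P [n [dP sP]]] := divisor_poly_exists hd (nonc _ _ _ _ lG lamG).
  have [c c0 lpE] := lamP lam P n dP sP.
  have pm : veval (flip true p) 0 = p ord_max.
    by rewrite veval0 /flip (_ : rev_ord ord0 = ord_max)//; apply/val_inj; rewrite /= subSS subn0.
  rewrite -pm; apply: (close true 0 G lam) => //.
    rewrite pm -coef_lpoly lpE coefZ mulf_neq0//.
    have [Pn0 _ divP] := dP; have [u [_ _ uE]] := divP G lG.
    have n00 : n = 0%N.
      case: (n) uE => // m uE; move: lamG.
      by rewrite (nbhs_singleton uE) subrr exprS mul0r mul0r eqxx.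
    (* The divisor has multiplicity 0 at infinity, so [P] has full degree [d] and the coefficient at
       [ord_max] is its leading one. *)
    have -> : (ord_max : 'I_d.+1) = (size P).-1 :> nat by move: sP; rewrite n00 addn0 => ->.
    by rewrite -lead_coefE lead_coef_eq0.
  have lGw : \forall w \near (0 : C)^', val (g (chart true w)) = <[G w]>%VS.
    by apply: cvg_within; case: lG => _; apply: filterS => w [].
  have far : \forall w \near (0 : C)^', w \notin [seq x^-1 | x <- E0 ++ s0].
    exact: finite_near.
  have wn0 : \forall w \near (0 : C)^', w != 0 by exact: (nbhs_dnbhs_neq 0).
  apply: filterS3 lGw far wn0 => w gw wE w0.
  have wE' : w^-1 \notin E0 ++ s0 by apply: contra wE => wE; rewrite -[w]invrK map_f.
  have Gw : G w \in val (g (chart false w^-1)).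
    by rewrite -(chart_swap true w0) in gw; rewrite gw memv_line.
  have -> : veval (flip true p) w = w ^+ d *: veval p w^-1 by rewrite (veval_flip false).
  rewrite linearZ /= -[X in X *: G w]/(w ^+ d * lam (veval p w^-1)) -scalerA.
  by rewrite (prop lam _ wE' _ Gw) !scalerA mulrC.
Qed.
End Parametrization.

(** * Symmetric bilinear forms *)

Section SymmetricForms.
Variables (K : numClosedFieldType) (W : vectType K) (form : {symmetric W}).
Implicit Types (u v w : W) (a : K).

Lemma formDl u v w : form (u + v) w = form u w + form v w.
Proof. exact: linearDl. Qed.
Lemma formDr u v w : form u (v + w) = form u v + form u w.
Proof. exact: linearDr. Qed.
Lemma formZl a v w : form (a *: v) w = a * form v w.
Proof. exact: linearZl_LR. Qed.
Lemma formZr a v w : form v (a *: w) = a * form v w.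
Proof. by rewrite linearZr_LR. Qed.
Lemma form0l w : form 0 w = 0.
Proof. exact: linear0l. Qed.
Lemma form0r w : form w 0 = 0.
Proof. exact: linear0r. Qed.
Lemma formC v w : form v w = form w v.
Proof. by have := hermC form v w; rewrite expr0 mul1r. Qed.
Lemma form_suml (I : finType) (F : I -> W) w : form (\sum_i F i) w = \sum_i form (F i) w.
Proof. by elim/big_rec2: _ => [|i x y _ <-]; rewrite ?form0l ?formDl. Qed.
Lemma form_sumr (I : finType) (F : I -> W) w : form w (\sum_i F i) = \sum_i form w (F i).
Proof. by elim/big_rec2: _ => [|i x y _ <-]; rewrite ?form0r ?formDr. Qed.
Lemma formN v w : form (- v) w = - form v w.
Proof. by rewrite -scaleN1r formZl mulN1r. Qed.
Lemma formNr v w : form v (- w) = - form v w.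
Proof. by rewrite -scaleN1r formZr mulN1r. Qed.

Lemma nondegenerateP w : nondegenerate form -> (forall v, form w v = 0) -> w = 0.
Proof.
move=> /eqP nd h; apply/eqP; rewrite -memv0 -nd; apply/mem_orthovP => v _; exact: h.
Qed.

(** Expanding [v] in a basis of [L] factors the pairing matrix through dimension [\dim L], while a
    triangular matrix with nonzero diagonal has full rank [n]. All later rank arguments go through
    this. *)
Lemma triangular_pairing (L : {vspace W}) n (v u : 'I_n -> W) :
  (forall i, v i \in L) -> (forall i j : 'I_n, (i < j)%N -> form (v i) (u j) = 0) ->
  (forall i, form (v i) (u i) != 0) -> (n <= \dim L)%N.
Proof.
move=> vL h0 h1.
pose A : 'M[K]_(n, \dim L) := \matrix_(i, k) coord (vbasis L) k (v i).
pose B : 'M[K]_(\dim L, n) := \matrix_(k, j) form (vbasis L)`_k (u j).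
have ABE i j : (A *m B) i j = form (v i) (u j).
  rewrite mxE [in RHS](coord_vbasis (vL i)) form_suml; apply: eq_bigr => k _.
  by rewrite !mxE formZl.
have : A *m B \in unitmx.
  rewrite unitmxE det_trig; last by apply/is_trig_mxP => i j ij; rewrite ABE h0.
  rewrite unitfE; apply/prodf_neq0 => i _; by rewrite ABE.
rewrite -row_full_unit => /eqP <-.
by apply: leq_trans (mxrankM_maxl _ _) (rank_leq_col _).
Qed.

(** If [w] were nonzero, some [w'] would pair with it nontrivially. Putting [w] before [h] and [w']
    before [u] keeps the pairing triangular, which gives [n + 1] independent vectors in dimension
    [n]. *)
Lemma pairing_eq0 n (h u : 'I_n -> W) w : nondegenerate form -> \dim {:W} = n ->
  (forall i j : 'I_n, (i < j)%N -> form (h i) (u j) = 0) ->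
  (forall i, form (h i) (u i) != 0) -> (forall j, form w (u j) = 0) -> w = 0.
Proof.
move=> nd dW h0 h1 wu; apply: contrapT => w0.
have [w' ww'] : exists w', form w w' != 0.
  apply: contrapT => h'; apply: w0; apply: nondegenerateP nd _ => v.
  by apply/eqP; apply: contrapT => /negP hv; apply: h'; exists v.
pose v (i : 'I_n.+1) := if unlift ord0 i is Some k then h k else w.
pose v' (i : 'I_n.+1) := if unlift ord0 i is Some k then u k else w'.
suff : (n.+1 <= \dim {:W})%N by rewrite dW ltnn.
apply: (@triangular_pairing _ _ v v').
- by move=> i; exact: memvf.
- move=> i j; rewrite /v /v'; case: unliftP => [k ->|->]; case: unliftP => [l ->|->] //=.
  by rewrite /bump/= !add1n ltnS; exact: h0.
- by move=> i; rewrite /v /v'; case: unliftP.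
Qed.

Lemma orthonormal_family k : nondegenerate form -> (k <= \dim {:W})%N ->
  exists e : 'I_k -> W, forall i j, form (e i) (e j) = (i == j)%:R.
Proof.
move=> nd; elim: k => [|k ih] kW; first by exists (fun=> 0); case.
have [e eE] := ih (ltnW kW).
have [pi piE] : exists pi : W -> W, forall x, pi x = x - \sum_i form x (e i) *: e i by eexists.
have pie x j : form (pi x) (e j) = 0.
  rewrite piE formDl formN form_suml (bigD1 j)//= big1 ?addr0; last first.
    by move=> i ij; rewrite formZl eE (negbTE ij) mulr0.
  by rewrite formZl eE eqxx mulr1 subrr.
(* Otherwise polarization annihilates the form on the image of [pi], nondegeneracy gives [pi = 0],
   and the [k] vectors [e i] span the space. *)
have [x px] : exists x, form (pi x) (pi x) != 0.
  apply: contrapT => h.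
  have pi0 x : form (pi x) (pi x) = 0.
    by apply/eqP; apply: contrapT => /negP hx; apply: h; exists x.
  have piD x y : pi (x + y) = pi x + pi y.
    rewrite !piE (eq_bigr (fun i => form x (e i) *: e i + form y (e i) *: e i)); last first.
      by move=> i _; rewrite formDl scalerDl.
    by rewrite big_split opprD addrACA.
  have pixy x y : form (pi x) (pi y) = 0.
    have := pi0 (x + y); rewrite piD formDl !formDr !pi0 add0r addr0 [form (pi y) _]formC.
    by move/eqP; rewrite -mulr2n mulrn_eq0 => /eqP.
  have pix0 x : pi x = 0.
    apply: nondegenerateP nd _ => y.
    rewrite -[y](subrK (\sum_i form y (e i) *: e i)) -piE formDr pixy add0r form_sumr.
    by rewrite big1// => i _; rewrite formZr pie mulr0.
  have : (fullv <= <<[seq e i | i <- enum 'I_k]>>)%VS.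
    apply/subvP => x _; have /eqP := pix0 x; rewrite piE subr_eq0 => /eqP ->.
    by apply: memv_suml => i _; apply/memvZ/memv_span/map_f; rewrite mem_enum.
  move=> /dimvS/leq_trans/(_ (dim_span _)); rewrite size_map size_enum_ord.
  by rewrite leqNgt kW.
set c := form _ _ in px.
exists (fun i => if unlift ord_max i is Some j then e j else (sqrtC c)^-1 *: pi x) => i j.
have sc : sqrtC c != 0 by rewrite sqrtC_eq0.
case: unliftP => [k1 ->|->]; case: unliftP => [k2 ->|->] //=.
- by rewrite eE (inj_eq (@lift_inj _ _)).
- by rewrite formZr formC pie mulr0 eq_sym (negbTE (neq_lift _ _)).
- by rewrite formZl pie mulr0 (negbTE (neq_lift _ _)).
- by rewrite formZl formZr eqxx -/c mulrA -invfM -expr2 sqrtCK mulVf.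
Qed.

Definition hyperbolic (h : 'I_5 -> W) :=
  forall i j : 'I_5, form (h i) (h j) = (i + j == 4)%N%:R.

Lemma hyperbolic_exists : nondegenerate form -> \dim {:W} = 5%N ->
  exists h, hyperbolic h.
Proof.
move=> nd dW; have [|e eE] := @orthonormal_family 5 nd; first by rewrite dW.
pose E k : W := e (inord k).
have EE k l : (k < 5)%N -> (l < 5)%N -> form (E k) (E l) = (k == l)%:R.
  by move=> k5 l5; rewrite eE -val_eqE /= !inordK.
have i2 : 'i * 'i = -1 :> K by rewrite -expr2 sqrCi.
(* The vectors [e + i e'] and [e - i e'] built on an orthonormal pair are isotropic with product 2,
   hence the factor [2^-1] on one of them. *)
exists (fun k : 'I_5 => nth 0 [:: 2^-1 *: (E 0%N + 'i *: E 1%N); 2^-1 *: (E 2%N + 'i *: E 3%N);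
  E 4%N; E 2%N - 'i *: E 3%N; E 0%N - 'i *: E 1%N] k).
move=> [[|[|[|[|[|//]]]]] ?] [[|[|[|[|[|//]]]]] ?] /=;
  rewrite ?formDl ?formDr ?formN ?formNr ?formZl ?formZr ?formDl ?formDr ?formN ?formNr ?formZl ?formZr ?EE//=.
all: rewrite ?mulr0 ?mulr1 ?addr0 ?add0r ?oppr0 ?mulr0 ?addr0 ?mulrN ?opprK ?i2 ?mulrN ?subrr ?mulr0 ?opprK//.
all: try by rewrite sub0r subrr.
all: by rewrite ?(mulrCA 'i) ?i2; field.
Qed.

Lemma hyperbolic_eq0 h w : nondegenerate form -> \dim {:W} = 5%N -> hyperbolic h ->
  (forall j, form w (h j) = 0) -> w = 0.
Proof.
move=> nd dW hh wh; apply: (@pairing_eq0 5 h (fun j => h (rev_ord j))) => //.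
- move=> i j ij; rewrite hh (_ : (_ == _)%N = false)//; apply/eqP => /= ij4.
  by have := ltn_ord j; lia.
- by move=> i; rewrite hh /= subSS subnKC ?oner_neq0//= -ltnS.
Qed.

Lemma hyperbolic_isometry (h v : 'I_5 -> W) : nondegenerate form -> \dim {:W} = 5%N ->
  hyperbolic h -> hyperbolic v ->
  exists A : 'End(W), [/\ lker A == 0%VS, forall w, form (A w) (A w) = form w w
    & forall i, A (h i) = v i].
Proof.
move=> nd dW hh hv.
(* The coefficient of [h i] in [w] is the product with the dual vector [h (rev_ord i)]. *)
pose f w := \sum_i form w (h (rev_ord i)) *: v i.
have flin : linear f.
  move=> a x y; rewrite /f scaler_sumr -big_split; apply: eq_bigr => i _ /=.
  by rewrite formDl formZl scalerDl scalerA.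
pose fL : {linear W -> W} := HB.pack f (GRing.isLinear.Build _ _ _ _ _ flin).
have AE w : linfun fL w = f w by rewrite lfunE.
have sel (i : 'I_5) : [forall j : 'I_5, ((j + rev_ord i)%N == 4) == (j == i)].
  by case: i => [[|[|[|[|[|//]]]]] ?]; apply/forallP => -[[|[|[|[|[|//]]]]] ?].
have fh i : f (h i) = v i.
  rewrite /f (bigD1 i)//= big1 ?addr0.
    by rewrite hh (eqP (forallP (sel i) i)) eqxx scale1r.
  by move=> j ji; rewrite hh (eqP (forallP (sel j) i)) eq_sym (negbTE ji) scale0r.
have hexp w : w = \sum_i form w (h (rev_ord i)) *: h i.
  apply/eqP; rewrite -subr_eq0; apply/eqP/(hyperbolic_eq0 nd dW hh) => j.
  rewrite formDl formN form_suml (bigD1 (rev_ord j))//= big1 ?addr0.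
    by rewrite formZl rev_ordK hh addnC (eqP (forallP (sel j) j)) eqxx mulr1 subrr.
  move=> i ij; have := eqP (forallP (sel (rev_ord j)) i); rewrite rev_ordK => ijE.
  by rewrite formZl hh ijE (negbTE ij) mulr0.
have fform x y : form (f x) (f y) = form x y.
  rewrite [in RHS](hexp x) [in RHS](hexp y) /f !form_suml; apply: eq_bigr => i _.
  rewrite !form_sumr; apply: eq_bigr => j _.
  by rewrite !formZl !formZr hv hh.
exists (linfun fL); split.
- apply/eqP/vspaceP => w; rewrite memv_ker AE memv0; apply/eqP/eqP => [fw|->]; last first.
    by rewrite -AE linear0.
  by apply: nondegenerateP nd _ => u; rewrite -fform fw form0l.
- by move=> w; rewrite !AE fform.
- by move=> i; rewrite AE fh.
Qed.
End SymmetricForms.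

(** * Gram matrices of null sextics *)

Lemma sum7E (V : nmodType) (F : 'I_7 -> V) : \sum_j F j =
  F (inord 0) + (F (inord 1) + (F (inord 2) + (F (inord 3) + (F (inord 4) +
  (F (inord 5) + F (inord 6)))))).
Proof.
rewrite (eq_bigr (fun j : 'I_7 => F (inord j))); last by move=> j _; rewrite inord_val.
by rewrite -(big_mkord xpredT (fun j => F (inord j))) unlock /= addr0.
Qed.

Lemma ord7P (i : 'I_7) : exists2 k, (k < 7)%N & i = inord k.
Proof. by exists i; rewrite ?inord_val. Qed.

Section DerivativeLift.
Variables (C : numFieldType) (W : vectType C) (d : nat).
Implicit Types (lam : 'Hom(W, C^o)) (z c : C) (p : 'I_d.+1 -> W).

Definition vder p z : W := \sum_(j < d.+1) (j%:R * z ^+ j.-1) *: p j.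

Lemma lpoly_der lam p z : lam (vder p z) = (lpoly lam p)^`().[z].
Proof.
have -> : lpoly lam p = \sum_(j < d.+1) lam (p j) *: 'X^j.
  by rewrite /lpoly poly_def; apply: eq_bigr => j _; rewrite inord_val.
rewrite (raddf_sum (@deriv C)) horner_sum /vder linear_sum; apply: eq_bigr => j _.
rewrite linearZ /= derivZ derivXn hornerZ hornerMn hornerXn /= /GRing.scale/=.
by rewrite mulrC mulr_natl.
Qed.

(* The coefficients of [z |-> veval p (z + c)]. *)
Definition shift_coef c p : 'I_d.+1 -> W :=
  fun j => \sum_(k < d.+1) (c ^+ (k - j) *+ 'C(k, j)) *: p k.

Lemma veval_shift c p z : veval (shift_coef c p) z = veval p (z + c).
Proof.
rewrite /veval /shift_coef.
under eq_bigr => j _ do rewrite scaler_sumr.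
rewrite exchange_big; apply: eq_bigr => k _ /=.
under eq_bigr => j _ do rewrite scalerA.
rewrite -scaler_suml; congr (_ *: _); rewrite addrC exprDn.
rewrite (big_ord_widen d.+1 (fun i => c ^+ (k - i) * z ^+ i *+ 'C(k, i)))//.
rewrite [RHS]big_mkcond; apply: eq_bigr => j _; rewrite ltnS.
case: leqP => [_|kj]; first by rewrite mulrC mulrnAl.
by rewrite bin_small// mulr0n mulr0.
Qed.

Lemma lpoly_shift lam c p : lpoly lam (shift_coef c p) = lpoly lam p \Po ('X + c%:P).
Proof.
apply: (@poly_eq_cofinite _ _ _ [::]) => z _.
by rewrite -lpolyE veval_shift lpolyE horner_comp !hornerE.
Qed.

Lemma vder_shift c p z : vder (shift_coef c p) z = vder p (z + c).
Proof.
apply: dual_eq => lam; rewrite !lpoly_der lpoly_shift deriv_comp derivD derivX derivC.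
by rewrite addr0 mulr1 horner_comp !hornerE.
Qed.

Lemma shift_coef_max c p : shift_coef c p ord_max = p ord_max.
Proof.
rewrite /shift_coef (bigD1 ord_max)//= big1 ?addr0.
  by rewrite subnn expr0 binn scale1r.
move=> k kd; rewrite bin_small ?mulr0n ?scale0r//.
by rewrite ltn_neqAle -val_eqE /= in kd *; rewrite kd -ltnS ltn_ord.
Qed.
End DerivativeLift.

Section NullCoefficients.
Variables (K : numClosedFieldType) (W : vectType K) (form : {symmetric W}).
Implicit Types (p : 'I_7 -> W) (z c : K).

Definition gram p i j : K := form (p (inord i)) (p (inord j)).

Lemma gramC p i j : gram p i j = gram p j i.
Proof. exact: formC. Qed.

(* Equivalently, [form (veval p z) (veval p w)] is [(z - w) ^+ 4] times a symmetric
   polynomial of bidegree (2, 2). *)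
Definition null_table p : Prop := let g := gram p in
  [/\ forall i j, (i < 7)%N -> (j < 7)%N -> ~~ (4 <= i + j <= 8)%N -> g i j = 0%R,
      [/\ g 1%N 3%N = - 4 * g 0%N 4%N, g 2%N 2%N = 6 * g 0%N 4%N, g 1%N 4%N = - 3 * g 0%N 5%N & g 2%N 3%N = 2 * g 0%N 5%N],
      g 2%N 4%N = - 9 * g 0%N 6%N - 4 * g 1%N 5%N /\ g 3%N 3%N = 16 * g 0%N 6%N + 6 * g 1%N 5%N
    & [/\ g 2%N 5%N = - 3 * g 1%N 6%N, g 3%N 4%N = 2 * g 1%N 6%N, g 3%N 5%N = - 4 * g 2%N 6%N & g 4%N 4%N = 6 * g 2%N 6%N]].

Definition null_lift p := forall z,
  form (veval p z) (veval p z) = 0 /\ form (vder p z) (vder p z) = 0.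

Lemma quadric_veval p z : form (veval p z) (veval p z) =
  (Poly (let g := gram p in [:: g 0%N 0%N; g 0%N 1%N + g 1%N 0%N;
      g 0%N 2%N + g 1%N 1%N + g 2%N 0%N; g 0%N 3%N + g 1%N 2%N + g 2%N 1%N + g 3%N 0%N;
      g 0%N 4%N + g 1%N 3%N + g 2%N 2%N + g 3%N 1%N + g 4%N 0%N;
      g 0%N 5%N + g 1%N 4%N + g 2%N 3%N + g 3%N 2%N + g 4%N 1%N + g 5%N 0%N;
      g 0%N 6%N + g 1%N 5%N + g 2%N 4%N + g 3%N 3%N + g 4%N 2%N + g 5%N 1%N + g 6%N 0%N;
      g 1%N 6%N + g 2%N 5%N + g 3%N 4%N + g 4%N 3%N + g 5%N 2%N + g 6%N 1%N;
      g 2%N 6%N + g 3%N 5%N + g 4%N 4%N + g 5%N 3%N + g 6%N 2%N;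
      g 3%N 6%N + g 4%N 5%N + g 5%N 4%N + g 6%N 3%N; g 4%N 6%N + g 5%N 5%N + g 6%N 4%N; g 5%N 6%N + g 6%N 5%N; g 6%N 6%N])).[z].
Proof.
rewrite horner_Poly /veval !sum7E !inordK//=.
rewrite !(formDl, formDr) !(formZl, formZr) /gram; ring.
Qed.

Lemma quadric_vder p z : form (vder p z) (vder p z) =
  (Poly (let g := gram p in [:: 1%:R * g 1%N 1%N; 2%:R * g 1%N 2%N + 2%:R * g 2%N 1%N;
      3%:R * g 1%N 3%N + 4%:R * g 2%N 2%N + 3%:R * g 3%N 1%N;
      4%:R * g 1%N 4%N + 6%:R * g 2%N 3%N + 6%:R * g 3%N 2%N + 4%:R * g 4%N 1%N;
      5%:R * g 1%N 5%N + 8%:R * g 2%N 4%N + 9%:R * g 3%N 3%N + 8%:R * g 4%N 2%N +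
      5%:R * g 5%N 1%N;
      6%:R * g 1%N 6%N + 10%:R * g 2%N 5%N + 12%:R * g 3%N 4%N + 12%:R * g 4%N 3%N +
      10%:R * g 5%N 2%N + 6%:R * g 6%N 1%N;
      12%:R * g 2%N 6%N + 15%:R * g 3%N 5%N + 16%:R * g 4%N 4%N + 15%:R * g 5%N 3%N +
      12%:R * g 6%N 2%N;
      18%:R * g 3%N 6%N + 20%:R * g 4%N 5%N + 20%:R * g 5%N 4%N + 18%:R * g 6%N 3%N;
      24%:R * g 4%N 6%N + 25%:R * g 5%N 5%N + 24%:R * g 6%N 4%N; 30%:R * g 5%N 6%N + 30%:R * g 6%N 5%N; 36%:R * g 6%N 6%N])).[z].
Proof.
rewrite horner_Poly /vder !sum7E !inordK//=.
rewrite !(formDl, formDr) !(formZl, formZr) /gram; ring.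
Qed.

Lemma poly_coef_eq0 (s : seq K) : (forall z, (Poly s).[z] = 0) -> forall k, s`_k = 0.
Proof.
move=> h k; have -> : s`_k = (Poly s)`_k by rewrite coef_Poly.
by rewrite (@poly_eq_cofinite _ (Poly s) 0 [::]) ?coef0// => z _; rewrite h horner0.
Qed.

(** Elimination without division: two vanishing expressions give a nonzero integer multiple of the
    unknown, and the remaining identity is left to [ring]. *)
Lemma lincomb_eq0 n (x a b e1 e2 : K) : n.+1%:R * x = a * e1 + b * e2 ->
  e1 = 0 -> e2 = 0 -> x = 0.
Proof.
move=> + e10 e20; rewrite e10 e20 !mulr0 addr0 => /eqP.
by rewrite mulf_eq0 pnatr_eq0 => /eqP.
Qed.

Lemma null_lift_table p : null_lift p -> null_table p.
Proof.
move=> hp.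
have S := poly_coef_eq0 (fun z => etrans (esym (quadric_veval p z)) (hp z).1).
have T := poly_coef_eq0 (fun z => etrans (esym (quadric_vder p z)) (hp z).2).
have gC := gramC p.
have S0 := S 0%N; have S1 := S 1%N; have S2 := S 2%N; have S3 := S 3%N; have S4 := S 4%N.
have S5 := S 5%N; have S6 := S 6%N; have S7 := S 7%N; have S8 := S 8%N; have S9 := S 9%N.
have S10 := S 10%N; have S11 := S 11%N; have S12 := S 12%N.
(* The coefficient of [z^k] in [form P' P'] involves the entries with [i + j = k + 2]. After this
   renumbering, [S] and [T] of the same index are two equations on the same antidiagonal. *)
have T2 := T 0%N; have T3 := T 1%N; have T4 := T 2%N; have T5 := T 3%N; have T6 := T 4%N.
have T7 := T 5%N; have T8 := T 6%N; have T9 := T 7%N; have T10 := T 8%N.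
clear S T.
move: S0 S1 S2 S3 S4 S5 S6 S7 S8 S9 S10 S11 S12 T2 T3 T4 T5 T6 T7 T8 T9 T10 => /=.
rewrite (gC 1 0)%N (gC 2 0)%N (gC 3 0)%N (gC 4 0)%N (gC 5 0)%N (gC 6 0)%N
  (gC 2 1)%N (gC 3 1)%N (gC 4 1)%N (gC 5 1)%N (gC 6 1)%N (gC 3 2)%N (gC 4 2)%N
  (gC 5 2)%N (gC 6 2)%N (gC 4 3)%N (gC 5 3)%N (gC 6 3)%N (gC 5 4)%N (gC 6 4)%N (gC 6 5)%N.
move=> S0 S1 S2 S3 S4 S5 S6 S7 S8 S9 S10 S11 S12 T2 T3 T4 T5 T6 T7 T8 T9 T10.
have g01 : gram p 0 1 = 0 by apply: (@lincomb_eq0 1 _ 1 0 _ _ _ S1 S1); ring.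
have g02 : gram p 0 2 = 0 by apply: (@lincomb_eq0 1 _ 1 (-1) _ _ _ S2 T2); ring.
have g11 : gram p 1 1 = 0 by apply: (@lincomb_eq0 0 _ 0 1 _ _ _ S2 T2); ring.
have g03 : gram p 0 3 = 0 by apply: (@lincomb_eq0 3 _ 2 (-1) _ _ _ S3 T3); ring.
have g12 : gram p 1 2 = 0 by apply: (@lincomb_eq0 3 _ 0 1 _ _ _ S3 T3); ring.
have g36 : gram p 3 6 = 0 by apply: (@lincomb_eq0 3 _ 20 (-1) _ _ _ S9 T9); ring.
have g45 : gram p 4 5 = 0 by apply: (@lincomb_eq0 3 _ (-18) 1 _ _ _ S9 T9); ring.
have g46 : gram p 4 6 = 0 by apply: (@lincomb_eq0 1 _ 25 (-1) _ _ _ S10 T10); ring.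
have g55 : gram p 5 5 = 0 by apply: (@lincomb_eq0 0 _ (-24) 1 _ _ _ S10 T10); ring.
have g56 : gram p 5 6 = 0 by apply: (@lincomb_eq0 1 _ 1 0 _ _ _ S11 S11); ring.
split.
- move=> [|[|[|[|[|[|[|i]]]]]]] [|[|[|[|[|[|[|j]]]]]]] //= _ _ _; rewrite ?S0 ?S12//; by rewrite gC.
- split; apply/eqP; rewrite -subr_eq0; apply/eqP.
  + by apply: (@lincomb_eq0 1 _ 4 (-1) _ _ _ S4 T4); ring.
  + by apply: (@lincomb_eq0 0 _ (-3) 1 _ _ _ S4 T4); ring.
  + by apply: (@lincomb_eq0 3 _ 6 (-1) _ _ _ S5 T5); ring.
  + by apply: (@lincomb_eq0 3 _ (-4) 1 _ _ _ S5 T5); ring.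
- split; apply/eqP; rewrite -subr_eq0; apply/eqP.
  + by apply: (@lincomb_eq0 1 _ 9 (-1) _ _ _ S6 T6); ring.
  + by apply: (@lincomb_eq0 0 _ (-8) 1 _ _ _ S6 T6); ring.
- split; apply/eqP; rewrite -subr_eq0; apply/eqP.
  + by apply: (@lincomb_eq0 3 _ 12 (-1) _ _ _ S7 T7); ring.
  + by apply: (@lincomb_eq0 3 _ (-10) 1 _ _ _ S7 T7); ring.
  + by apply: (@lincomb_eq0 1 _ 16 (-1) _ _ _ S8 T8); ring.
  + by apply: (@lincomb_eq0 0 _ (-15) 1 _ _ _ S8 T8); ring.
Qed.

Lemma null_table_lift p : null_table p -> null_lift p.
Proof.
move=> [out [g13 g22 g14 g23] [g24 g33] [g25 g34 g35 g44]] z.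
have gC := gramC p.
have E := (out 0 0, out 0 1, out 0 2, out 0 3, out 1 1, out 1 2, out 3 6, out 4 5, out 4 6,
  out 5 5, out 5 6, out 6 6)%N.
rewrite quadric_veval quadric_vder !horner_Poly /=.
rewrite (gC 1 0)%N (gC 2 0)%N (gC 3 0)%N (gC 4 0)%N (gC 5 0)%N (gC 6 0)%N
  (gC 2 1)%N (gC 3 1)%N (gC 4 1)%N (gC 5 1)%N (gC 6 1)%N (gC 3 2)%N (gC 4 2)%N
  (gC 5 2)%N (gC 6 2)%N (gC 4 3)%N (gC 5 3)%N (gC 6 3)%N (gC 5 4)%N (gC 6 4)%N (gC 6 5)%N.
rewrite !E// g13 g22 g14 g23 g24 g33 g25 g34 g35 g44; split; ring.
Qed.

Lemma null_table_flip p : null_table p -> null_table (flip true p).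
Proof.
move=> [out [g13 g22 g14 g23] [g24 g33] [g25 g34 g35 g44]].
have gF i j : (i < 7)%N -> (j < 7)%N -> gram (flip true p) i j = gram p (6 - j) (6 - i).
  move=> i7 j7; rewrite gramC /gram /flip; congr (form (p _) (p _)).
    by apply/val_inj; rewrite /= !inordK//= ltnS leq_subr.
  by apply/val_inj; rewrite /= !inordK//= ltnS leq_subr.
rewrite /null_table !gF//= !subn0; split=> //.
by move=> i j i7 j7 ij; rewrite gF// out//; lia.
Qed.

(** Translation mixes the entries of the table but plainly preserves [null_lift], so the proof
    passes through the latter. *)
Lemma null_table_shift c p : null_table p -> null_table (shift_coef c p).
Proof.
move=> /null_table_lift hp; apply: null_lift_table => z.
by rewrite veval_shift vder_shift; exact: hp.
Qed.

(** The entry (0, 4) is [C(0, 0)], so for the translated curve it is [C(c, c)]: the right-hand side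
    is the quartic [C(z, z)] written in Gram entries. *)
Lemma gram_shift04 c p : null_table p -> gram (shift_coef c p) 0 4 =
  gram p 0 4 + 2 * gram p 0 5 * c + (gram p 1 5 + 6 * gram p 0 6) * c ^+ 2 +
  2 * gram p 1 6 * c ^+ 3 + gram p 2 6 * c ^+ 4.
Proof.
move=> [out [g13 g22 g14 g23] [g24 g33] [g25 g34 g35 g44]].
have gC := gramC p.
rewrite {1}/gram /shift_coef !sum7E !inordK//=.
rewrite !(mulr1n, bin0, bin1, binn, expr0, expr1).
have -> : 'C(5, 4) = 5%N by []. have -> : 'C(6, 4) = 15%N by [].
rewrite !bin_small// !mulr0n !scale0r !add0r.
rewrite !(formDl, formDr) !(formZl, formZr) -!/(gram p _ _).
rewrite !subn0 -[(6 - 4)%N]/2%N g24 g25 g34 g35 g44 (gC 5 4)%N (gC 6 4)%N (gC 6 5)%N g14.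
rewrite !(out 3 6, out 4 5, out 4 6, out 5 5, out 5 6, out 6 6)%N//; ring.
Qed.

(** This entry is the leading coefficient of the quartic [C(z, z)], that is its value at infinity, a
    point fixed by translations. *)
Lemma gram_shift26 c p : null_table p -> gram (shift_coef c p) 2 6 = gram p 2 6.
Proof.
move=> [out _ _ _].
rewrite {1}/gram /shift_coef !sum7E !inordK//=.
have bin2 : ('C(0, 2) = 0)%N * ('C(1, 2) = 0)%N by [].
have bin6 k : (k < 6)%N -> 'C(k, 6) = 0%N by exact: bin_small.
rewrite !(mulr1n, binn, expr0) !bin2 !bin6// !mulr0n !scale0r !add0r scale1r.
rewrite !(formDl, formZl) !scale1r -!/(gram p _ _).
by rewrite !(out 3 6, out 4 6, out 5 6, out 6 6)%N// !mulr0 !addr0.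
Qed.
End NullCoefficients.

Section Subspaces.
Variables (K : fieldType) (W : vectType K).

Lemma subspace_extension (U : {vspace W}) m : (\dim U <= m <= \dim {:W})%N ->
  exists2 L : {vspace W}, (U <= L)%VS & \dim L = m.
Proof.
move=> /andP[Um mW]; pose V := <<take (m - \dim U) (vbasis (U^C)%VS)>>%VS.
have dC : (\dim U + \dim (U^C)%VS = \dim {:W})%N.
  by rewrite dimv_compl subnKC// dimvS// subvf.
have VC : (V <= U^C)%VS.
  apply/span_subvP => v /mem_take; exact: vbasis_mem.
exists (U + V)%VS; first exact: addvSl.
rewrite dimv_disjoint_sum; last first.
  by apply/eqP; rewrite -subv0 -(capv_compl U); apply: capvS.
have /eqP -> : free (take (m - \dim U) (vbasis (U^C)%VS)).
  apply: (@catl_free _ _ (drop (m - \dim U) (vbasis (U^C)%VS))).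
  by rewrite cat_take_drop (basis_free (vbasisP _)).
rewrite size_take size_tuple; case: ltnP => h; lia.
Qed.
End Subspaces.

(** * Rank restrictions on the Gram matrix *)

Section Tables.
Variables (K : numClosedFieldType) (W : vectType K) (form : {symmetric W}).
Hypotheses (nd : nondegenerate form) (dW : \dim {:W} = 5%N).
Implicit Types (p : 'I_7 -> W) (z c : K).

(** In orthonormal coordinates a basis of [U] forms a matrix [X] of full row rank with [X X^T = 0],
    so twice its rank is at most 5. *)
Lemma isotropic_dim (U : {vspace W}) :
  {in U &, forall u v, form u v = 0} -> (\dim U <= 2)%N.
Proof.
move=> iso; have [|e eE] := @orthonormal_family _ _ form 5 nd; first by rewrite dW.
pose X : 'M[K]_(\dim U, 5) := \matrix_(i, j) form (vbasis U)`_i (e j).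
have expand w : w = \sum_j form w (e j) *: e j.
  apply/eqP; rewrite -subr_eq0; apply/eqP.
  apply: (@pairing_eq0 _ _ form 5 e e) => //.
  - by move=> i j ij; rewrite eE -val_eqE /= ltn_eqF.
  - by move=> i; rewrite eE eqxx oner_neq0.
  - move=> j; rewrite formDl formN form_suml (bigD1 j)//= big1 ?addr0.
      by rewrite formZl eE eqxx mulr1 subrr.
    by move=> i ij; rewrite formZl eE (negbTE ij) mulr0.
have XX : X *m X^T = 0.
  apply/matrixP => i j; rewrite !mxE.
  rewrite -[RHS](iso (vbasis U)`_i (vbasis U)`_j) ?vbasis_mem ?mem_nth ?size_tuple//.
  rewrite [in RHS](expand (vbasis U)`_j) form_sumr; apply: eq_bigr => k _.
  by rewrite !mxE formZr mulrC.
pose Y : 'M[K]_(5, \dim U) := \matrix_(j, l) coord (vbasis U) l (e j).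
have XY : X *m Y = 1%:M.
  apply/matrixP => i l; rewrite !mxE -[RHS](coord_free _ _ (basis_free (vbasisP U))).
  rewrite [in RHS](expand (vbasis U)`_i) linear_sum; apply: eq_bigr => j _.
  by rewrite !mxE linearZ.
have rX : \rank X = \dim U.
  apply/eqP; rewrite eqn_leq rank_leq_row -{1}(mxrank1 K (\dim U)) -XY.
  exact: mxrankM_maxl.
have := mulmx0_rank_max XX; rewrite mxrank_tr rX; lia.
Qed.

(** The span of the coefficients is totally isotropic, hence of dimension at most 2. This is how
    nonlinearity excludes a zero Gram matrix. *)
Lemma isotropic_line p : (forall i j, (i < 7)%N -> (j < 7)%N -> gram form p i j = 0) ->
  exists L : {vspace W}, \dim L = 2%N /\ forall j, p j \in L.
Proof.
move=> g0; pose U := <<[seq p j | j <- enum 'I_7]>>%VS.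
have perp w : (forall j, form w (p j) = 0) -> {in U, forall v, form w v = 0}.
  move=> wp v vU; apply/eqP; rewrite formC -mem_orthov1; apply: subvP v vU.
  by apply/span_subvP => _ /mapP[j _ ->]; rewrite mem_orthov1 formC wp.
have iso : {in U &, forall u v, form u v = 0}.
  move=> u v uU; apply: (perp) => j; rewrite formC.
  have pj i : form (p j) (p i) = 0 by have := g0 j i (ltn_ord _) (ltn_ord _); rewrite /gram !inord_val.
  exact: (perp _ pj u uU).
have [|L UL dL] := @subspace_extension _ _ U 2; first by rewrite (isotropic_dim iso) dW.
exists L; split=> // j; apply: (subvP UL); apply: memv_span; apply: map_f.
by rewrite mem_enum.
Qed.

Lemma gram_triangular6 p (s t : seq nat) :
  (forall i j, (i < j)%N -> (j < 6)%N -> gram form p (nth 0 s i) (nth 0 t j) = 0) ->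
  (forall i, (i < 6)%N -> gram form p (nth 0 s i) (nth 0 t i) != 0) -> False.
Proof.
move=> h0 h1; suff : (6 <= \dim {:W})%N by rewrite dW.
apply: (@triangular_pairing _ _ form fullv 6 (fun i => p (inord (nth 0 s i)%N))
  (fun i => p (inord (nth 0 t i)%N))).
- by move=> i; exact: memvf.
- by move=> i j ij; apply: h0 ij (ltn_ord j).
- by move=> i; apply: h1.
Qed.

Lemma gram_triangular5 p (s t : seq nat) w :
  (forall i j, (i < j)%N -> (j < 5)%N -> gram form p (nth 0 s i) (nth 0 t j) = 0) ->
  (forall i, (i < 5)%N -> gram form p (nth 0 s i) (nth 0 t i) != 0) ->
  (forall j, (j < 5)%N -> form w (p (inord (nth 0 t j)%N)) = 0) -> w = 0.
Proof.
move=> h0 h1 hw.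
apply: (@pairing_eq0 _ _ form 5 (fun i => p (inord (nth 0 s i)%N))
  (fun i => p (inord (nth 0 t i)%N)) w nd dW).
- by move=> i j ij; apply: h0 ij (ltn_ord j).
- by move=> i; apply: h1.
- by move=> j; apply: hw.
Qed.

Let natr_neq0 n : n.+1%:R != 0 :> K. Proof. by rewrite pnatr_eq0. Qed.

(** The hypotheses make [C(z, z)] a nonzero constant, with all its roots at infinity. If the (0, 6)
    entry is nonzero, antidiagonal 6 yields rank 6. Otherwise only antidiagonal 4 remains, and [p_6]
    is orthogonal to the basis [p_0, ..., p_4]. *)
Lemma null_table_no_node p : null_table form p ->
  gram form p 0 5 = 0 -> gram form p 1 5 = - 6 * gram form p 0 6 ->
  gram form p 1 6 = 0 -> gram form p 2 6 = 0 -> gram form p 0 4 != 0 ->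
  p (inord 6) = 0.
Proof.
move=> [out [g13 g22 g14 g23] [g24 g33] [g25 g34 g35 g44]] g05 g15 g16 g26 g04.
have gC := gramC form p.
rewrite g05 g16 g26 !mulr0 in g14 g23 g25 g34 g35 g44.
have {}g24 : gram form p 2 4 = 15 * gram form p 0 6 by rewrite g24 g15; ring.
have {}g33 : gram form p 3 3 = - 20 * gram form p 0 6 by rewrite g33 g15; ring.
have E := (g05, g14, g23, g16, g25, g34, g26, g35, g44).
have off i j : (i < 7)%N -> (j < 7)%N -> (i + j)%N \notin [:: 4; 6]%N -> gram form p i j = 0.
  case: i j => [|[|[|[|[|[|[|i]]]]]]] [|[|[|[|[|[|[|j]]]]]]] //= _ _ _;
    by [rewrite out|rewrite E|rewrite gC E].
have [b0|b0] := eqVneq (gram form p 0 6) 0; last first.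
  case: (@gram_triangular6 p [:: 6; 5; 4; 3; 2; 1]%N [:: 0; 1; 2; 3; 4; 5]%N).
    by move=> [|[|[|[|[|[|i]]]]]] [|[|[|[|[|[|j]]]]]] //= _ _; rewrite off.
  have b15 : gram form p 1 5 != 0 by rewrite g15 mulf_neq0 ?oppr_eq0.
  have b24 : gram form p 2 4 != 0 by rewrite g24 mulf_neq0.
  have b33 : gram form p 3 3 != 0 by rewrite g33 mulf_neq0 ?oppr_eq0.
  by move=> [|[|[|[|[|[|i]]]]]] //= _; by [|rewrite gC].
rewrite b0 !mulr0 in g15 g24 g33.
apply: (@gram_triangular5 p [:: 0; 1; 2; 3; 4]%N [:: 4; 3; 2; 1; 0]%N).
- by move=> [|[|[|[|[|[|i]]]]]] [|[|[|[|[|[|j]]]]]] //= _ _; rewrite off.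
- have b13 : gram form p 1 3 != 0 by rewrite g13 mulf_neq0 ?oppr_eq0.
  have b22 : gram form p 2 2 != 0 by rewrite g22 mulf_neq0.
  by move=> [|[|[|[|[|[|i]]]]]] //= _; by [|rewrite gC].
- move=> j j5; rewrite -/(gram form p 6 _) gC.
  by case: j j5 => [|[|[|[|[|j]]]]] //= _; by [|rewrite off].
Qed.

(* Seven vectors in dimension 5 have a Gram matrix of rank at most 5. Of the parameters left
   free in [null_table], only [b] and the entry (1, 5), say [t], survive, and the Gram matrix is
   antidiagonal with entries [b, t, - 9 b - 4 t, 16 b + 6 t]: rank 5 leaves [t = 0] or
   [9 b + 4 t = 0]. *)
Lemma null_table_cases p : null_table form p ->
  gram form p 0 4 = 0 -> gram form p 2 6 = 0 -> p (inord 0) != 0 ->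
  (exists i j, ((i < 7)%N /\ (j < 7)%N) /\ gram form p i j != 0) ->
  let b := gram form p 0 6 in b != 0 /\
  ((forall i j, (i < 7)%N -> (j < 7)%N -> (i + j)%N != 6%N -> gram form p i j = 0) /\
  ([/\ p (inord 1) = 0, p (inord 5) = 0, gram form p 2 4 = - 9 * b & gram form p 3 3 = 16 * b]
  \/ [/\ p (inord 2) = 0, p (inord 4) = 0, 4 * gram form p 1 5 = - 9 * b &
        2 * gram form p 3 3 = 5 * b])).
Proof.
move=> [out [g13 g22 g14 g23] [g24 g33] [g25 g34 g35 g44]] g04 g26 p0 nz b.
have gC := gramC form p.
rewrite g04 g26 !mulr0 in g13 g22 g35 g44.
have E4 := (g04, g13, g22, g26, g35, g44).
(* Antidiagonal 5 consists of nonzero multiples of this entry and everything before it is zero, so a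
   nonzero value gives rank 6. The same holds for antidiagonal 7 and the entry (1, 6), with
   everything after it zero. *)
have [g05|g05] := eqVneq (gram form p 0 5) 0; last first.
  exfalso; apply: (@gram_triangular6 p [:: 0; 1; 2; 3; 4; 5]%N [:: 5; 4; 3; 2; 1; 0]%N).
    by move=> [|[|[|[|[|[|i]]]]]] [|[|[|[|[|[|j]]]]]] //= _ _;
      by [rewrite out|rewrite E4|rewrite gC E4].
  have b14 : gram form p 1 4 != 0 by rewrite g14 mulf_neq0 ?oppr_eq0.
  have b23 : gram form p 2 3 != 0 by rewrite g23 mulf_neq0.
  by move=> [|[|[|[|[|[|i]]]]]] //= _; by [|rewrite gC].
have [g16|g16] := eqVneq (gram form p 1 6) 0; last first.
  exfalso; apply: (@gram_triangular6 p [:: 6; 5; 4; 3; 2; 1]%N [:: 1; 2; 3; 4; 5; 6]%N).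
    by move=> [|[|[|[|[|[|i]]]]]] [|[|[|[|[|[|j]]]]]] //= _ _;
      by [rewrite out|rewrite E4|rewrite gC E4].
  have b25 : gram form p 2 5 != 0 by rewrite g25 mulf_neq0 ?oppr_eq0.
  have b34 : gram form p 3 4 != 0 by rewrite g34 mulf_neq0.
  by move=> [|[|[|[|[|[|i]]]]]] //= _; by [|rewrite gC].
rewrite g05 g16 !mulr0 in g14 g23 g25 g34.
have E := (E4, (g05, g14, g23, g16, g25, g34)).
have off i j : (i < 7)%N -> (j < 7)%N -> (i + j)%N != 6%N -> gram form p i j = 0.
  case: i j => [|[|[|[|[|[|[|i]]]]]]] [|[|[|[|[|[|[|j]]]]]]] //= _ _ _;
    by [rewrite out|rewrite E|rewrite gC E].
(* With [b = 0] the antidiagonal reads [0, t, -4 t, 6 t, -4 t, t, 0]. Either the Gram matrix is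
   zero, or [p_1, ..., p_5] form a basis orthogonal to [p_0]. *)
have [b0|b0] := eqVneq b 0.
  rewrite -/b b0 !mulr0 !(sub0r, add0r) in g24 g33.
  have [t0|t0] := eqVneq (gram form p 1 5) 0.
    rewrite t0 !mulr0 ?oppr0 in g24 g33; exfalso; case: nz => i [j [[i7 j7] /eqP nz]]; apply: nz.
    have [ij|ij] := eqVneq (i + j)%N 6%N; last exact: off.
    by case: i j i7 j7 ij => [|[|[|[|[|[|[|i]]]]]]] [|[|[|[|[|[|[|j]]]]]]] //= _ _ _; by [|rewrite gC].
  exfalso; case/eqP: p0.
  apply: (@gram_triangular5 p [:: 1; 2; 3; 4; 5]%N [:: 5; 4; 3; 2; 1]%N).
  - by move=> [|[|[|[|[|[|i]]]]]] [|[|[|[|[|[|j]]]]]] //= _ _; rewrite off.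
  - have b24 : gram form p 2 4 != 0 by rewrite g24 oppr_eq0 mulf_neq0.
    have b33 : gram form p 3 3 != 0 by rewrite g33 mulf_neq0.
    by move=> [|[|[|[|[|[|i]]]]]] //= _; by [|rewrite gC].
  - by move=> [|[|[|[|[|[|j]]]]]] //= _; rewrite -/(gram form p 0 _) off.
split=> //; split=> //.
(* In both surviving cases five coefficients form a basis, and the other two, being orthogonal to
   it, are zero. *)
have [t0|t0] := eqVneq (gram form p 1 5) 0.
  left; rewrite t0 !mulr0 addr0 subr0 in g24 g33.
  have z k : k = 1%N \/ k = 5%N -> p (inord k) = 0.
    move=> hk; apply: (@gram_triangular5 p [:: 0; 2; 3; 4; 6]%N [:: 6; 4; 3; 2; 0]%N).
    - by move=> [|[|[|[|[|[|i]]]]]] [|[|[|[|[|[|j]]]]]] //= _ _; rewrite off.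
    - have b24 : gram form p 2 4 != 0 by rewrite g24 mulf_neq0 ?oppr_eq0.
      have b33 : gram form p 3 3 != 0 by rewrite g33 mulf_neq0.
      by move=> [|[|[|[|[|[|i]]]]]] //= _; by [|rewrite gC].
    - by case: hk => -> [|[|[|[|[|[|j]]]]]] //= _; rewrite -/(gram form p _ _) off.
  by split=> //; apply: z; [left|right].
have [bt|bt] := eqVneq (9 * b + 4 * gram form p 1 5) 0; last first.
  exfalso; apply: (@gram_triangular6 p [:: 0; 1; 2; 4; 5; 6]%N [:: 6; 5; 4; 2; 1; 0]%N).
    by move=> [|[|[|[|[|[|i]]]]]] [|[|[|[|[|[|j]]]]]] //= _ _; rewrite off.
  have g24n : gram form p 2 4 != 0.
    by apply: contra bt => /eqP g0; rewrite -oppr_eq0 opprD -mulNr -g24 g0.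
  by move=> [|[|[|[|[|[|i]]]]]] //= _; by [|rewrite gC].
right; have t4 : 4 * gram form p 1 5 = - 9 * b.
  by apply/eqP; rewrite -subr_eq0 -[X in _ == X]bt; apply/eqP; ring.
have g33' : 2 * gram form p 3 3 = 5 * b.
  have -> : 2 * gram form p 3 3 = 32 * b + 3 * (4 * gram form p 1 5) by rewrite g33 -/b; ring.
  by rewrite t4; ring.
have g33n : gram form p 3 3 != 0.
  by apply: contraTneq (mulf_neq0 (natr_neq0 4) b0) => g0; rewrite negbK -g33' g0 mulr0.
have z k : k = 2%N \/ k = 4%N -> p (inord k) = 0.
  move=> hk; apply: (@gram_triangular5 p [:: 0; 1; 3; 5; 6]%N [:: 6; 5; 3; 1; 0]%N).
  - by move=> [|[|[|[|[|[|i]]]]]] [|[|[|[|[|[|j]]]]]] //= _ _; rewrite off.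
  - by move=> [|[|[|[|[|[|i]]]]]] //= _; by [|rewrite gC].
  - by case: hk => -> [|[|[|[|[|[|j]]]]]] //= _; rewrite -/(gram form p _ _) off.
by split=> //; apply: z; [left|right].
Qed.
End Tables.

(** * Reparametrization and normal form *)

Section Wderive.
Variables (C : numFieldType) (W : vectType C).
Implicit Types (lam : 'Hom(W, C^o)) (z c : C) (G P : C -> W).

(** This frees [wderive] from the chosen basis: vector identities for derivatives are henceforth
    tested on functionals. *)
Lemma functional_wderive lam G z : wholomorphic_near G z ->
  lam (wderive G z) = derive1 (fun w => lam (G w)) z.
Proof.
move=> hG; have dG i : derivable (wcoord G i) z 1 by exact: holo_derivable (hG i).
have [k kE] := choice (fun i => derivable_slope (dG i)).
have [|w|_ ->] := @slope_derivable C (fun w => lam (G w))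
    (fun w => \sum_i k i w * lam (vbasis {:W})`_i) z.
- rewrite (_ : (fun w => _) = \sum_i (k i * cst (lam (vbasis {:W})`_i))); last first.
    by apply/funext => w; rewrite fct_sumE.
  apply: (@big_ind _ (fun f : C -> C => {for z, continuous f})).
  + exact: cst_continuous.
  + by move=> f f' cf cf'; exact: continuousD.
  + by move=> i _; apply: continuousM; [have [] := kE i|exact: cst_continuous].
- rewrite !(functional_coord lam) mulr_sumr -big_split; apply: eq_bigr => i _ /=.
  by have [_ _ /(_ w)] := kE i; rewrite /wcoord => ->; ring.
- rewrite /wderive linear_sum; apply: eq_bigr => i _.
  by rewrite linearZ /=; have [_ -> _] := kE i.
Qed.

Lemma wderive_scale (r : C -> C) P G z : derivable r z 1 ->
  wholomorphic_near P z -> wholomorphic_near G z ->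
  (\forall w \near z, G w = r w *: P w) ->
  wderive G z = derive1 r z *: P z + r z *: wderive P z.
Proof.
move=> dr hP hG GE; apply: dual_eq => lam.
rewrite functional_wderive// linearD !linearZ /= functional_wderive//.
have dP := holo_derivable (holo_functional lam hP).
have -> : derive1 (fun w => lam (G w)) z = derive1 (r * (fun w => lam (P w))) z.
  rewrite !derive1E; apply: near_eq_derive.
  by apply: filterS GE => w ->; rewrite linearZ.
by rewrite derive1E deriveM// -!derive1E addrC /GRing.scale/= [_ * lam _]mulrC.
Qed.

Lemma wderive_veval d (p : 'I_d.+1 -> W) z : wderive (veval p) z = vder p z.
Proof.
apply: dual_eq => lam; rewrite functional_wderive ?lpoly_der -?derive1_hornerC.
  by congr (derive1 _ z); apply/funext => w; rewrite lpolyE.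
exact: holo_veval.
Qed.

(* The factor [r] is recovered from any functional not vanishing at [P z]. *)
Lemma lift_factor g b z G P : local_lift g b z G -> local_lift g b z P ->
  exists r : C -> C, [/\ derivable r z 1, r z != 0 & \forall w \near z, G w = r w *: P w].
Proof.
move=> lG lP; have [nu nuP] := dual_neq0 (lift_neq0 lP).
have hP := holo_functional nu lP.1; have hG := holo_functional nu lG.1.
have prop := lift_proportional lP lG.
exists ((fun w => nu (G w)) * (fun w => (nu (P w))^-1)); split.
- exact: holo_derivable (holoM hG (holoV hP nuP)).
- have [c c0 E] := nbhs_singleton prop.
  change (nu (G z) / nu (P z) != 0); rewrite E linearZ /= mulfK//.
- apply: filterS2 prop (holo_neq0 hP nuP) => w [c c0 E] nuw.
  change (G w = (nu (G w) / nu (P w)) *: P w).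
  by rewrite E linearZ /= mulfK.
Qed.
End Wderive.

Section Mobius.
Variable C : numFieldType.
Implicit Types (f : 'End('rV[C]_2)) (z c : C).

(** Where the image of the line is not a line, which happens only for singular [f], the default
    value is [p]. *)
Definition mobius f (p : P1 C) : P1 C := insubd p (f @: val p)%VS.

Lemma mobiusE f p : lker f == 0%VS -> val (mobius f p) = (f @: val p)%VS.
Proof.
move=> /eqP f0; rewrite insubdK// unfold_in limg_dim_eq ?(valP p)//.
by rewrite f0 capv0.
Qed.

Lemma lker0_inv f : lker f == 0%VS -> lker (f^-1)%VF == 0%VS.
Proof.
move=> f0; apply/lker0P => u v E.
by rewrite -[u](lker0_lfunVK f0) -[v](lker0_lfunVK f0) E.
Qed.

Lemma mobius_inv f p : lker f == 0%VS ->
  mobius f^-1%VF (mobius f p) = p /\ mobius f (mobius f^-1%VF p) = p.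
Proof.
move=> f0; have f10 := lker0_inv f0.
split; apply/val_inj; rewrite !mobiusE// -limg_comp.
  by rewrite lker0_compVf// lim1g.
by rewrite lker0_compfV// lim1g.
Qed.

Lemma mobius_holomorphic f : lker f == 0%VS -> holomorphic_curve (mobius f).
Proof.
move=> f0 b z0.
(* [chart_vec b z] is affine in [z], so its image under [f] is a vector polynomial of degree at most
   1. *)
pose q (j : 'I_2) := f (if j == 0 then chart_vec b 0 else chart_vec b 1 - chart_vec b 0).
have qE z : veval q z = f (chart_vec b z).
  rewrite /veval !big_ord_recl big_ord0 /q /= expr0 scale1r expr1 addr0 -linearZ -linearD.
  by congr (f _); apply: rV2P; rewrite !mxE; case: (b) => /=; ring.
exists (veval q); split; first exact: holo_veval.
near=> z; rewrite qE; split; last by rewrite mobiusE// /= limg_line.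
by rewrite -(linear0 f) (inj_eq (lker0P f0)) chart_vec0.
Unshelve. all: by end_near. Qed.

Lemma mobius_automorphism f : lker f == 0%VS -> P1_automorphism (mobius f).
Proof.
move=> f0; exists (mobius f^-1%VF); split.
- by move=> p; have [] := mobius_inv p f0.
- by move=> p; have [] := mobius_inv p f0.
- exact: mobius_holomorphic.
- exact: mobius_holomorphic (lker0_inv f0).
Qed.

Lemma mobius_comp f1 f2 p : lker f1 == 0%VS -> lker f2 == 0%VS ->
  lker (f1 \o f2)%VF == 0%VS /\ mobius (f1 \o f2)%VF p = mobius f1 (mobius f2 p).
Proof.
move=> h1 h2; have h12 : lker (f1 \o f2)%VF == 0%VS.
  by apply/lker0P => u v; rewrite !lfunE /= => /(lker0P h1)/(lker0P h2).
by split=> //; apply/val_inj; rewrite !mobiusE// limg_comp.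
Qed.

Definition translation c : 'End('rV[C]_2) :=
  linfun (mulmxr (\matrix_(i, j) (if i == j then 1 else if i == 0 then c else 0))).

Definition inversion : 'End('rV[C]_2) :=
  linfun (mulmxr (\matrix_(i, j) (i != j)%:R)).

Lemma translationE c v : translation c v 0 0 = v 0 0 /\
  translation c v 0 1 = v 0 1 + c * v 0 0.
Proof.
rewrite /translation lfunE /= !mxE !big_ord_recl !big_ord0 !mxE /=.
by rewrite (_ : lift 0 0 = 1)//; [split; ring|apply/val_inj].
Qed.

Lemma inversionE v : inversion v 0 0 = v 0 1 /\ inversion v 0 1 = v 0 0.
Proof.
rewrite /inversion lfunE /= !mxE !big_ord_recl !big_ord0 !mxE /=.
by rewrite (_ : lift 0 0 = 1)//; [split; ring|apply/val_inj].
Qed.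

Lemma translation_inj c : lker (translation c) == 0%VS.
Proof.
apply/lker0P => u v E; have [u0 u1] := translationE c u; have [v0 v1] := translationE c v.
have h0 : u 0 0 = v 0 0 by rewrite -u0 E v0.
by apply: rV2P => //; apply: (addIr (c * u 0 0)); rewrite -u1 E v1 h0.
Qed.

Lemma inversion_inj : lker inversion == 0%VS.
Proof.
apply/lker0P => u v E; have [u0 u1] := inversionE u; have [v0 v1] := inversionE v.
by apply: rV2P; rewrite -?u0 -?u1 E.
Qed.

Lemma mobius_chart f b b' z z' : lker f == 0%VS -> f (chart_vec b z) = chart_vec b' z' ->
  mobius f (chart b z) = chart b' z'.
Proof. by move=> f0 E; apply/val_inj; rewrite mobiusE// /= limg_line E. Qed.

Lemma translation_chart c z :
  mobius (translation c) (chart false z) = chart false (z + c) /\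
  mobius (translation c) (chart true 0) = chart true 0.
Proof.
split; apply: mobius_chart (translation_inj c) _.
  have [u0 u1] := translationE c (chart_vec false z).
  have [v0 v1] := chart_vecE false z; have [w0 w1] := chart_vecE false (z + c).
  by apply: rV2P; rewrite ?u0 ?u1 ?v0 ?v1 ?w0 ?w1 ?mulr1.
have [u0 u1] := translationE c (chart_vec true 0).
have [v0 v1] := chart_vecE true (0 : C).
by apply: rV2P; rewrite ?u0 ?u1 ?v0 ?v1 ?mulr0 ?addr0.
Qed.

Lemma inversion_chart b z : mobius inversion (chart b z) = chart (~~ b) z.
Proof.
apply: mobius_chart inversion_inj _.
have [u0 u1] := inversionE (chart_vec b z).
have [v0 v1] := chart_vecE b z; have [w0 w1] := chart_vecE (~~ b) z.
by apply: rV2P; rewrite ?u0 ?u1 ?v0 ?v1 ?w0 ?w1; case: (b).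
Qed.

Variables (W : vectType C) (d : nat).
Implicit Types (g : P1 C -> projective_space W) (p : 'I_d.+1 -> W).

Lemma parametrizes_ord_max g p : parametrizes g p ->
  p ord_max != 0 /\ val (g (chart true 0)) = <[p ord_max]>%VS.
Proof.
move=> /(_ true 0); rewrite veval0 /flip (_ : rev_ord ord0 = ord_max)//.
by apply/val_inj; rewrite /= subSS subn0.
Qed.

Lemma parametrizes_translation g p c : parametrizes g p ->
  parametrizes (g \o mobius (translation c)) (shift_coef c p).
Proof.
move=> gp; apply: parametrizes_cover => [z|].
  by rewrite veval_shift /= (translation_chart c z).1; exact: (gp false (z + c)).
by rewrite shift_coef_max /= (translation_chart c 0).2; exact: parametrizes_ord_max.
Qed.

Lemma parametrizes_inversion g p : parametrizes g p ->
  parametrizes (g \o mobius inversion) (flip true p).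
Proof.
by move=> gp b z; rewrite -flipK /= inversion_chart; exact: gp.
Qed.
End Mobius.

Section NullCurves.
Variables (K : numClosedFieldType) (W : vectType K) (form : {symmetric W}).
Implicit Types (g : P1 K -> projective_space W) (p : 'I_7 -> W) (z c : K).

Lemma quadric_mixed p z : form (veval p z) (vder p z) =
  (Poly (let g := gram form p in [:: 1%:R * g 0%N 1%N; 2%:R * g 0%N 2%N + 1%:R * g 1%N 1%N;
      3%:R * g 0%N 3%N + 2%:R * g 1%N 2%N + 1%:R * g 2%N 1%N;
      4%:R * g 0%N 4%N + 3%:R * g 1%N 3%N + 2%:R * g 2%N 2%N + 1%:R * g 3%N 1%N;
      5%:R * g 0%N 5%N + 4%:R * g 1%N 4%N + 3%:R * g 2%N 3%N + 2%:R * g 3%N 2%N +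
      1%:R * g 4%N 1%N;
      6%:R * g 0%N 6%N + 5%:R * g 1%N 5%N + 4%:R * g 2%N 4%N + 3%:R * g 3%N 3%N +
      2%:R * g 4%N 2%N + 1%:R * g 5%N 1%N;
      6%:R * g 1%N 6%N + 5%:R * g 2%N 5%N + 4%:R * g 3%N 4%N + 3%:R * g 4%N 3%N +
      2%:R * g 5%N 2%N + 1%:R * g 6%N 1%N;
      6%:R * g 2%N 6%N + 5%:R * g 3%N 5%N + 4%:R * g 4%N 4%N + 3%:R * g 5%N 3%N +
      2%:R * g 6%N 2%N;
      6%:R * g 3%N 6%N + 5%:R * g 4%N 5%N + 4%:R * g 5%N 4%N + 3%:R * g 6%N 3%N;
      6%:R * g 4%N 6%N + 5%:R * g 5%N 5%N + 4%:R * g 6%N 4%N; 6%:R * g 5%N 6%N + 5%:R * g 6%N 5%N; 6%:R * g 6%N 6%N])).[z].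
Proof.
rewrite horner_Poly /veval /vder !sum7E !inordK//=.
rewrite !(formDl, formDr) !(formZl, formZr) /gram; ring.
Qed.

(** This is half the derivative of [form P P = 0], checked here on coefficients. *)
Lemma null_table_mixed p z : null_table form p -> form (veval p z) (vder p z) = 0.
Proof.
move=> [out [g13 g22 g14 g23] [g24 g33] [g25 g34 g35 g44]].
have gC := gramC form p.
have E := (out 0 0, out 0 1, out 0 2, out 0 3, out 1 1, out 1 2, out 3 6, out 4 5, out 4 6,
  out 5 5, out 5 6, out 6 6)%N.
rewrite quadric_mixed horner_Poly /=.
rewrite ?(gC 1 0)%N ?(gC 2 0)%N ?(gC 3 0)%N ?(gC 4 0)%N ?(gC 5 0)%N ?(gC 6 0)%N
  ?(gC 2 1)%N ?(gC 3 1)%N ?(gC 4 1)%N ?(gC 5 1)%N ?(gC 6 1)%N ?(gC 3 2)%N ?(gC 4 2)%N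
  ?(gC 5 2)%N ?(gC 6 2)%N ?(gC 4 3)%N ?(gC 5 3)%N ?(gC 6 3)%N ?(gC 5 4)%N ?(gC 6 4)%N ?(gC 6 5)%N.
rewrite ?E// ?g13 g22 g14 g23 g24 g33 g25 g34 g35 g44; ring.
Qed.

Lemma null_curve_table g p : null_curve form g -> parametrizes g p -> null_table form p.
Proof.
move=> [_ _ hnull] gp; apply: null_lift_table => z.
have [h0 _ h1] := hnull false z _ (parametrizes_lift false z gp).
by rewrite -wderive_veval.
Qed.

Lemma parametrizes_holomorphic d g (p : 'I_d.+1 -> W) :
  parametrizes g p -> holomorphic_curve g.
Proof.
by move=> gp b z; exists (veval (flip b p)); exact: parametrizes_lift.
Qed.

Lemma null_table_flip_any b p : null_table form p -> null_table form (flip b p).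
Proof. by case: b => //; exact: null_table_flip. Qed.

Lemma null_table_curve g p : parametrizes g p -> null_table form p -> null_curve form g.
Proof.
move=> gp np.
have quad b z : form (veval (flip b p) z) (veval (flip b p) z) = 0.
  by have [] := null_table_lift (null_table_flip_any b np) z.
split; first exact: parametrizes_holomorphic gp.
- move=> q w; have [b [z ->]] : exists b z, q = chart b z.
    by have [[z ->]|->] := chart_cover q; [exists false, z|exists true, 0].
  have [_ ->] := gp b z; move=> /vlineP[k ->].
  by rewrite formZl formZr quad !mulr0.
- move=> b z G lG; have lP := parametrizes_lift b z gp.
  (* Since [G' = r' P + r P'], the conditions for [G] are combinations of those for the polynomial
     lift [P]. *)
  have [r [dr r0 GE]] := lift_factor lG lP.
  have Gz : G z = r z *: veval (flip b p) z by exact: nbhs_singleton GE.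
  have npb := null_table_flip_any b np.
  rewrite (wderive_scale dr lP.1 lG.1 GE) Gz wderive_veval.
  have [_ der] := null_table_lift npb z; have mix := null_table_mixed z npb.
  have quadz := quad b z; have mix' := mix; rewrite formC in mix'.
  move: (veval _ z) (vder _ z) (r z) (derive1 r z) quadz mix mix' der => P V a a' PP PV VP VV.
  split; do ?rewrite (formDl, formDr); do ?rewrite (formZl, formZr); rewrite ?PP ?PV ?VP ?VV;
    by rewrite !mulr0 ?addr0.
Qed.

Hypotheses (nd : nondegenerate form) (dW : \dim {:W} = 5%N).

(* [Q.[c]] is a constant multiple of [form P'' P''] at [c]; its roots are the
   nodes to be moved to [0] and to infinity. *)
Definition node_poly p : {poly K} := let g := gram form p in
  Poly [:: g 0%N 4%N; 2 * g 0%N 5%N; g 1%N 5%N + 6 * g 0%N 6%N; 2 * g 1%N 6%N; g 2%N 6%N].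

(** Only a translation is used, so the (2, 6) entry is kept and a node already placed at infinity is
    not lost. *)
Lemma find_node g p : parametrizes g p -> null_table form p ->
  exists f p', [/\ lker f == 0%VS, parametrizes (g \o mobius f) p', null_table form p',
    gram form p' 0 4 = 0 & gram form p' 2 6 = gram form p 2 6].
Proof.
move=> gp np; have [rootQ|noroot] := pselect (exists c, root (node_poly p) c).
  have [c rc] := rootQ.
  exists (translation c), (shift_coef c p); split.
  - exact: translation_inj.
  - exact: parametrizes_translation.
  - exact: null_table_shift.
  - rewrite gram_shift04//; move/eqP: rc => <-.
    by rewrite horner_Poly /=; ring.
  - exact: gram_shift26.
(* A polynomial without roots is a nonzero constant: the case excluded by [null_table_no_node],
   because [p_6] is the value of the lift at infinity. *)
have sz : size (node_poly p) == 1%N.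
  by apply: contrapT => h; apply: noroot; apply/closed_rootP/negP.
have coef k : (0 < k)%N -> (node_poly p)`_k = 0.
  by move=> k0; rewrite nth_default// (eqP sz).
have c0 : (node_poly p)`_0 != 0.
  have := lead_coef_eq0 (node_poly p); rewrite lead_coefE (eqP sz) /= => ->.
  by rewrite -size_poly_eq0 (eqP sz).
have [c1 c2 c3 c4] := And4 (coef 1%N isT) (coef 2%N isT) (coef 3%N isT) (coef 4%N isT).
rewrite !coef_Poly /= in c0 c1 c2 c3 c4.
have two n : n.+1%:R != 0 :> K by rewrite pnatr_eq0.
have p6 : p (inord 6) = 0.
  apply: null_table_no_node nd dW _ np _ _ _ _ _ => //.
  - by move/eqP: c1; rewrite mulf_eq0 (negbTE (two 1%N)) => /eqP.
  - by apply/eqP; rewrite mulNr -addr_eq0; apply/eqP.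
  - by move/eqP: c3; rewrite mulf_eq0 (negbTE (two 1%N)) => /eqP.
have [+ _] := parametrizes_ord_max gp.
by rewrite (_ : ord_max = inord 6) ?p6 ?eqxx//; apply/val_inj; rewrite /= inordK.
Qed.

(** Inversion turns the (0, 4) entry into the (2, 6) entry. A node moved to 0 is thus sent to
    infinity, and a second application of [find_node] supplies one at a finite point. *)
Lemma normal_form g p : parametrizes g p -> null_table form p ->
  exists f p', [/\ lker f == 0%VS, parametrizes (g \o mobius f) p', null_table form p',
    gram form p' 0 4 = 0 & gram form p' 2 6 = 0].
Proof.
move=> gp np; have [f1 [p1 [f10 gp1 np1 p104 _]]] := find_node gp np.
have gp2 := parametrizes_inversion gp1; have np2 := null_table_flip np1.
have gF i j : (i < 7)%N -> (j < 7)%N -> gram form (flip true p1) i j = gram form p1 (6 - j) (6 - i).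
  move=> i7 j7; rewrite gramC /gram /flip; congr (form (p1 _) (p1 _)).
    by apply/val_inj; rewrite /= !inordK//= ltnS leq_subr.
  by apply/val_inj; rewrite /= !inordK//= ltnS leq_subr.
have [f3 [p3 [f30 gp3 np3 p304 p326]]] := find_node gp2 np2.
have [f0 fE] := mobius_comp (chart false (0 : K)) f10 (inversion_inj K).
have [h0 _] := mobius_comp (chart false (0 : K)) f0 f30.
exists ((f1 \o inversion K) \o f3)%VF, p3; split=> //.
  move=> b z; have := gp3 b z; rewrite /=.
  have [_ ->] := mobius_comp (chart b z) f0 f30.
  by have [_ ->] := mobius_comp (mobius f3 (chart b z)) f10 (inversion_inj K).
by rewrite p326 gF//=.
Qed.
End NullCurves.

Section Classification.
Variables (K : numClosedFieldType) (W : vectType K) (form : {symmetric W}).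
Hypotheses (nd : nondegenerate form) (dW : \dim {:W} = 5%N).
Implicit Types (g : P1 K -> projective_space W) (p : 'I_7 -> W) (z c : K) (h : 'I_5 -> W).

Definition unbranched_model h (r : K) : 'I_7 -> W := fun j => nth 0
  [:: h (inord 0); h (inord 1); 0; r *: h (inord 2); 0; - (9 / 4) *: h (inord 3);
      h (inord 4)] j.

Definition branched_model h : 'I_7 -> W := fun j => nth 0
  [:: h (inord 0); 0; h (inord 1); 4 *: h (inord 2); - 9 *: h (inord 3); 0;
      h (inord 4)] j.

Lemma chart_surj (q : P1 K) : exists b z, q = chart b z.
Proof. by have [[z ->]|->] := chart_cover q; [exists false, z|exists true, 0]. Qed.

Lemma veval_linear (A : 'End(W)) s (M p : 'I_7 -> W) b z :
  (forall j, A (M j) = s *: p j) -> A (veval (flip b M) z) = s *: veval (flip b p) z.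
Proof.
move=> AE; rewrite /veval linear_sum scaler_sumr; apply: eq_bigr => j _.
by rewrite linearZ /= /flip AE !scalerA mulrC.
Qed.

Lemma isometry_equivalence g gM f (A : 'End(W)) s (M p : 'I_7 -> W) :
  parametrizes gM M -> lker f == 0%VS -> parametrizes (g \o mobius f) p ->
  lker A == 0%VS -> (forall w, form (A w) (A w) = form w w) -> s != 0 ->
  (forall j, A (M j) = s *: p j) -> projectively_equivalent form gM g.
Proof.
move=> gM_M f0 gp A0 Aform s0 AE.
exists A, (mobius f^-1%VF); split=> //.
- by move=> w; rewrite Aform.
- exact: mobius_automorphism (lker0_inv f0).
- move=> q; have [_ qE] := mobius_inv q f0.
  have [b [z E]] := chart_surj (mobius f^-1%VF q); rewrite E in qE *.
  have gE : val (g q) = <[veval (flip b p) z]>%VS by rewrite -qE; exact: (gp b z).2.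
  have [_ ->] := gM_M b z.
  rewrite gE limg_line (veval_linear _ _ AE).
  apply: line_gen; rewrite ?dim_vline ?(gp b z).1//.
    by apply/vlineP; exists s.
  by rewrite scaler_eq0 negb_or s0 (gp b z).1.
Qed.

Lemma nonlinear_gram g f p : nonlinear g -> lker f == 0%VS ->
  parametrizes (g \o mobius f) p ->
  exists i j, ((i < 7)%N /\ (j < 7)%N) /\ gram form p i j != 0.
Proof.
move=> nl f0 gp; apply: contrapT => all0; apply: nl.
have [|L [dL pL]] := @isotropic_line _ _ form nd dW p.
  move=> i j i7 j7; apply/eqP; apply: contrapT => /negP gij; apply: all0.
  by exists i, j.
exists L; split=> // q; have [_ qE] := mobius_inv q f0.
have [b [z E]] := chart_surj (mobius f^-1%VF q); rewrite E in qE.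
have -> : val (g q) = <[veval (flip b p) z]>%VS by rewrite -qE; exact: (gp b z).2.
rewrite -memvE.
by apply: memv_suml => j _; apply: memvZ; exact: pL.
Qed.

Lemma hyperbolicE (v : nat -> W) :
  (forall i j, (i < 5)%N -> (j < 5)%N -> (i + j)%N != 4%N -> form (v i) (v j) = 0) ->
  form (v 0%N) (v 4%N) = 1 -> form (v 1%N) (v 3%N) = 1 -> form (v 2%N) (v 2%N) = 1 ->
  hyperbolic form (fun i : 'I_5 => v i).
Proof.
move=> off v04 v13 v22 i j; have [ij|ij] := eqVneq (i + j)%N 4%N; last first.
  by rewrite off.
have v40 : form (v 4%N) (v 0%N) = 1 by rewrite formC.
have v31 : form (v 3%N) (v 1%N) = 1 by rewrite formC.
by case: i j ij => [[|[|[|[|[|//]]]]] ?] [[|[|[|[|[|//]]]]] ?].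
Qed.

Theorem null_sextic_classification g p h r g1 g2 : hyperbolic form h -> 2 * r ^+ 2 = 5 ->
  parametrizes g1 (unbranched_model h r) -> parametrizes g2 (branched_model h) ->
  parametrizes g p -> null_table form p -> nonlinear g ->
  projectively_equivalent form g1 g \/ projectively_equivalent form g2 g.
Proof.
move=> hh r2 gp1 gp2 gp np nl.
have two n : n.+1%:R != 0 :> K by rewrite pnatr_eq0.
have r0 : r != 0.
  by apply: contraTneq (two 4%N) => r0; rewrite negbK -r2 r0 expr0n mulr0.
have [f [q [f0 gq nq q04 q26]]] := normal_form nd dW gp np.
have q0 : q (inord 0) != 0.
  have [+ _] := gq false 0; rewrite veval0 /flip (_ : ord0 = inord 0)//.
  by apply/val_inj; rewrite /= inordK.
have [b0 [off cases]] := null_table_cases nd dW nq q04 q26 q0 (nonlinear_gram nl f0 gq).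
move: b0 cases; set b := gram form q 0 6 => b0 cases.
(* Dividing the lift by [s] normalizes the (0, 6) entry to 1. The other factors in [v] undo the
   coefficients of the model, so that [A] carries the model to [s^-1 q]. *)
pose s := sqrtC b; have ss : s * s = b by rewrite -expr2 sqrtCK.
have s0 : s != 0 by rewrite sqrtC_eq0.
have i0 : (inord 0 : 'I_7) = 0 :> nat by rewrite inordK.
case: cases => [[q1 q5 q24 q33]|[q2 q4 q15 q33]].
- right; pose v i := nth 0 [:: s^-1 *: q (inord 0); s^-1 *: q (inord 2); (s * 4)^-1 *: q (inord 3);
    - (s * 9)^-1 *: q (inord 4); s^-1 *: q (inord 6)] i.
  have hv : hyperbolic form (fun i : 'I_5 => v i).
    apply: hyperbolicE.
    + by move=> [|[|[|[|[|i]]]]] [|[|[|[|[|j]]]]] //= _ _ _; rewrite formZl formZr -/(gram form q _ _) off ?mulr0.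
    + rewrite /v /= formZl formZr -/b mulrA -invfM ss mulVf//.
    + rewrite /v /= formZl formZr -/(gram form q 2 4) q24 -ss; field.
      by rewrite ?s0 ?two.
    + rewrite /v /= formZl formZr -/(gram form q 3 3) q33 -ss; field.
      by rewrite ?s0 ?two.
  have [A [A0 Aform Ah]] := hyperbolic_isometry nd dW hh hv.
  apply: (isometry_equivalence gp2 f0 gq A0 Aform (invr_neq0 s0)) => j.
  have [k k7 ->] := ord7P j; rewrite /branched_model inordK//.
  case: k k7 => [|[|[|[|[|[|[|k]]]]]]] //= _; rewrite ?[A (_ *: _)]linearZ ?linear0 /= ?Ah /v ?inordK//=;
    rewrite ?q1 ?q5 ?scaler0 ?scalerA//; congr (_ *: _); field; by rewrite ?s0 ?two.
- left; pose v i := nth 0 [:: s^-1 *: q (inord 0); s^-1 *: q (inord 1); (s * r)^-1 *: q (inord 3);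
    - (4 / (s * 9)) *: q (inord 5); s^-1 *: q (inord 6)] i.
  have hv : hyperbolic form (fun i : 'I_5 => v i).
    apply: hyperbolicE.
    + by move=> [|[|[|[|[|i]]]]] [|[|[|[|[|j]]]]] //= _ _ _; rewrite formZl formZr -/(gram form q _ _) off ?mulr0.
    + rewrite /v /= formZl formZr -/b mulrA -invfM ss mulVf//.
    + rewrite /v /= formZl formZr -/(gram form q 1 5).
      have -> : gram form q 1 5 = - 9 * (s * s) / 4 by rewrite ss -q15 mulrC mulKf.
      field; by rewrite ?s0 ?two.
    + rewrite /v /= formZl formZr -/(gram form q 3 3).
      have -> : gram form q 3 3 = r ^+ 2 * (s * s).
        by apply: (mulfI (two 1%N)); rewrite q33 -r2 ss; ring.
      by field; rewrite s0 r0.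
  have [A [A0 Aform Ah]] := hyperbolic_isometry nd dW hh hv.
  apply: (isometry_equivalence gp1 f0 gq A0 Aform (invr_neq0 s0)) => j.
  have [k k7 ->] := ord7P j; rewrite /unbranched_model inordK//.
  case: k k7 => [|[|[|[|[|[|[|k]]]]]]] //= _; rewrite ?[A (_ *: _)]linearZ ?linear0 /= ?Ah /v ?inordK//=;
    rewrite ?q2 ?q4 ?scaler0 ?scalerA//; congr (_ *: _); field; by rewrite ?s0 ?r0 ?two.
Qed.
End Classification.

(** * The two models *)

Section RationalCurves.
Variables (K : numClosedFieldType) (W : vectType K) (d : nat).
Implicit Types (g : P1 K -> projective_space W) (p : 'I_d.+1 -> W) (z c : K).
Implicit Types (lam : 'Hom(W, K^o)).

Lemma chart_true0_neq z : chart false z <> chart true 0.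
Proof. by move=> /chart_eqP /= [z0 /esym/eqP]; rewrite invr_eq0 (negbTE z0). Qed.

Lemma parametrizes_exists p : (forall z, veval p z != 0) -> p ord_max != 0 ->
  exists g, parametrizes g p.
Proof.
move=> pz pm.
have line (v : W) : v != 0 -> exists L : projective_space W, val L = <[v]>%VS.
  move=> v0; have dv : \dim <[v]>%VS == 1%N by rewrite dim_vline v0.
  by exists (exist (fun L : {vspace W} => \dim L == 1%N) _ dv).
have /choice[g gE] (q : P1 K) : exists L : projective_space W,
    (forall z, q = chart false z -> val L = <[veval p z]>%VS) /\
    (q = chart true 0 -> val L = <[p ord_max]>%VS).
  have [[z ->]|->] := chart_cover q.
    have [L LE] := line _ (pz z); exists L; split; last by move=> /chart_true0_neq.
    by move=> w /(@chart_inj _ false) <-.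
  have [L LE] := line _ pm; exists L; split=> // w /esym/chart_true0_neq [].
exists g; apply: parametrizes_cover => [z|]; split=> //.
  by apply: (gE _).1.
by apply: (gE _).2.
Qed.

Lemma incidence_finite g p lam z : parametrizes g p ->
  (val (g (chart false z)) <= lker lam)%VS = ((lpoly lam p).[z] == 0).
Proof.
by move=> /(_ false z)[_ ->]; rewrite -memvE memv_ker lpolyE.
Qed.

Lemma incidence_infinity g p lam : parametrizes g p ->
  (val (g (chart true 0)) <= lker lam)%VS = (lam (p ord_max) == 0).
Proof.
by move=> /parametrizes_ord_max[_ ->]; rewrite -memvE memv_ker.
Qed.

Lemma prod_count_root (rs : seq K) z : \prod_(x <- rs) ('X - x%:P) =
  \prod_(x <- rs | x != z) ('X - x%:P) * ('X - z%:P) ^+ count_mem z rs.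
Proof.
elim: rs => [|x rs ih]; first by rewrite !big_nil mulr1.
rewrite !big_cons ih /=; case: eqVneq => [->|xz] /=.
  by rewrite add1n exprS mulrCA.
by rewrite add0n mulrA.
Qed.

Lemma sum_count_undup (T : eqType) (s : seq T) :
  (\sum_(x <- undup s) count_mem x s)%N = size s.
Proof.
rewrite -[RHS](perm_size (perm_count_undup s)) size_flatten /shape -map_comp.
rewrite sumnE big_map; apply: eq_bigr => x _ /=.
by rewrite size_nseq.
Qed.

(** The hyperplane cuts out the roots of [f], and infinity with multiplicity [d - deg f]. *)
Theorem parametrizes_degree g p : parametrizes g p -> has_degree g d.
Proof.
move=> gp lam [q0 q0lam]; pose f := lpoly lam p.
have f0 : f != 0.
  apply: contra q0lam => /eqP f0; have [[z ->]|->] := chart_cover q0.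
    by rewrite (incidence_finite _ _ gp) -/f f0 horner0.
  by rewrite (incidence_infinity _ gp) -coef_lpoly -/f f0 coef0.
have [rs fE] := closed_field_poly_normal f.
have lc0 : lead_coef f != 0 by rewrite lead_coef_eq0.
have szf : size f = (size rs).+1.
  by rewrite fE size_scale// size_prod_XsubC.
have rootE z : (f.[z] == 0) = (z \in rs).
  by rewrite fE hornerZ mulf_eq0 (negbTE lc0) -[_ == 0]/(root _ z) root_prod_XsubC.
have szd : (size f <= d.+1)%N by exact: size_lpoly.
pose n := (d.+1 - size f)%N.
have szf0 : (0 < size f)%N by rewrite szf.
have nat1 a j : (j < d.+1 - a)%N -> (j <= d)%N /\ (a <= d - j)%N by lia.
have nat2 a : (0 < a)%N -> (a <= d.+1)%N ->
    [/\ (d.+1 - a <= d)%N, (d - (d.+1 - a))%N = a.-1 & (d.+1 - a + a.-1)%N = d].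
  by move=> *; split; lia.
have [nd dn nE] := nat2 _ szf0 szd.
have infE : (lam (p ord_max) == 0) = (0 < n)%N.
  rewrite -coef_lpoly -/f /= subn_gt0 ltnS.
  apply/idP/idP => [fd|fd]; last by rewrite nth_default.
  rewrite -ltnS ltn_neqAle szd andbT; apply: contra lc0 => /eqP sz.
  by rewrite lead_coefE sz.
pose inf : seq (P1 K) := if (0 < n)%N then [:: chart true 0] else [::].
pose m (q : P1 K) := if q == chart true 0 then n else count (fun z => chart false z == q) rs.
have mfin z : m (chart false z) = count_mem z rs.
  rewrite /m ifN; last by apply/eqP; exact: chart_true0_neq.
  by apply: eq_count => x /=; apply/eqP/eqP => [/chart_inj|->].
have minf : m (chart true 0) = n by rewrite /m eqxx.
exists (inf ++ map (chart false) (undup rs)), m; split.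
- rewrite cat_uniq (map_inj_uniq (@chart_inj _ false)) undup_uniq andbT.
  rewrite /inf; case: ifP => _; apply/hasPn => _ /mapP[z _ ->]; last by rewrite in_nil.
  by rewrite inE; apply/eqP; exact: chart_true0_neq.
- move=> q; rewrite mem_cat; have [[z ->]|->] := chart_cover q.
    rewrite (incidence_finite _ _ gp) -/f rootE (mem_map (@chart_inj _ false)) mem_undup.
    rewrite orbC (_ : chart false z \in inf = false) ?orbF//.
    rewrite /inf; case: ifP => _; last by rewrite in_nil.
    by rewrite inE; apply/eqP; exact: chart_true0_neq.
  rewrite (incidence_infinity _ gp) infE /inf; case: ifP => _.
    by rewrite inE eqxx.
  rewrite in_nil orFb; apply/mapP => -[z _ /esym]; exact: chart_true0_neq.
- move=> q; rewrite mem_cat => /orP[|/mapP[z _ ->]].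
    rewrite /inf; case: ifP => // n0; rewrite inE => /eqP ->; rewrite minf.
    exists true, 0, (veval (flip true p)); split=> //; first exact: parametrizes_lift.
    pose fr := lpoly lam (flip true p).
    have frE j : (j <= d)%N -> fr`_j = f`_(d - j).
      move=> jd; rewrite /fr /f !coef_poly ltnS jd ltnS leq_subr /flip.
      congr (lam (p _)); apply/val_inj; rewrite /= !inordK ?ltnS ?leq_subr//.
    (* The [n] lowest coefficients of the reversed polynomial are those of [f] beyond its degree. *)
    have frX : fr = drop_poly n fr * 'X^n.
      rewrite -[LHS](poly_take_drop n) (_ : take_poly n fr = 0) ?add0r//.
      apply/polyP => j; rewrite coef_take_poly coef0; case: ifP => // jn.
      by have [jd fj] := nat1 _ _ jn; rewrite frE// nth_default.
    exists (horner (drop_poly n fr)); split; first exact: holo_horner.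
      by rewrite horner_coef0 coef_drop_poly add0n frE// dn -lead_coefE.
    by near=> w; rewrite lpolyE -/fr {1}frX hornerM hornerXn subr0 mulrC.
  rewrite mfin; exists false, z, (veval p); split=> //.
    exact: (parametrizes_lift false z gp).
  exists (horner (lead_coef f *: \prod_(x <- rs | x != z) ('X - x%:P))); split.
  + exact: holo_horner.
  + rewrite hornerZ mulf_neq0// horner_prod prodf_seq_neq0; apply/allP => x _.
    by apply/implyP => xz; rewrite hornerXsubC subr_eq0 eq_sym.
  + near=> w; rewrite lpolyE -/f {1}fE (prod_count_root rs z) !hornerZ hornerM.
    by rewrite horner_exp hornerXsubC mulrA mulrC.
- rewrite big_cat big_map /=.
  under [X in (_ + X)%N]eq_bigr => z _ do rewrite mfin.
  rewrite sum_count_undup.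
  have -> : (\sum_(q <- inf) m q = n)%N.
    rewrite /inf; case: ifP => h; first by rewrite big_seq1.
    by rewrite big_nil; move: h; case: (n).
  by rewrite -[RHS]nE -/n szf.
Unshelve. all: by end_near. Qed.

(** A functional composed with the projection off [L] vanishes on the whole curve, so its polynomial
    is zero, and hence so are its values on the coefficients. *)
Lemma coef_in_subspace g p (L : {vspace W}) : parametrizes g p ->
  (forall q, (val (g q) <= L)%VS) -> forall j, p j \in L.
Proof.
move=> gp gL j; pose pi := (\1 - projv L)%VF.
have piL v : v \in L -> pi v = 0.
  by move=> vL; rewrite add_lfunE opp_lfunE id_lfunE projv_id// subrr.
suff /eqP : pi (p j) = 0.
  by rewrite add_lfunE opp_lfunE id_lfunE subr_eq0 => /eqP ->; rewrite memv_proj.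
apply: dual_eq => nu; rewrite linear0; pose lam := (nu \o pi)%VF.
have -> : nu (pi (p j)) = lam (p j) by rewrite comp_lfunE.
rewrite -coef_lpoly (_ : lpoly lam p = 0) ?coef0//.
apply: (@poly_eq_cofinite _ _ 0 [::]) => z _; rewrite -lpolyE horner0 comp_lfunE piL ?linear0//.
have [_ E] := gp false z; rewrite memvE -[X in (X <= L)%VS]E; exact: gL.
Qed.
End RationalCurves.

(** * Branch points read in two coordinates *)

Section BranchPoints.
Variables (K : numClosedFieldType) (W : vectType K) (form : {symmetric W}).
Implicit Types (g : P1 K -> projective_space W) (p N : 'I_7 -> W) (z c : K) (u v w : W).

Lemma form_functional u : exists lam : 'Hom(W, K^o), forall v, lam v = form v u.
Proof.
have flin : linear (fun v => form v u : K^o) by move=> a x y; rewrite formDl formZl.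
pose fL : {linear W -> K^o} := HB.pack (fun v => form v u : K^o) (GRing.isLinear.Build _ _ _ _ _ flin).
by exists (linfun fL) => v; rewrite lfunE.
Qed.

(* In the coordinates [form _ u] and [form _ w] the lift reads [(1, a z^k)]. *)
Definition adapted N u w k (a : K) := forall j,
  form (N j) u = (j == 0 :> nat)%:R /\ form (N j) w = a *+ (j == k :> nat).

Lemma adapted_veval N u w k a z : (k < 7)%N -> adapted N u w k a ->
  form (veval N z) u = 1 /\ form (veval N z) w = a * z ^+ k.
Proof.
move=> k7 aN; split; rewrite /veval form_suml.
  rewrite (bigD1 ord0)//= big1 ?addr0 => [|j j0].
    by rewrite formZl (aN _).1 expr0 mulr1.
  by rewrite formZl (aN _).1 -[_ == _ :> nat]/(j == ord0) (negbTE j0) mulr0.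
rewrite (bigD1 (Ordinal k7))//= big1 ?addr0 => [|j jk].
  by rewrite formZl (aN _).2 eqxx mulrC.
by rewrite formZl (aN _).2 -[_ == _ :> nat]/(j == Ordinal k7) (negbTE jk) mulr0.
Qed.

Lemma adapted_vder N u w k a z : (k < 7)%N -> adapted N u w k a ->
  form (vder N z) u = 0 /\ form (vder N z) w = k%:R * z ^+ k.-1 * a.
Proof.
move=> k7 aN; split; rewrite /vder form_suml.
  rewrite big1 => // j _; rewrite formZl (aN _).1; case: eqP => [->|_]; rewrite ?mulr0//.
  by rewrite !mul0r.
rewrite (bigD1 (Ordinal k7))//= big1 ?addr0 => [|j jk].
  by rewrite formZl (aN _).2 eqxx.
by rewrite formZl (aN _).2 -[_ == _ :> nat]/(j == Ordinal k7) (negbTE jk) mulr0.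
Qed.

(** As [form _ u] is identically 1 on the polynomial lift [P], its value on [G] is the factor [rho]
    with [G = rho P], and it is holomorphic. *)
Lemma adapted_lift g p b z G u w k a : (k < 7)%N -> adapted (flip b p) u w k a ->
  parametrizes g p -> local_lift g b z G ->
  exists rho : K -> K, [/\ holomorphic_near rho z, rho z != 0 &
    \forall x \near z, G x = rho x *: veval (flip b p) x /\
      wderive G x = derive1 rho x *: veval (flip b p) x + rho x *: vder (flip b p) x].
Proof.
move=> k7 aN gp lG; have lP := parametrizes_lift b z gp.
have [phi phiE] := form_functional u.
have phiP x : phi (veval (flip b p) x) = 1 by rewrite phiE (adapted_veval x k7 aN).1.
have hrho := holo_functional phi lG.1.
have GE : \forall x \near z, G x = phi (G x) *: veval (flip b p) x.
  by apply: filterS (lift_proportional lP lG) => x [c _ ->]; rewrite linearZ /= phiP /GRing.scale/= mulr1.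
exists (fun x => phi (G x)); split=> //.
  have [c c0 ->] := nbhs_singleton (lift_proportional lP lG).
  by rewrite linearZ /= phiP /GRing.scale/= mulr1.
have hG : \forall x \near z, wholomorphic_near G x.
  apply: (@filter_forall _ _ (fun i x => holomorphic_near (wcoord G i) x) (nbhs z)) => i.
  exact: (near_join (lG.1 i)).
apply: filterS3 hG (near_join GE) hrho => x hGx GEx dx; split.
  exact: nbhs_singleton GEx.
by rewrite -wderive_veval; exact: (wderive_scale dx (holo_veval _ _) hGx GEx).
Qed.

(** If [rho' P + rho P'] vanishes at [z], pairing with [u] gives [rho' = 0], and pairing with [w]
    then gives [k a z^(k - 1) = 0]. For [k = 1] this is absurd; for [k = 2] it leaves [z = 0]. *)
Lemma adapted_branch g p q r : parametrizes g p -> branch_point g q r ->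
  exists b z, q = chart b z /\ forall u w k a, (k < 7)%N -> a != 0 ->
    adapted (flip b p) u w k a -> [/\ k%:R * z ^+ k.-1 = 0 & k = 2%N -> r = 1%N].
Proof.
move=> gp [r0 [b [z [G [lam [-> lG _ [U [hU U0 UE]]]]]]]]; exists b, z; split=> //.
move=> u w k a k7 a0 aN; have [rho [hrho rho0 near_rho]] := adapted_lift k7 aN gp lG.
have kz : k%:R * z ^+ k.-1 = 0.
  have [_ dG] := nbhs_singleton near_rho.
  have := nbhs_singleton UE; rewrite dG subrr expr0n gtn_eqF// scale0r => E.
  have := congr1 (form ^~ u) E; rewrite /= formDl !formZl form0l.
  rewrite (adapted_veval z k7 aN).1 (adapted_vder z k7 aN).1 mulr0 addr0 mulr1 => drho.
  have := congr1 (form ^~ w) E; rewrite /= formDl !formZl form0l drho mul0r add0r.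
  rewrite (adapted_vder z k7 aN).2 => /eqP.
  by rewrite mulrA !mulf_eq0 (negbTE rho0) (negbTE a0) orbF -mulf_eq0 => /eqP.
split=> // k2; move: kz aN; rewrite k2 expr1 => /eqP.
rewrite mulf_eq0 pnatr_eq0 /= => /eqP z0 aN; rewrite z0 in hU U0 UE hrho rho0 near_rho.
apply/eqP; rewrite eqn_leq r0 andbT leqNgt; apply/negP => r2.
have [phi phiE] := form_functional u; have [psi psiE] := form_functional w.
have hphi := holo_functional phi hU; have hpsi := holo_functional psi hU.
(* Eliminating [rho'] between the two coordinates of [G' = x^r U] and dividing by [x] gives [F = H]
   off 0. By continuity this holds at 0, where [H] vanishes if [r >= 2] but [F] does not. *)
pose F x := (2 * a) * rho x.
pose H := (horner ('X ^+ r.-1)) * ((fun x => psi (U x)) * cst 1 + cst (- a) * (horner ('X ^+ 2) * (fun x => phi (U x)))).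
have FH : F 0 = H 0.
  apply: continuous_dnbhs_eq.
  - exact: (holo_continuous (holoM (holo_cst _ _) hrho)).
  - apply: continuousM; first exact: holo_continuous (holo_horner _ _).
    apply: continuousD; first exact: (holo_continuous (holoM hpsi (holo_cst _ _))).
    exact: (holo_continuous (holoM (holo_cst _ _) (holoM (holo_horner _ _) hphi))).
  - rewrite near_withinE; apply: filterS2 near_rho UE => x [_ dG] dU x0.
    have := congr1 (form ^~ u) dU; have := congr1 (form ^~ w) dU.
    rewrite dG /= !(formDl, formZl) (adapted_veval x (k := 2) _ aN).1// (adapted_veval x (k := 2) _ aN).2//.
    rewrite (adapted_vder x (k := 2) _ aN).1// (adapted_vder x (k := 2) _ aN).2// subr0 expr1.
    rewrite mulr0 addr0 mulr1 -phiE -psiE => Ew Eu.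
    change (2 * a * rho x = ('X ^+ r.-1).[x] * (psi (U x) * 1 + - a * (('X ^+ 2).[x] * phi (U x)))).
    rewrite !hornerXn; apply: (mulfI x0).
    have xr : x ^+ r = x * x ^+ r.-1 by rewrite -exprS prednK.
    rewrite xr in Ew Eu.
    have -> : x * (2 * a * rho x) = x * x ^+ r.-1 * psi (U x) - derive1 rho x * (a * x ^+ 2).
      by rewrite -Ew; ring.
    by rewrite Eu; ring.
move: FH; rewrite /F.
have -> : H 0 = 0.
  change (('X ^+ r.-1).[0] * (psi (U 0) * 1 + - a * (('X ^+ 2).[0] * phi (U 0))) = 0).
  by rewrite hornerXn expr0n; case: r r0 r2 {UE H} => [|[|r]] //= _ _; rewrite mul0r.
by move/eqP; rewrite !mulf_eq0 (negbTE a0) (negbTE rho0) pnatr_eq0.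
Qed.

Lemma adapted_branch_point g p b u w a : parametrizes g p -> a != 0 ->
  adapted (flip b p) u w 2 a -> flip b p (inord 1) = 0 -> branch_point g (chart b 0) 1.
Proof.
move=> gp a0 aN N1; split=> //; have [phi phiE] := form_functional u.
set N := flip b p in aN N1 *.
exists b, 0, (veval N), phi; split=> //; first exact: parametrizes_lift.
  by near=> x; rewrite phiE (adapted_veval x _ aN).1.
(* The truncated exponent [j - 2] is harmless: the term [j = 0] has coefficient 0, and [N] vanishes
   at 1. *)
exists (fun x => \sum_(j < 7) (j%:R * x ^+ (j - 2)) *: N j); split.
- move=> i; rewrite (_ : wcoord _ i =
      horner (\sum_(j < 7) (j%:R * coord (vbasis {:W}) i (N j)) *: 'X^(j - 2))).
    exact: holo_horner.
  apply/funext => x; rewrite /wcoord linear_sum horner_sum; apply: eq_bigr => j _.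
  by rewrite linearZ hornerZ hornerXn /= /GRing.scale/=; ring.
- apply/eqP => /(congr1 (form ^~ w)); rewrite /= form0l form_suml.
  have i2 : (2 < 7)%N by [].
  rewrite (bigD1 (Ordinal i2))//= big1 ?addr0 => [|j j2].
    rewrite formZl (aN _).2 subnn expr0 mulr1 => /eqP.
    by rewrite mulf_eq0 pnatr_eq0 /= mulr1n (negbTE a0).
  by rewrite formZl (aN _).2 -[_ == _ :> nat]/(j == Ordinal i2) (negbTE j2) mulr0.
- near=> x; rewrite wderive_veval subr0 expr1 /vder scaler_sumr; apply: eq_bigr => j _.
  have [k k7 ->] := ord7P j; rewrite inordK//.
  case: k k7 => [|[|k]] k7 /=.
  + by rewrite !mul0r scale0r scaler0.
  + by rewrite N1 !scaler0.
  + by rewrite scalerA !subSS subn0 exprS mulrCA.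
Unshelve. all: by end_near. Qed.
End BranchPoints.

Section Models.
Variables (K : numClosedFieldType) (W : vectType K) (form : {symmetric W}).
Variables (h : 'I_5 -> W) (hh : hyperbolic form h) (r : K) (r2 : 2 * r ^+ 2 = 5).
Implicit Types (g : P1 K -> projective_space W) (z c : K) (lam nu : 'Hom(W, K^o)).

Let M1 := unbranched_model h r.
Let M2 := branched_model h.

Lemma hyperbolic_inord i j : (i < 5)%N -> (j < 5)%N ->
  form (h (inord i)) (h (inord j)) = (i + j == 4)%N%:R.
Proof. by move=> i5 j5; rewrite hh !inordK. Qed.

Lemma flip_model (N : 'I_7 -> W) k : (k < 7)%N -> flip true N (inord k) = N (inord (6 - k)).
Proof.
move=> k7; rewrite /flip; congr (N _); apply/val_inj.
by rewrite /= !inordK//= ltnS leq_subr.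
Qed.

Lemma unbranched_model_table : null_table form M1.
Proof.
have r5 : r * r = 5 / 2 by rewrite -expr2 -r2; field.
split.
- move=> i j i7 j7 ij; rewrite /gram /M1 /unbranched_model !inordK//.
  case: i j i7 j7 ij => [|[|[|[|[|[|[|i]]]]]]] [|[|[|[|[|[|[|j]]]]]]] //= _ _ _;
    by rewrite ?(form0l, form0r)// ?formZl ?formZr hyperbolic_inord//= ?mulr0.
- split; rewrite /gram /M1 /unbranched_model !inordK//=;
    by rewrite ?(form0l, form0r)// ?formZl ?formZr ?hyperbolic_inord//= ?mulr0.
- split; rewrite /gram /M1 /unbranched_model !inordK//=;
    rewrite ?(form0l, form0r) ?formZl ?formZr ?hyperbolic_inord//=; last rewrite !mulr1 r5; by field.
- split; rewrite /gram /M1 /unbranched_model !inordK//=;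
    by rewrite ?(form0l, form0r)// ?formZl ?formZr ?hyperbolic_inord//= ?mulr0.
Qed.

Lemma branched_model_table : null_table form M2.
Proof.
split.
- move=> i j i7 j7 ij; rewrite /gram /M2 /branched_model !inordK//.
  case: i j i7 j7 ij => [|[|[|[|[|[|[|i]]]]]]] [|[|[|[|[|[|[|j]]]]]]] //= _ _ _;
    by rewrite ?(form0l, form0r)// ?formZl ?formZr hyperbolic_inord//= ?mulr0.
- split; rewrite /gram /M2 /branched_model !inordK//=;
    by rewrite ?(form0l, form0r)// ?formZl ?formZr ?hyperbolic_inord//= ?mulr0.
- split; rewrite /gram /M2 /branched_model !inordK//=;
    rewrite ?(form0l, form0r) ?formZl ?formZr ?hyperbolic_inord//=; by ring.
- split; rewrite /gram /M2 /branched_model !inordK//=;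
    by rewrite ?(form0l, form0r)// ?formZl ?formZr ?hyperbolic_inord//= ?mulr0.
Qed.

(** Pairing with [h_4] and [h_3] extracts the components along [h_0] and [h_1], which are [1] and
    [z]. At infinity the two ends of the model exchange roles. *)
Lemma unbranched_adapted b : exists u w a, a != 0 /\ adapted form (flip b M1) u w 1 a.
Proof.
have n9 : - (9 / 4) != 0 :> K by rewrite oppr_eq0 mulf_neq0 ?invr_eq0 ?pnatr_eq0.
case: b.
  exists (h (inord 0)), (h (inord 1)), (- (9 / 4)); split=> // j; have [k k7 ->] := ord7P j.
  rewrite flip_model// /M1 /unbranched_model !inordK ?ltnS ?leq_subr//.
  case: k k7 => [|[|[|[|[|[|[|k]]]]]]] //= _;
    by rewrite ?formZl ?form0l ?hyperbolic_inord//= ?mulr0 ?mulr1 ?mulr1n.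
exists (h (inord 4)), (h (inord 3)), 1; split; first exact: oner_neq0.
move=> j; have [k k7 ->] := ord7P j; rewrite /flip /M1 /unbranched_model !inordK//.
case: k k7 => [|[|[|[|[|[|[|k]]]]]]] //= _;
  by rewrite ?formZl ?form0l ?hyperbolic_inord//= ?mulr0 ?mulr1 ?mulr1n.
Qed.

Lemma branched_adapted b : exists u w a, a != 0 /\ adapted form (flip b M2) u w 2 a.
Proof.
have n9 : - 9 != 0 :> K by rewrite oppr_eq0 pnatr_eq0.
case: b.
  exists (h (inord 0)), (h (inord 1)), (- 9); split=> // j; have [k k7 ->] := ord7P j.
  rewrite flip_model// /M2 /branched_model !inordK ?ltnS ?leq_subr//.
  case: k k7 => [|[|[|[|[|[|[|k]]]]]]] //= _;
    by rewrite ?formZl ?form0l ?hyperbolic_inord//= ?mulr0 ?mulr1 ?mulr1n.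
exists (h (inord 4)), (h (inord 3)), 1; split; first exact: oner_neq0.
move=> j; have [k k7 ->] := ord7P j; rewrite /flip /M2 /branched_model !inordK//.
case: k k7 => [|[|[|[|[|[|[|k]]]]]]] //= _;
  by rewrite ?formZl ?form0l ?hyperbolic_inord//= ?mulr0 ?mulr1 ?mulr1n.
Qed.

Lemma adapted_exists (N : 'I_7 -> W) k : (k < 7)%N ->
  (forall b, exists u w a, a != 0 /\ adapted form (flip b N) u w k a) ->
  exists g, parametrizes g N.
Proof.
move=> k7 hN.
have neq0 b z : veval (flip b N) z != 0.
  have [u [w [a [_ aN]]]] := hN b; apply/eqP => E.
  have := (adapted_veval z k7 aN).1; rewrite E form0l => /esym/eqP.
  by rewrite oner_eq0.
apply: parametrizes_exists => [z|]; first exact: neq0 false z.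
by have := neq0 true 0; rewrite veval0 /flip (_ : rev_ord ord0 = ord_max)//; apply/val_inj.
Qed.

(** A plane containing the curve contains the coefficients [h_0, h_1, h_4], which are independent by
    pairing with [h_4, h_3, h_0]. *)
Lemma model_nonlinear g (N : 'I_7 -> W) i : parametrizes g N ->
  N (inord 0) = h (inord 0) -> N (inord i) = h (inord 1) -> N (inord 6) = h (inord 4) ->
  nonlinear g.
Proof.
move=> gN N0 Ni N6 [L [dL gL]]; have NL := coef_in_subspace gN gL.
suff : (3 <= \dim L)%N by rewrite dL.
apply: (@triangular_pairing _ _ form L 3
  (fun k : 'I_3 => nth 0 [:: h (inord 0); h (inord 1); h (inord 4)] k)
  (fun k : 'I_3 => nth 0 [:: h (inord 4); h (inord 3); h (inord 0)] k)).
- by move=> [[|[|[|//]]] ?] /=; rewrite -?N0 -?Ni -?N6.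
- by move=> [[|[|[|//]]] ?] [[|[|[|//]]] ?] //= _; rewrite hyperbolic_inord.
- by move=> [[|[|[|//]]] ?] /=; rewrite hyperbolic_inord//= oner_neq0.
Qed.

Lemma unbranched_model_unbranched g : parametrizes g M1 -> unbranched g.
Proof.
move=> gM q s bq; have [b [z [_ H]]] := adapted_branch form gM bq.
have [u [w [a [a0 aN]]]] := unbranched_adapted b.
have [+ _] := H u w 1%N a isT a0 aN.
by rewrite /= expr0 mulr1 => /eqP; rewrite oner_eq0.
Qed.

Lemma branched_model_branch g : parametrizes g M2 -> forall q s,
  branch_point g q s <-> (q = chart false 0 \/ q = chart true 0) /\ s = 1%N.
Proof.
move=> gM q s; split=> [bq|[qE ->]].
  have [b [z [-> H]]] := adapted_branch form gM bq.
  have [u [w [a [a0 aN]]]] := branched_adapted b.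
  have [+ s1] := H u w 2%N a isT a0 aN.
  rewrite expr1 => /eqP; rewrite mulf_eq0 pnatr_eq0 /= => /eqP ->.
  by split; [case: (b); [right|left]|exact: s1].
have M21 b : flip b M2 (inord 1) = 0.
  case: b; first by rewrite flip_model// /M2 /branched_model inordK.
  by rewrite /flip /M2 /branched_model inordK.
case: qE => ->.
  have [u [w [a [a0 aN]]]] := branched_adapted false.
  exact: (adapted_branch_point gM a0 aN (M21 false)).
have [u [w [a [a0 aN]]]] := branched_adapted true.
exact: (adapted_branch_point gM a0 aN (M21 true)).
Qed.
End Models.

(** * Inequivalence of the two models *)

Section Incidence.
Variables (K : numClosedFieldType) (W : vectType K) (form : {symmetric W}).
Implicit Types (g : P1 K -> projective_space W) (z c : K) (lam mu nu : 'Hom(W, K^o)) (f : {poly K}).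

(* A projective invariant expressed through the sets where hyperplanes meet the
   curve, multiplicities ignored, hence unaffected by any bijective reparametrization. *)
Definition has_secant_pair g := exists q1 q2 lam mu,
  [/\ q1 <> q2, forall q, (val (g q) <= lker lam)%VS <-> q = q1,
      forall q, (val (g q) <= lker mu)%VS <-> q = q1 \/ q = q2
    & forall nu, ~ (forall q, (val (g q) <= lker nu)%VS <-> q = q2)].

Lemma has_secant_pair_equivalent g g' :
  projectively_equivalent form g g' -> has_secant_pair g -> has_secant_pair g'.
Proof.
move=> [A [phi [A0 _ [psi [phiK psiK _ _]] gE]]] [q1 [q2 [lam [mu [q12 hlam hmu hnu]]]]].
have pull nu q : (val (g' q) <= lker (nu \o A^-1)%VF)%VS = (val (g (phi q)) <= lker nu)%VS.
  have [v0 vE] := vpick_line (g (phi q)).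
  by rewrite gE vE limg_line -!memvE !memv_ker comp_lfunE /= lker0_lfunK.
have pull' nu q : (val (g' q) <= lker nu)%VS = (val (g (phi q)) <= lker (nu \o A)%VF)%VS.
  have [v0 vE] := vpick_line (g (phi q)).
  by rewrite gE vE limg_line -!memvE !memv_ker comp_lfunE.
have phiE q q' : phi q = q' <-> q = psi q'.
  by split=> [<-|->]; rewrite ?phiK ?psiK.
exists (psi q1), (psi q2), (lam \o A^-1)%VF, (mu \o A^-1)%VF; split.
- by move=> /(congr1 phi); rewrite !psiK.
- by move=> q; rewrite pull -phiE; exact: hlam.
- by move=> q; rewrite pull -!phiE; exact: hmu.
- move=> nu hnu'; apply: (hnu (nu \o A)%VF) => q.
  rewrite -[q in val (g q)]psiK -pull'; split=> [/hnu'/(congr1 phi)|->].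
    by rewrite !psiK.
  exact: (hnu' (psi q2)).2.
Qed.

Lemma single_root_poly f c : (forall z, root f z -> z = c) ->
  f = lead_coef f *: ('X - c%:P) ^+ (size f).-1.
Proof.
have [->|f0] := eqVneq f 0; first by rewrite lead_coef0 scale0r.
have [rs fE] := closed_field_poly_normal f => hc.
have lc0 : lead_coef f != 0 by rewrite lead_coef_eq0.
have rsc : rs = nseq (size rs) c.
  apply/all_pred1P/allP => x xrs; apply/eqP/hc.
  by rewrite fE rootZ// root_prod_XsubC.
have szf : (size f).-1 = size rs.
  by rewrite fE size_scale// size_prod_XsubC.
by rewrite szf [LHS]fE {1}rsc big_nseq -Monoid.iteropE.
Qed.

Lemma coef1_XsubC_exp (k : K) n c :
  (k *: ('X - c%:P) ^+ n)`_1 = k * (n%:R * (- c) ^+ n.-1).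
Proof.
have -> : (k *: ('X - c%:P) ^+ n)`_1 = (k *: ('X - c%:P) ^+ n)^`().[0].
  by rewrite horner_coef0 coef_deriv mulr1n.
rewrite derivZ deriv_exp derivXsubC mul1r hornerZ hornerMn horner_exp hornerXsubC sub0r.
by rewrite mulr_natl.
Qed.

Lemma coef2_XsubC_exp (k : K) n c :
  (k *: ('X - c%:P) ^+ n)`_2 *+ 2 = k * ((n * n.-1)%:R * (- c) ^+ n.-2).
Proof.
have -> : (k *: ('X - c%:P) ^+ n)`_2 *+ 2 = (k *: ('X - c%:P) ^+ n)^`()^`().[0].
  by rewrite horner_coef0 !coef_deriv mulr1n.
rewrite derivZ deriv_exp derivXsubC mul1r derivZ derivMn deriv_exp derivXsubC mul1r.
rewrite hornerZ !hornerMn horner_exp hornerXsubC sub0r.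
by rewrite natrM; ring.
Qed.

Variables (h : 'I_5 -> W) (hh : hyperbolic form h) (r : K).
Let M1 := unbranched_model h r.
Let M2 := branched_model h.
Let hf := hyperbolic_inord hh.

Lemma ord_max7 : (ord_max : 'I_7) = inord 6.
Proof. by apply/val_inj; rewrite /= inordK. Qed.

Lemma veval7 (N : 'I_7 -> W) z u : form (veval N z) u =
  form (N (inord 0)) u + (z * form (N (inord 1)) u + (z ^+ 2 * form (N (inord 2)) u +
  (z ^+ 3 * form (N (inord 3)) u + (z ^+ 4 * form (N (inord 4)) u +
  (z ^+ 5 * form (N (inord 5)) u + z ^+ 6 * form (N (inord 6)) u))))).
Proof.
by rewrite /veval sum7E !inordK// !formDl !formZl expr0 expr1 mul1r.
Qed.

Lemma lpoly_coef lam (N : 'I_7 -> W) k : (k < 7)%N -> (lpoly lam N)`_k = lam (N (inord k)).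
Proof. by move=> k7; rewrite -coef_lpoly inordK. Qed.

Lemma size7 lam (N : 'I_7 -> W) : lam (N (inord 6)) != 0 -> size (lpoly lam N) = 7%N.
Proof.
rewrite -lpoly_coef// => c6; apply/eqP; rewrite eqn_leq size_lpoly /=.
by rewrite ltnNge; apply: contra c6 => sz; rewrite nth_default.
Qed.

Lemma unbranched_secant_pair g : parametrizes g M1 -> has_secant_pair g.
Proof.
move=> gM.
have [lam lamE] := form_functional form (h (inord 0)).
(* Pairing with [h_1] reads the term [-(9/4) z^5]; the factor [4 / 9] makes the restriction
   [z^6 - z^5]. *)
have [mu muE] := form_functional form (h (inord 0) + (4 / 9) *: h (inord 1)).
have lamP z : (lpoly lam M1).[z] = z ^+ 6.
  rewrite -lpolyE lamE veval7 /M1 /unbranched_model !inordK//= !form0l !formZl !hf//=; by ring.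
have muP z : (lpoly mu M1).[z] = z ^+ 5 * (z - 1).
  rewrite -lpolyE muE veval7 /M1 /unbranched_model !inordK//=.
  rewrite !form0l !formZl !formDr !formZr !hf//=; by field.
exists (chart false 0), (chart false 1), lam, mu; split.
- by move=> /(@chart_inj _ false)/esym/eqP; rewrite oner_eq0.
- move=> q; have [[z ->]|->] := chart_cover q.
    rewrite (incidence_finite _ _ gM) lamP expf_eq0 /=.
    by split=> [/eqP->//|/(@chart_inj _ false) ->].
  rewrite (incidence_infinity _ gM) ord_max7 lamE /M1 /unbranched_model inordK//= hf//= oner_eq0.
  by split=> // /esym/chart_true0_neq.
- move=> q; have [[z ->]|->] := chart_cover q.
    rewrite (incidence_finite _ _ gM) muP mulf_eq0 expf_eq0 /= subr_eq0.
    split=> [/orP[]/eqP ->|[]/(@chart_inj _ false) ->]; rewrite ?eqxx ?orbT//; by [left|right].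
  rewrite (incidence_infinity _ gM) ord_max7 muE /M1 /unbranched_model inordK//=.
  rewrite formDr formZr !hf//= mulr0 addr0 oner_eq0.
  by split=> // -[] /esym/chart_true0_neq.
(* A hyperplane meeting the curve at [1] alone would restrict to a multiple of [(z - 1)^6], whose
   [z^2] term is nonzero, whereas this model has no [z^2] term. *)
- move=> nu Znu.
  have n6 : nu (M1 (inord 6)) != 0.
    rewrite -ord_max7 -(incidence_infinity _ gM); apply/negP => /Znu /esym.
    exact: chart_true0_neq.
  have fE : lpoly nu M1 = lead_coef (lpoly nu M1) *: ('X - 1%:P) ^+ (size (lpoly nu M1)).-1.
    apply: single_root_poly => z rz; apply: (@chart_inj _ false); apply/Znu.
    by rewrite (incidence_finite _ _ gM).
  have lc0 : lead_coef (lpoly nu M1) != 0 by rewrite lead_coef_eq0 -size_poly_eq0 size7.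
  rewrite size7// in fE; have := coef2_XsubC_exp (lead_coef (lpoly nu M1)) 6 1.
  rewrite -[(7.-1)%N]/6%N in fE; rewrite -fE lpoly_coef// {1}/M1 /unbranched_model inordK//= linear0 mul0rn.
  move/esym/eqP; rewrite !mulf_eq0 (negbTE lc0) pnatr_eq0 /=.
  by rewrite !oppr_eq0 oner_eq0.
Qed.

Lemma branched_no_secant_pair g : parametrizes g M2 -> ~ has_secant_pair g.
Proof.
move=> gM [q1 [q2 [lam [mu [q12 Zlam Zmu Znu]]]]].
have M21 : M2 (inord 1) = 0 by rewrite /M2 /branched_model inordK.
have M25 : M2 (inord 5) = 0 by rewrite /M2 /branched_model inordK.
(* Neither infinity nor 0 can be [q2]: pairing with [h_4] gives the constant 1, and with [h_0] gives
   [z^6], so hyperplanes do meet the curve at these points alone. *)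
have [c q2E] : exists c, q2 = chart false c.
  have [//|q2E] := chart_cover q2; exfalso.
  have [nu nuE] := form_functional form (h (inord 4)); apply: (Znu nu) => q; rewrite q2E.
  have [[z ->]|->] := chart_cover q.
    rewrite (incidence_finite _ _ gM) -lpolyE nuE veval7 /M2 /branched_model !inordK//=.
    rewrite !form0l !formZl !hf//= !mulr0 !addr0 oner_eq0.
    by split=> // /chart_true0_neq.
  rewrite (incidence_infinity _ gM) ord_max7 nuE /M2 /branched_model inordK//= hf//=.
have c0 : c != 0.
  apply/eqP => c0; have [nu nuE] := form_functional form (h (inord 0)).
  apply: (Znu nu) => q; rewrite q2E c0.
  have [[z ->]|->] := chart_cover q.
    rewrite (incidence_finite _ _ gM) -lpolyE nuE veval7 /M2 /branched_model !inordK//=.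
    rewrite !form0l !formZl !hf//= !mulr0 !add0r mulr1 expf_eq0 /=.
    by split=> [/eqP->//|/(@chart_inj _ false) ->].
  rewrite (incidence_infinity _ gM) ord_max7 nuE /M2 /branched_model inordK//= hf//= oner_eq0.
  by split=> // /esym/chart_true0_neq.
pose f := lpoly mu M2.
have fc : root f c by rewrite /root -(incidence_finite _ _ gM); apply/Zmu; right.
have f1 : f`_1 = 0 by rewrite lpoly_coef// M21 linear0.
have f5 : f`_5 = 0 by rewrite lpoly_coef// M25 linear0.
have [[e q1E]|q1E] := chart_cover q1.
  have l6 : lam (M2 (inord 6)) != 0.
    rewrite -ord_max7 -(incidence_infinity _ gM); apply/negP => /Zlam; rewrite q1E => /esym.
    exact: chart_true0_neq.
  have m6 : mu (M2 (inord 6)) != 0.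
    rewrite -ord_max7 -(incidence_infinity _ gM); apply/negP => /Zmu; rewrite q1E q2E.
    by case=> /esym; exact: chart_true0_neq.
  (* The linear coefficient [-6 e^5] of [(z - e)^6] must vanish, since the model has no linear
     term. *)
  have e0 : e = 0.
    have lE : lpoly lam M2 = lead_coef (lpoly lam M2) *: ('X - e%:P) ^+ 6.
      rewrite {1}(@single_root_poly (lpoly lam M2) e) ?size7// => z rz.
      apply: (@chart_inj _ false); rewrite -q1E; apply/Zlam.
      by rewrite (incidence_finite _ _ gM).
    have lc0 : lead_coef (lpoly lam M2) != 0 by rewrite lead_coef_eq0 -size_poly_eq0 size7.
    have := coef1_XsubC_exp (lead_coef (lpoly lam M2)) 6 e.
    rewrite -lE lpoly_coef// M21 linear0 => /esym/eqP.
    by rewrite mulf_eq0 (negbTE lc0) mulf_eq0 pnatr_eq0 expf_eq0 oppr_eq0 => /= /eqP.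
  have [rs fE] := closed_field_poly_normal f.
  have szf : size f = 7%N by exact: size7.
  have lc0 : lead_coef f != 0 by rewrite lead_coef_eq0 -size_poly_eq0 szf.
  have rootE z : root f z = (z \in rs) by rewrite fE rootZ// root_prod_XsubC.
  have szrs : size rs = 6%N.
    by have := szf; rewrite fE size_scale// size_prod_XsubC => -[].
  have rsP z : z \in rs -> z = 0 \/ z = c.
    rewrite -rootE /root -(incidence_finite _ _ gM) => /Zmu; rewrite q1E q2E e0.
    by case=> /(@chart_inj _ false) ->; [left|right].
  (* The model has no [z^5] term, so the six roots sum to zero. They are all [0] or [c], so [c]
     would have multiplicity 0. *)
  have sum0 : \sum_(x <- rs) x = 0.
    have := f5; rewrite fE coefZ => /eqP; rewrite mulf_eq0 (negbTE lc0) /= => /eqP.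
    have := @coefPn_prod_XsubC _ rs; rewrite szrs => /(_ isT) /= -> /eqP.
    by rewrite oppr_eq0 => /eqP.
  have sumc : \sum_(x <- rs) x = c *+ count_mem c rs.
    elim: (rs) rsP => [|x s ih] sP; first by rewrite big_nil.
    rewrite big_cons /= mulrnDr -ih => [|z zs]; last by apply: sP; rewrite in_cons zs orbT.
    congr (_ + _); have [->|->] := sP x (mem_head _ _); first by rewrite eq_sym (negbTE c0).
    by rewrite eqxx.
  move: sum0; rewrite sumc => /eqP; rewrite mulrn_eq0 (negbTE c0) orbF.
  by rewrite -leqn0 leqNgt -has_count has_pred1 -rootE fc.
have f0 : f != 0.
  apply/eqP => f0; have : (val (g (chart false 0)) <= lker mu)%VS.
    by rewrite (incidence_finite _ _ gM) -/f f0 horner0.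
  move/Zmu; rewrite q1E q2E => -[/chart_true0_neq//|/(@chart_inj _ false) c00].
  by rewrite -c00 eqxx in c0.
(* With [q1] at infinity, [c] is the only finite root. The linear coefficient of [(z - c)^n] is then
   nonzero, again contrary to the missing linear term. *)
have fE : f = lead_coef f *: ('X - c%:P) ^+ (size f).-1.
  apply: single_root_poly => z rz.
  have /Zmu : (val (g (chart false z)) <= lker mu)%VS by rewrite (incidence_finite _ _ gM).
  by rewrite q1E q2E => -[/chart_true0_neq//|/(@chart_inj _ false)].
have := coef1_XsubC_exp (lead_coef f) (size f).-1 c; rewrite -fE f1 => /esym/eqP.
rewrite !mulf_eq0 lead_coef_eq0 (negbTE f0) expf_eq0 oppr_eq0 (negbTE c0) andbF orbF /=.
rewrite pnatr_eq0 -leqn0 leqNgt -subn1 subn_gt0.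
by rewrite (root_size_gt1 f0 fc).
Qed.
End Incidence.

Theorem proposition7 (R : realType) (W : vectType R[i]) (form : {symmetric W})
    (dimW : \dim {:W} = 5%N) (form_nondeg : nondegenerate form) :
  let sextic (g : P1 R[i] -> projective_space W) :=
    [/\ null_curve form g, nonlinear g & has_degree g 6] in
  exists g1 g2 : P1 R[i] -> projective_space W,
    [/\ sextic g1, sextic g2,
        ~ projectively_equivalent form g1 g2
      & forall g, sextic g ->
          projectively_equivalent form g1 g \/ projectively_equivalent form g2 g]
    /\ unbranched g1
    /\ exists p1 p2 : P1 R[i], p1 <> p2 /\
         forall p r, branch_point g2 p r <-> (p = p1 \/ p = p2) /\ r = 1%N.
Proof.
move=> sextic.
have [h hh] := hyperbolic_exists form_nondeg dimW.
(* [r^2] is the (3, 3) Gram entry of the unbranched model, fixed at [5/2] by [2 g_33 = 5 b] with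
   [b = 1]. *)
pose r : R[i] := sqrtC (5 / 2).
have r2 : 2 * r ^+ 2 = 5 :> R[i] by rewrite sqrtCK mulrC divfK ?pnatr_eq0.
have [g1 gM1] := adapted_exists (isT : (1 < 7)%N) (unbranched_adapted hh r).
have [g2 gM2] := adapted_exists (isT : (2 < 7)%N) (branched_adapted hh).
have s1 : sextic g1.
  split; last exact: (parametrizes_degree gM1).
    exact: (null_table_curve gM1 (unbranched_model_table hh r2)).
  by apply: (model_nonlinear (i := 1) hh gM1); rewrite /unbranched_model inordK.
have s2 : sextic g2.
  split; last exact: (parametrizes_degree gM2).
    exact: (null_table_curve gM2 (branched_model_table hh)).
  by apply: (model_nonlinear (i := 2) hh gM2); rewrite /branched_model inordK.
exists g1, g2; split; [split=> //|split].
- move=> /has_secant_pair_equivalent /(_ (unbranched_secant_pair hh gM1)).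
  exact: (branched_no_secant_pair hh gM2).
- move=> g [gnull gnl gdeg]; have [ghol _ _] := gnull.
  have [p gp] := rational_parametrization ghol gdeg.
  exact: (null_sextic_classification form_nondeg dimW hh r2 gM1 gM2 gp
            (null_curve_table gnull gp) gnl).
- exact: (unbranched_model_unbranched hh gM1).
- exists (chart false 0), (chart true 0); split; first exact: chart_true0_neq.
  exact: (branched_model_branch hh gM2).
Qed.
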